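(* Let $M=(M^{2m+1};\varphi,\xi,\eta,g)\in\mathcal B_2^a$, that is, $M$ is an almost semi-cosymplectic manifold, and let $f:M\to N$ be a $(\pm)$-holomorphic map. (1) If $N\in\mathcal A_1\cup\mathcal A_2\cup\mathcal A_3\cup\mathcal A_5\cup\mathcal A_6$, then (i) $f$ is constant along $D^M$; (ii) there is no non-constant $(\pm)$-holomorphic weakly conformal map from $M$ into $N$. (2) If $N\in\mathcal A_1\cup\mathcal A_2\cup\mathcal A_3\cup\mathcal A_4\cup\mathcal A_5\cup\mathcal A_6$, then $f$ is harmonic if and only if $\lambda$ is constant along $\xi$. (3) If $N\in\mathcal B_1$, then $f$ is harmonic if and only if $\lambda$ is constant along $\xi$. In particular, if $\lambda=0$ (or equivalently $f_*\xi=0$) and $M$ is of one of the types in $\mathcal B_1$ other than nearly cosymplectic (i.e. $M$ is cosymplectic, almost cosymplectic, nearly-$\mathcal K$-cosymplectic or quasi-$\mathcal K$-cosymplectic), then $f$ is also pluriharmonic. (4) If $N\in\mathcal B_1$ and $f$ is weakly conformal, then (i) $f$ is harmonic and homothetic with minimal image if $\lambda$ is constant along $\xi$; (ii) $\lambda$ is constant if $f$ is harmonic. (5) If $N\in\mathcal B_3$ (almost $\beta_N$-Kenmotsu), then: (i) $f$ is harmonic if and only if $d\lambda(\xi)-2\beta_N\sum_{i=1}^mh(E_i,E_i)=0$. (ii)(a) Any two of the following imply the third: $f$ is harmonic; $\lambda$ is constant along $\xi$; $f$ is constant along $D^M$. (ii)(b) If $\lambda=0$ (or equivalently $f_*\xi=0$),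 then $f$ is harmonic if and only if it is constant. (iii) If $f$ is weakly conformal, then $f$ is harmonic if and only if it is constant. (6) If $N\in\mathcal C_1$, then $f$ is harmonic. In particular, if $M$ is of one of the types in $\mathcal B_1$ other than nearly cosymplectic (in the sense of (3)), then any $(\pm)$-holomorphic map from $M$ into $N$ is pluriharmonic (and thus harmonic). (7) If $N$ is an almost Hermitian manifold, then there is no non-constant $(\pm)$-holomorphic weakly conformal map from $M$ into $N$.
   Context: Manifolds and maps are smooth; $\nabla$ denotes Levi-Civita connections. An almost contact metric manifold $M=(M^{2m+1};\varphi,\xi,\eta,g)$ is a $(2m+1)$-dimensional Riemannian manifold with a $(1,1)$-tensor $\varphi$, a vector field $\xi$ and a 1-form $\eta$ such that $\varphi^2X=-X+\eta(X)\xi$, $\eta(\xi)=1$, $g(\varphi X,\varphi Y)=g(X,Y)-\eta(X)\eta(Y)$. Put $D^M=\varphi(TM)=\ker\eta$, $\Omega(X,Y)=g(X,\varphi Y)$, $P(X,Y)=(\nabla_X\varphi)Y+(\nabla_{\varphi X}\varphi)\varphi Y$, $Q(X,Y)=(\nabla_X\varphi)Y+(\nabla_Y\varphi)X$, $W_X=\nabla_XX+\nabla_{\varphi X}(\varphi X)$, $2\mathfrak h=\mathcal L_\xi\varphi$. Conventions: $2d\eta(X,Y)=X\eta(Y)-Y\eta(X)-\eta([X,Y])$; $d\Omega(X,Y,Z)$ is the cyclic sum of $(\nabla_X\Omega)(Y,Z)$ and $(\eta\wedge\Omega)(X,Y,Z)$ the cyclic sum of $\eta(X)\Omega(Y,Z)$;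 $\{e_i;\varphi e_i;\xi\}_{1\le i\le m}$ is any local orthonormal frame; $\delta\eta=\eta(\sum_iW_{e_i})=-\operatorname{div}\xi$; $\delta\Omega(X)=g(-\varphi(\nabla_\xi\xi)+\sum_iP(e_i,e_i),X)$. $M$ is normal if $[\varphi,\varphi]+2d\eta\otimes\xi=0$, where $[\varphi,\varphi](X,Y)=\varphi^2[X,Y]+[\varphi X,\varphi Y]-\varphi[\varphi X,Y]-\varphi[X,\varphi Y]$. Classes. $\mathcal B_2^a$: almost semi-cosymplectic manifolds ($\delta\eta=0$ and $\delta\Omega=0$). $\mathcal A_1$: $\alpha$-contact metric manifolds ($d\eta=\alpha\Omega$, $\alpha\neq0$ a real constant); quasi-contact metric manifolds ($P(X,Y)=2g(X,Y)\xi-\eta(Y)\{X+\eta(X)\xi+\mathfrak hX\}$); quasi-$\mathcal K$-Sasakian manifolds ($P(X,Y)=2g(X,Y)\xi-2\eta(Y)X+\eta(Y)\nabla_{\varphi X}\xi$); strongly pseudoconvex CR-manifolds ($d\eta=\Omega$ and $(\nabla_X\varphi)Y=g(X+\mathfrak hX,Y)\xi-\eta(Y)(X+\mathfrak hX)$); $\alpha$-Sasakian manifolds ($d\eta=\alpha\Omega$, $\alpha\neq0$ constant, and normal). $\mathcal A_2$: nearly trans-Sasakian manifolds of type $(\wp,\theta)$: $Q(X,Y)=\wp\{2g(X,Y)\xi-\eta(X)Y-\eta(Y)X\}-\theta\{\eta(X)\varphi Y+\eta(Y)\varphi X\}$ with nowhere vanishing functions $\wp,\theta$. $\mathcal A_3$: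 trans-Sasakian manifolds of type $(\wp,\theta)$: normal with $(\nabla_X\varphi)Y=\wp\{g(X,Y)\xi-\eta(Y)X\}+\theta\{g(\varphi X,Y)\xi-\eta(Y)\varphi X\}$, where $2m\wp=\delta\Omega(\xi)$, $2m\theta=-\delta\eta$ and $\wp,\theta$ vanish nowhere. $\mathcal A_4$: quasi-Sasakian manifolds (normal, $d\Omega=0$, and $\eta\wedge(d\eta)^r\neq0$, $(d\eta)^{r+1}=0$ for some $1\le r\le m-1$). $\mathcal A_5$: nearly $\alpha$-contact metric manifolds ($2\alpha\Omega(X,Y)=d\eta(X,Y)+d\eta(\varphi X,\varphi Y)$, $\alpha\ne0$ constant). $\mathcal A_6$: nearly $\alpha$-Sasakian manifolds ($Q(X,Y)=\alpha\{2g(X,Y)\xi-\eta(Y)X-\eta(X)Y\}$, $\alpha\ne0$ constant). $\mathcal B_1$: cosymplectic ($d\eta=0$, $d\Omega=0$, normal), almost cosymplectic ($d\eta=0$, $d\Omega=0$), nearly cosymplectic ($(\nabla_X\varphi)X=0$), nearly-$\mathcal K$-cosymplectic ($(\nabla_X\varphi)X=0$ and $(\nabla_X\varphi)\xi=0$), quasi-$\mathcal K$-cosymplectic ($P(X,Y)=\eta(Y)\nabla_{\varphi X}\xi$) manifolds. $\mathcal B_3$: almost $\beta$-Kenmotsu manifolds ($d\Omega=2\beta\,\eta\wedge\Omega$, $d\eta=0$, $d\beta\wedge\eta=0$ for a nowhere vanishing smooth function $\beta$), including the $\beta$-Kenmotsu (normal) and the CR-integrable ($(\nabla_X\varphi)Y=g(\mathfrak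 hX,Y)\xi-\eta(Y)\mathfrak hX+\beta\{g(\varphi X,Y)\xi-\eta(Y)\varphi X\}$) ones. $\mathcal C_1$: almost Hermitian manifolds $(H;J,G)$ that are Kähler ($\nabla J=0$), nearly Kähler ($(\nabla_XJ)X=0$), almost Kähler ($d\Phi=0$, $\Phi(X,Y)=G(X,JY)$) or quasi-Kähler ($(\nabla_{JX}J)X-(\nabla_XJ)JX=0$). An almost contact metric target is written $N=(N^{2n+1};\phi,\gamma,\sigma,h)$, with the same notions for $(\phi,\gamma,\sigma,h,n)$; functions on $N$ such as $\beta_N$ are evaluated along $f$. $f$ is $(\pm)$-holomorphic if $f_*\varphi=\pm\psi f_*$ (one fixed sign), with $\psi=\phi$, resp. $\psi=J$ for an almost Hermitian target. For an almost contact metric target, $\lambda\in C^\infty(M)$ is the function with $f_*\xi=\lambda\gamma$ (it exists for $(\pm)$-holomorphic $f$); ''$\lambda$ is constant along $\xi$'' means $d\lambda(\xi)=0$; $E_i=f_*e_i$. $f$ is constant along $D^M$ if $f_*X=0$ for all $X\in\Gamma(D^M)$; harmonic if its tension field vanishes; pluriharmonic if $(\nabla f_* )(X,X)+(\nabla f_* )(\varphi X,\varphi X)=0$ for all $X\in\Gamma(TM)$, $\nabla f_*$ the second fundamental form. $f$ is weakly conformal if $h(f_*X,f_*Y)=\mu^2g(X,Y)$ for all $X,Y$ and some function $\mu\ge0$ ($h$ the target metric), homothetic if moreover $\mu$ is constant. *)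

(* Defs.v *)
From mathcomp Require Import all_boot all_order all_algebra all_fingroup.
From mathcomp Require Import all_classical all_reals all_analysis.
Import Order.TTheory GRing.Theory Num.Theory.
Import numFieldNormedType.Exports.

Set Implicit Arguments.
Unset Strict Implicit.
Unset Printing Implicit Defensive.

Local Open Scope classical_set_scope.
Local Open Scope ring_scope.

(* Tensor calculus is done in charts.  Tangent vectors are row vectors of
   components, so an endomorphism F acts by v *m F, a one-form w (a column) by
   v *m w, and a metric g by v *m g *m u^T; the differential of a map is the
   library's Jacobian acting on the right.  A tensor on a manifold is a family of
   component functions indexed by the charts, subject to the usual
   transformation law, and tensorial conditions are required at every point of
   every chart. *)

Section LocalCalculus.
Context {R : realType} {d : nat}.
Implicit Types (v w u : 'rV[R]_d) (x : 'rV[R]_d) (U : set 'rV[R]_d).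
Implicit Types (X Y : 'rV[R]_d -> 'rV[R]_d) (F g : 'rV[R]_d -> 'M[R]_d).

Definition basis_vec (i : 'I_d) : 'rV[R]_d := delta_mx 0 i.

(* Smoothness on the open set U: all iterated partial derivatives exist and are
   differentiable (hence continuous) on U. *)
Definition smooth_on {W : normedModType R} U (G : 'rV[R]_d -> W) : Prop :=
  forall (s : seq 'I_d) x, U x ->
    differentiable (foldr (fun i H => 'D_(basis_vec i) H) G s) x.

Definition inner (A : 'M[R]_d) v w : R := (v *m A *m w^T) 0 0.
Definition pairing (c : 'cV[R]_d) v : R := (v *m c) 0 0.

Definition bracket X Y x : 'rV[R]_d := 'D_(X x) Y x - 'D_(Y x) X x.

(* Gamma(v, w) = Gamma^k_ij v^i w^j: Koszul formula for the fields with constant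
   components v, w, d/dx^l. *)
Definition christoffel g x v w : 'rV[R]_d :=
  2^-1 *: (\row_l ('D_v (fun y => inner (g y) w (basis_vec l)) x
                 + 'D_w (fun y => inner (g y) v (basis_vec l)) x
                 - 'D_(basis_vec l) (fun y => inner (g y) v w) x))
       *m invmx (g x).

Definition nabla g v Y x : 'rV[R]_d := 'D_v Y x + christoffel g x v (Y x).

(* (nabla_v F) w.  Here and below, tensors built from operations on vector fields
   are evaluated at tangent vectors by extending these with constant
   components. *)
Definition nabla_endo g F x v w : 'rV[R]_d :=
  nabla g v (fun y => w *m F y) x - nabla g v (cst w) x *m F x.

Definition nabla_2form g (B : 'rV[R]_d -> 'rV[R]_d -> 'rV[R]_d -> R) x u v w : R :=
  'D_u (fun y => B y v w) x
  - B x (nabla g u (cst v) x) w - B x v (nabla g u (cst w) x).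

(* d B for a 2-form B, as the cyclic sum of (nabla_u B)(v, w). *)
Definition ext_2form g (B : 'rV[R]_d -> 'rV[R]_d -> 'rV[R]_d -> R) x u v w : R :=
  nabla_2form g B x u v w + nabla_2form g B x v w u + nabla_2form g B x w u v.

(* Fundamental 2-form g(v, F w). *)
Definition fundamental_form g F x v w : R := inner (g x) v (w *m F x).

Definition divergence g X x : R :=
  \tr (\matrix_i nabla g (basis_vec i) X x).

(* The alternating sum of a multilinear form T with k.+1 arguments. *)
Definition alternate (k : nat) (T : (nat -> 'rV[R]_d) -> R)
    (v : 'I_k.+1 -> 'rV[R]_d) : R :=
  \sum_(s : 'S_k.+1) (-1) ^+ s * T (fun j => v (s (inord j))).

End LocalCalculus.

(* Connected, Hausdorff, second countable smooth manifolds with a smooth atlas;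
   param c is the inverse of the coordinate map coord c. *)
Record manifold (R : realType) (d : nat) := Manifold {
  mf_car :> topologicalType;
  mf_hausdorff : hausdorff_space mf_car;
  mf_second_countable : @second_countable mf_car;
  mf_connected : connected [set: mf_car];
  chart : Type;
  chart_dom : chart -> set mf_car;
  coord : chart -> mf_car -> 'rV[R]_d;
  param : chart -> 'rV[R]_d -> mf_car;
  chart_dom_open : forall c, open (chart_dom c);
  chart_img_open : forall c, open (coord c @` chart_dom c);
  coordK : forall c p, chart_dom c p -> param c (coord c p) = p;
  coord_continuous : forall c p, chart_dom c p -> {for p, continuous (coord c)};
  param_continuous : forall c x, (coord c @` chart_dom c) x ->
    {for x, continuous (param c)};
  chart_cover : forall p, exists c, chart_dom c p;
  chart_compat : forall a b,
    smooth_on (coord a @` (chart_dom a `&` chart_dom b)) (coord b \o param a)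
}.

Section Tensors.
Context {R : realType} {d : nat} (M : manifold R d).

Definition chart_img (c : chart M) : set 'rV[R]_d := coord c @` chart_dom c.
Definition overlap (a b : chart M) : set 'rV[R]_d :=
  coord a @` (chart_dom a `&` chart_dom b).
Definition transition (a b : chart M) : 'rV[R]_d -> 'rV[R]_d :=
  coord b \o param a.

Definition is_smooth_fun (u : M -> R) : Prop :=
  forall c : chart M, smooth_on (chart_img c) (u \o param c).

Definition is_vector_field (X : chart M -> 'rV[R]_d -> 'rV[R]_d) : Prop :=
  (forall c, smooth_on (chart_img c) (X c)) /\
  (forall a b x, overlap a b x ->
     X b (transition a b x) = X a x *m jacobian (transition a b) x).

Definition is_one_form (w : chart M -> 'rV[R]_d -> 'cV[R]_d) : Prop :=
  (forall c, smooth_on (chart_img c) (w c)) /\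
  (forall a b x, overlap a b x ->
     w a x = jacobian (transition a b) x *m w b (transition a b x)).

Definition is_endo_field (F : chart M -> 'rV[R]_d -> 'M[R]_d) : Prop :=
  (forall c, smooth_on (chart_img c) (F c)) /\
  (forall a b x, overlap a b x ->
     F a x *m jacobian (transition a b) x =
     jacobian (transition a b) x *m F b (transition a b x)).

Definition is_metric (g : chart M -> 'rV[R]_d -> 'M[R]_d) : Prop :=
  [/\ forall c, smooth_on (chart_img c) (g c),
      forall a b x, overlap a b x ->
        g a x = jacobian (transition a b) x *m g b (transition a b x)
                *m (jacobian (transition a b) x)^T,
      forall c x, chart_img c x -> (g c x)^T = g c x
    & forall c x v, chart_img c x -> v != 0 -> 0 < inner (g c x) v v].

End Tensors.

Record riemannian (R : realType) (d : nat) := Riemannian {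
  rm_manifold :> manifold R d;
  metric : chart rm_manifold -> 'rV[R]_d -> 'M[R]_d;
  metricP : is_metric metric
}.

Record almost_contact_metric (R : realType) (m : nat) := AlmostContactMetric {
  acm_riem :> riemannian R (m.*2).+1;
  acm_phi : chart acm_riem -> 'rV[R]_((m.*2).+1) -> 'M[R]_((m.*2).+1);
  acm_xi : chart acm_riem -> 'rV[R]_((m.*2).+1) -> 'rV[R]_((m.*2).+1);
  acm_eta : chart acm_riem -> 'rV[R]_((m.*2).+1) -> 'cV[R]_((m.*2).+1);
  acm_phiP : is_endo_field acm_phi;
  acm_xiP : is_vector_field acm_xi;
  acm_etaP : is_one_form acm_eta;
  acm_phi2 : forall c x v, chart_img c x ->
    v *m acm_phi c x *m acm_phi c x
    = - v + pairing (acm_eta c x) v *: acm_xi c x;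
  acm_eta_xi : forall c x, chart_img c x ->
    pairing (acm_eta c x) (acm_xi c x) = 1;
  acm_compat : forall c x v w, chart_img c x ->
    inner (metric c x) (v *m acm_phi c x) (w *m acm_phi c x)
    = inner (metric c x) v w
      - pairing (acm_eta c x) v * pairing (acm_eta c x) w
}.

Record almost_hermitian (R : realType) (n : nat) := AlmostHermitian {
  ah_riem :> riemannian R n.*2;
  ah_J : chart ah_riem -> 'rV[R]_n.*2 -> 'M[R]_n.*2;
  ah_JP : is_endo_field ah_J;
  ah_J2 : forall c x (v : 'rV[R]_n.*2), chart_img c x ->
    v *m ah_J c x *m ah_J c x = - v;
  ah_compat : forall c x v w, chart_img c x ->
    inner (metric c x) (v *m ah_J c x) (w *m ah_J c x) = inner (metric c x) v w
}.

Section AlmostContactOperators.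
Context {R : realType} {m : nat} {M : almost_contact_metric R m} (c : chart M).
Local Notation V := 'rV[R]_((m.*2).+1).
Implicit Types (x v w u : V) (X Y : V -> V).
Local Notation g := (metric c).
Local Notation phi := (acm_phi c).
Local Notation xi := (acm_xi c).
Local Notation eta := (acm_eta c).

Definition nabla_phi x v w : V := nabla_endo g phi x v w.
Definition nabla_xi x v : V := nabla g v xi x.

Definition P_tensor x v w : V :=
  nabla_phi x v w + nabla_phi x (v *m phi x) (w *m phi x).
Definition Q_tensor x v w : V := nabla_phi x v w + nabla_phi x w v.

(* 2 h = L_xi phi, with (L_xi phi) X = [xi, phi X] - phi [xi, X]. *)
Definition h_tensor x v : V :=
  2^-1 *: (bracket xi (fun y => v *m phi y) x
           - bracket xi (cst v) x *m phi x).

Definition Omega x v w : R := fundamental_form g phi x v w.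
Definition d_Omega x u v w : R := ext_2form g Omega x u v w.
Definition eta_wedge_Omega x u v w : R :=
  pairing (eta x) u * Omega x v w + pairing (eta x) v * Omega x w u
  + pairing (eta x) w * Omega x u v.

Definition d_eta_fields X Y x : R :=
  2^-1 * ('D_(X x) (fun y => pairing (eta y) (Y y)) x
          - 'D_(Y x) (fun y => pairing (eta y) (X y)) x
          - pairing (eta x) (bracket X Y x)).
Definition d_eta x v w : R := d_eta_fields (cst v) (cst w) x.

Definition nijenhuis X Y x : V :=
  let phiX := fun y => X y *m phi y in
  let phiY := fun y => Y y *m phi y in
  bracket X Y x *m phi x *m phi x + bracket phiX phiY x
  - bracket phiX Y x *m phi x - bracket X phiY x *m phi x.

Definition normal_at x : Prop := forall X Y : V -> V,
  differentiable X x -> differentiable Y x ->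
  nijenhuis X Y x + (2 * d_eta_fields X Y x) *: xi x = 0.

(* {e_i; phi e_i; xi} is an orthonormal basis of the tangent space. *)
Definition adapted_frame x (e : 'I_m -> V) : Prop :=
  (forall i j, [/\ inner (g x) (e i) (e j) = (i == j)%:R,
                   inner (g x) (e i *m phi x) (e j *m phi x) = (i == j)%:R
                 & inner (g x) (e i) (e j *m phi x) = 0]) /\
  (forall i, [/\ inner (g x) (e i) (xi x) = 0,
                 inner (g x) (e i *m phi x) (xi x) = 0
               & inner (g x) (xi x) (xi x) = 1]).

Definition codiff_eta x : R := - divergence g xi x.
Definition codiff_Omega x (e : 'I_m -> V) v : R :=
  inner (g x)
    (- (nabla_xi x (xi x) *m phi x) + \sum_(i < m) P_tensor x (e i) (e i)) v.

(* Up to nonzero constant factors, eta /\ (d eta)^r and (d eta)^(r + 1). *)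
Definition eta_wedge_d_eta_pow x (r : nat) (v : 'I_(r.*2).+1 -> V) : R :=
  alternate (fun a => pairing (eta x) (a 0%N) *
    \prod_(i < r) d_eta x (a (i.*2).+1) (a (i.*2).+2)) v.
Definition d_eta_pow_succ x (r : nat) (v : 'I_(r.*2).+2 -> V) : R :=
  alternate (fun a => \prod_(i < r.+1) d_eta x (a i.*2) (a (i.*2).+1)) v.

End AlmostContactOperators.

Section AlmostContactClasses.
Context {R : realType} {m : nat} (M : almost_contact_metric R m).
Local Notation V := 'rV[R]_((m.*2).+1).
Implicit Types (a : R) (rho theta beta : M -> R).

Definition everywhere (P : chart M -> V -> Prop) : Prop :=
  forall c x, chart_img c x -> P c x.

Definition nowhere_vanishing_smooth (u : M -> R) : Prop :=
  is_smooth_fun u /\ forall p, u p != 0.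

Definition normal_structure : Prop := everywhere (fun c x => normal_at c x).
Definition eta_closed : Prop := everywhere (fun c x =>
  forall v w, d_eta c x v w = 0).
Definition Omega_closed : Prop := everywhere (fun c x =>
  forall u v w, d_Omega c x u v w = 0).

Definition almost_semi_cosymplectic : Prop := everywhere (fun c x =>
  codiff_eta c x = 0 /\
  forall e, adapted_frame c x e -> forall v, codiff_Omega c x e v = 0).

Definition alpha_contact_metric a : Prop := a != 0 /\ everywhere (fun c x =>
  forall v w, d_eta c x v w = a * Omega c x v w).

Definition quasi_contact_metric : Prop := everywhere (fun c x => forall v w,
  P_tensor c x v w = (2 * inner (metric c x) v w) *: acm_xi c x
    - pairing (acm_eta c x) w *:
        (v + pairing (acm_eta c x) v *: acm_xi c x + h_tensor c x v)).

Definition quasi_K_sasakian : Prop := everywhere (fun c x => forall v w,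
  P_tensor c x v w = (2 * inner (metric c x) v w) *: acm_xi c x
    - (2 * pairing (acm_eta c x) w) *: v
    + pairing (acm_eta c x) w *: nabla_xi c x (v *m acm_phi c x)).

Definition strongly_pseudoconvex_CR : Prop := everywhere (fun c x => forall v w,
  d_eta c x v w = Omega c x v w /\
  nabla_phi c x v w =
    inner (metric c x) (v + h_tensor c x v) w *: acm_xi c x
    - pairing (acm_eta c x) w *: (v + h_tensor c x v)).

Definition alpha_sasakian a : Prop := alpha_contact_metric a /\ normal_structure.

Definition nearly_trans_sasakian rho theta : Prop :=
  [/\ nowhere_vanishing_smooth rho, nowhere_vanishing_smooth theta
    & everywhere (fun c x => forall v w,
  Q_tensor c x v w =
    rho (param c x) *: ((2 * inner (metric c x) v w) *: acm_xi c x
      - pairing (acm_eta c x) v *: w - pairing (acm_eta c x) w *: v)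
    - theta (param c x) *: (pairing (acm_eta c x) v *: (w *m acm_phi c x)
      + pairing (acm_eta c x) w *: (v *m acm_phi c x)))].

Definition trans_sasakian rho theta : Prop :=
  [/\ nowhere_vanishing_smooth rho, nowhere_vanishing_smooth theta,
      normal_structure & everywhere (fun c x =>
  [/\ forall v w, nabla_phi c x v w =
        rho (param c x) *: (inner (metric c x) v w *: acm_xi c x
          - pairing (acm_eta c x) w *: v)
        + theta (param c x) *:
            (inner (metric c x) (v *m acm_phi c x) w *: acm_xi c x
             - pairing (acm_eta c x) w *: (v *m acm_phi c x)),
      forall e, adapted_frame c x e ->
        2 * m%:R * rho (param c x) = codiff_Omega c x e (acm_xi c x)
    & 2 * m%:R * theta (param c x) = - codiff_eta c x])].

Definition quasi_sasakian : Prop :=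
  [/\ normal_structure, Omega_closed
    & exists r : nat, [/\ (1 <= r)%N, (r <= m.-1)%N,
      everywhere (fun c x =>
        exists v, eta_wedge_d_eta_pow c x (r := r) v != 0)
    & everywhere (fun c x => forall v, d_eta_pow_succ c x (r := r) v = 0)]].

Definition nearly_alpha_contact_metric a : Prop :=
  a != 0 /\ everywhere (fun c x => forall v w,
  2 * a * Omega c x v w =
    d_eta c x v w + d_eta c x (v *m acm_phi c x) (w *m acm_phi c x)).

Definition nearly_alpha_sasakian a : Prop :=
  a != 0 /\ everywhere (fun c x => forall v w,
  Q_tensor c x v w =
    a *: ((2 * inner (metric c x) v w) *: acm_xi c x
      - pairing (acm_eta c x) w *: v - pairing (acm_eta c x) v *: w)).

Definition cosymplectic : Prop := [/\ eta_closed, Omega_closed & normal_structure].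
Definition almost_cosymplectic : Prop := eta_closed /\ Omega_closed.
Definition nearly_cosymplectic : Prop := everywhere (fun c x =>
  forall v, nabla_phi c x v v = 0).
Definition nearly_K_cosymplectic : Prop := everywhere (fun c x =>
  forall v, nabla_phi c x v v = 0 /\ nabla_phi c x v (acm_xi c x) = 0).
Definition quasi_K_cosymplectic : Prop := everywhere (fun c x => forall v w,
  P_tensor c x v w =
    pairing (acm_eta c x) w *: nabla_xi c x (v *m acm_phi c x)).

Definition almost_beta_kenmotsu beta : Prop :=
  [/\ nowhere_vanishing_smooth beta, eta_closed
    & everywhere (fun c x =>
  (forall u v w, d_Omega c x u v w =
     2 * beta (param c x) * eta_wedge_Omega c x u v w) /\
  (forall v w, 'D_v (beta \o param c) x * pairing (acm_eta c x) w
             - 'D_w (beta \o param c) x * pairing (acm_eta c x) v = 0))].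

Definition class_A1 : Prop :=
  (exists a, alpha_contact_metric a) \/ quasi_contact_metric \/
  quasi_K_sasakian \/ strongly_pseudoconvex_CR \/ (exists a, alpha_sasakian a).
Definition class_A2 : Prop := exists rho theta, nearly_trans_sasakian rho theta.
Definition class_A3 : Prop := exists rho theta, trans_sasakian rho theta.
Definition class_A4 : Prop := quasi_sasakian.
Definition class_A5 : Prop := exists a, nearly_alpha_contact_metric a.
Definition class_A6 : Prop := exists a, nearly_alpha_sasakian a.

(* The types of B1 other than nearly cosymplectic. *)
Definition class_B1_restricted : Prop :=
  [\/ cosymplectic, almost_cosymplectic, nearly_K_cosymplectic
    | quasi_K_cosymplectic].
Definition class_B1 : Prop := class_B1_restricted \/ nearly_cosymplectic.

End AlmostContactClasses.

Section AlmostHermitianClasses.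
Context {R : realType} {n : nat} (H : almost_hermitian R n).

Definition nabla_J (c : chart H) x v w : 'rV[R]_n.*2 :=
  nabla_endo (metric c) (ah_J c) x v w.

Definition kahler : Prop := forall (c : chart H) x v w, chart_img c x ->
  nabla_J c x v w = 0.
Definition nearly_kahler : Prop := forall (c : chart H) x v, chart_img c x ->
  nabla_J c x v v = 0.
Definition almost_kahler : Prop := forall (c : chart H) x u v w, chart_img c x ->
  ext_2form (metric c) (fundamental_form (metric c) (ah_J c)) x u v w = 0.
Definition quasi_kahler : Prop := forall (c : chart H) x v, chart_img c x ->
  nabla_J c x (v *m ah_J c x) v - nabla_J c x v (v *m ah_J c x) = 0.

Definition class_C1 : Prop :=
  [\/ kahler, nearly_kahler, almost_kahler | quasi_kahler].

End AlmostHermitianClasses.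

Section Maps.
Context {R : realType} {d e : nat} {M : riemannian R d} {N : riemannian R e}.
Variable f : M -> N.

(* Domain and expression of f in a chart a of M and a chart b of N. *)
Definition local_dom (a : chart M) (b : chart N) : set 'rV[R]_d :=
  coord a @` (chart_dom a `&` f @^-1` chart_dom b).
Definition local_map (a : chart M) (b : chart N) : 'rV[R]_d -> 'rV[R]_e :=
  coord b \o f \o param a.
Definition diff_map a b (x : 'rV[R]_d) : 'M[R]_(d, e) :=
  jacobian (local_map a b) x.

Definition smooth_map : Prop :=
  continuous f /\ forall a b, smooth_on (local_dom a b) (local_map a b).

Definition constant_map : Prop := forall p q, f p = f q.

(* nabla_v (f_* w), the connection being that of the pull-back f^* TN. *)
Definition pullback_nabla a b x (v w : 'rV[R]_d) : 'rV[R]_e :=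
  'D_v (fun y => w *m diff_map a b y) x
  + christoffel (metric b) (local_map a b x)
      (v *m diff_map a b x) (w *m diff_map a b x).

Definition second_fundamental_form a b x (v w : 'rV[R]_d) : 'rV[R]_e :=
  pullback_nabla a b x v w - christoffel (metric a) x v w *m diff_map a b x.

Definition tension a b x : 'rV[R]_e :=
  \sum_i \sum_j invmx (metric a x) i j *:
    second_fundamental_form a b x (basis_vec i) (basis_vec j).

Definition harmonic_map : Prop := forall a b x, local_dom a b x -> tension a b x = 0.

Definition conformal_with (mu : M -> R) : Prop :=
  (forall p, 0 <= mu p) /\
  (forall a b x v w, local_dom a b x ->
     inner (metric b (local_map a b x)) (v *m diff_map a b x) (w *m diff_map a b x)
     = mu (param a x) ^+ 2 * inner (metric a x) v w).
Definition weakly_conformal : Prop := exists mu, conformal_with mu.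
Definition homothetic : Prop := exists mu : R, conformal_with (fun=> mu).

(* Wherever f is an immersion, the normal part of the trace, for the induced
   metric f^* h, of nabla_v (f_* w), that is (up to a factor) the mean curvature
   vector of the image, vanishes. *)
Definition induced_metric a b x : 'M[R]_d :=
  diff_map a b x *m metric b (local_map a b x) *m (diff_map a b x)^T.
Definition minimal_image : Prop := forall a b x, local_dom a b x ->
  row_free (diff_map a b x) ->
  forall nu : 'rV[R]_e,
    (forall v, inner (metric b (local_map a b x)) (v *m diff_map a b x) nu = 0) ->
    inner (metric b (local_map a b x))
      (\sum_i \sum_j invmx (induced_metric a b x) i j *:
         pullback_nabla a b x (basis_vec i) (basis_vec j)) nu = 0.

Definition pm_holomorphic (F : chart M -> 'rV[R]_d -> 'M[R]_d)
    (G : chart N -> 'rV[R]_e -> 'M[R]_e) : Prop :=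
  exists s : R, (s = 1 \/ s = -1) /\
    forall a b x, local_dom a b x ->
      F a x *m diff_map a b x = s *: (diff_map a b x *m G b (local_map a b x)).

End Maps.

Section MapsFromAlmostContact.
Context {R : realType} {m e : nat} {M : almost_contact_metric R m}
  {N : riemannian R e}.
Variable f : M -> N.

Definition pluriharmonic : Prop :=
  forall (a : chart M) (b : chart N) x v, local_dom f a b x ->
    second_fundamental_form f a b x v v
    + second_fundamental_form f a b x (v *m acm_phi a x) (v *m acm_phi a x) = 0.

Definition constant_along_D : Prop :=
  forall (a : chart M) (b : chart N) x v, local_dom f a b x ->
    pairing (acm_eta a x) v = 0 -> v *m diff_map f a b x = 0.

Definition maps_xi_to_zero : Prop :=
  forall (a : chart M) (b : chart N) x, local_dom f a b x ->
    acm_xi a x *m diff_map f a b x = 0.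

Definition constant_along_xi (u : M -> R) : Prop :=
  forall (a : chart M) x, chart_img a x -> 'D_(acm_xi a x) (u \o param a) x = 0.

End MapsFromAlmostContact.

(* u = lambda, the smooth function with f_* xi = lambda gamma. *)
Definition is_lambda {R : realType} {m n : nat} {M : almost_contact_metric R m}
    {N : almost_contact_metric R n} (f : M -> N) (lambda : M -> R) : Prop :=
  is_smooth_fun lambda /\
  forall (a : chart M) (b : chart N) x, local_dom f a b x ->
    acm_xi a x *m diff_map f a b x =
    lambda (param a x) *: acm_xi b (local_map f a b x).

(* Main.v *)
(* Write F for the differential of f, B for its second fundamental form and
   S(X) = (nabla_{phi X} phi) X + phi (nabla_X phi) X.  Differentiating F phi = s psi F
   gives B(phi X, phi X) = - F S(X) + S_N(F X) + psi^2 B(X, X).  Summing over an adapted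
   frame and using the vanishing of delta Omega, the psi-part of the tension depends
   only on S_N(E_i) and on nabla_gamma gamma; its gamma-part is obtained by
   differentiating h(F X, gamma) = lambda eta(X), and by delta eta = 0 it is
   d lambda(xi) minus the trace of nabla gamma over the E_i and psi E_i.  The symmetry of
   B turns the xi-component of delta Omega = 0 into sum_i d sigma(E_i, psi E_i) = 0,
   which forces E_i = 0 as soon as d sigma(E, psi E) is a nonzero multiple of |E|^2.
   For a weakly conformal f one has mu^2 = lambda^2, and polarising the derivative of
   f^* h = lambda^2 g yields h(tau, F X) = - (2m - 1) lambda d lambda(X).  All these
   identities are local: a chart of M and a chart of N suffice, and connectedness of M
   enters only to pass from a vanishing derivative to a constant function or map. *)

Require Import Defs.
From mathcomp Require Import all_boot all_order all_algebra all_fingroup.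
From mathcomp Require Import all_classical all_reals all_analysis.
From mathcomp Require Import ring lra.
Import Order.TTheory GRing.Theory Num.Theory.
Import numFieldNormedType.Exports.

Set Implicit Arguments.
Unset Strict Implicit.
Local Open Scope classical_set_scope.
Local Open Scope ring_scope.

(** * Calculus in several variables *)

(** Derivatives are eliminated chart by chart: at a point, a structure is reduced to its values
    together with [T], the derivative of [xi], and [A], that of [phi] ([acm_point]), and a map to
    [F], [B] and the sign [s] ([holomorphic_point]). The rest is linear algebra in an orthonormal
    frame, and each almost contact class enters only through a pointwise type whose constant may
    vary from point to point. The symmetry of [B] is equality of mixed derivatives; [smooth_on]
    supplies differentiable first derivatives, which is exactly what Young's form of Schwarz's
    theorem asks for. The dilation [mu] of a weakly conformal map carries no regularity, so it is
    never differentiated: the differentiable coefficient of [F xi] on [gamma] has the same square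
    and takes its place. The factor 2m - 1 cannot vanish because it is odd. For a weakly conformal
    map into an almost beta-Kenmotsu manifold, harmonicity reads xi(lambda) = 2 m beta lambda^2 and
    the conformal identity reads lambda xi(lambda) = 0; together they give lambda^3 = 0. *)

Section Calculus.
Context {R : realType}.

Lemma derivable_entry (V : normedModType R) p q (M : V -> 'M[R]_(p, q)) x v i j :
  derivable M x v -> derivable (fun y => M y i j) x v.
Proof. by move/derivable_mxP. Qed.

Lemma derive_entry (V : normedModType R) p q (M : V -> 'M[R]_(p, q)) x v i j :
  derivable M x v -> 'D_v (fun y => M y i j) x = ('D_v M x) i j.
Proof. by move=> dM; rewrite derive_mx // mxE. Qed.

Lemma differentiable_entry (V : normedModType R) p q (M : V -> 'M[R]_(p, q)) x i j :
  differentiable M x -> differentiable (fun y => M y i j) x.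
Proof.
by move=> dM; apply: (@differentiable_comp _ _ _ _ M (fun N : 'M[R]_(p, q) => N i j)) => //;
  exact: differentiable_coord.
Qed.

Lemma differentiable_bigsum (V W : normedModType R) n (f : 'I_n -> V -> W) (x : V) :
  (forall i, differentiable (f i) x) ->
  differentiable (fun y => \sum_(i < n) f i y) x.
Proof.
move=> df; rewrite (_ : (fun y => _) = \sum_(i < n) f i).
  exact: differentiable_sum.
by apply/funext => y; rewrite fct_sumE.
Qed.

Lemma derive_bigsum (V W : normedModType R) n (f : 'I_n -> V -> W) (x v : V) :
  (forall i, derivable (f i) x v) ->
  'D_v (fun y => \sum_(i < n) f i y) x = \sum_(i < n) 'D_v (f i) x.
Proof.
move=> df; rewrite (_ : (fun y => _) = \sum_(i < n) f i).
  exact: derive_sum.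
by apply/funext => y; rewrite fct_sumE.
Qed.

Lemma differentiable_mx (V : normedModType R) p q (M : V -> 'M[R]_(p, q)) x :
  (forall i j, differentiable (fun y => M y i j) x) -> differentiable M x.
Proof.
move=> dM.
rewrite (_ : M = fun y => \sum_(i < p) \sum_(j < q) M y i j *: delta_mx i j).
  do 2 apply: differentiable_bigsum => ?; exact: differentiableZl.
by apply/funext => y; exact: matrix_sum_delta.
Qed.

Lemma differentiable_mulmx (V : normedModType R) p q r (X : V -> 'M[R]_(p, q))
    (Y : V -> 'M[R]_(q, r)) x :
  differentiable X x -> differentiable Y x ->
  differentiable (fun y => X y *m Y y) x.
Proof.
move=> dX dY; apply: differentiable_mx => i k.
under eq_fun do rewrite mxE.
by apply: differentiable_bigsum => j; apply: differentiableM; exact: differentiable_entry.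
Qed.

Lemma derive_mulmx (V : normedModType R) p q r (X : V -> 'M[R]_(p, q))
    (Y : V -> 'M[R]_(q, r)) x v :
  differentiable X x -> differentiable Y x ->
  'D_v (fun y => X y *m Y y) x = 'D_v X x *m Y x + X x *m 'D_v Y x.
Proof.
move=> dX dY.
rewrite derive_mx; last by apply/diff_derivable/differentiable_mulmx.
apply/matrixP => i k; rewrite !mxE.
under eq_fun do rewrite mxE.
rewrite derive_bigsum => [|j]; last first.
  by apply: derivableM; apply/derivable_entry/diff_derivable.
rewrite -big_split /=; apply: eq_bigr => j _.
rewrite deriveM; try by apply/derivable_entry/diff_derivable.
rewrite !derive_entry; try exact/diff_derivable.
by rewrite /= addrC [Y x j k *: _]mulrC.
Qed.

Lemma differentiable_trmx (V : normedModType R) p q (X : V -> 'M[R]_(p, q)) x :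
  differentiable X x -> differentiable (fun y => (X y)^T) x.
Proof.
move=> dX; apply: differentiable_mx => i k.
under eq_fun do rewrite mxE.
exact: differentiable_entry.
Qed.

Lemma derive_trmx (V : normedModType R) p q (X : V -> 'M[R]_(p, q)) x v :
  differentiable X x -> 'D_v (fun y => (X y)^T) x = ('D_v X x)^T.
Proof.
move=> dX; rewrite derive_mx; last by apply/diff_derivable/differentiable_trmx.
apply/matrixP => i k; rewrite !mxE.
under eq_fun do rewrite mxE.
by rewrite derive_entry //; exact: diff_derivable.
Qed.

Lemma differentiable_scalemx (V : normedModType R) p q (k : V -> R) (Z : V -> 'M[R]_(p, q)) x :
  differentiable k x -> differentiable Z x -> differentiable (fun y => k y *: Z y) x.
Proof.
move=> dk dZ; apply: differentiable_mx => i j; under eq_fun do rewrite mxE.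
by apply: differentiableM => //; exact: differentiable_entry.
Qed.

Lemma derive_scalemx (V : normedModType R) p q (k : V -> R) (Z : V -> 'M[R]_(p, q)) x v :
  differentiable k x -> differentiable Z x ->
  'D_v (fun y => k y *: Z y) x = 'D_v k x *: Z x + k x *: 'D_v Z x.
Proof.
move=> dk dZ; rewrite derive_mx; last by apply/diff_derivable/differentiable_scalemx.
apply/matrixP => i j; rewrite !mxE; under eq_fun do rewrite mxE.
rewrite deriveM; try (exact: diff_derivable); last exact/derivable_entry/diff_derivable.
rewrite derive_entry; last exact: diff_derivable.
by rewrite /= addrC [Z x i j *: _]mulrC.
Qed.

Lemma differentiable_expansion (V W : normedModType R) (G : V -> W) x (e : R) :
  differentiable G x -> 0 < e ->
  \forall u \near (0 : V), `|G (u + x) - G x - 'D_u G x| <= e * `|u|.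
Proof.
move=> dG e0; have /eqaddoP := diff_locally dG.
move=> /(_ _ e0).
apply: filterS => u /=; rewrite deriveE // [_ + x]addrC.
by rewrite !fctE /= opprD addrA [u + x]addrC.
Qed.

(** Turns a directional derivative into a derivative in one real variable, so that the mean value
    theorem applies along segments. *)
Lemma is_derive_line (V W : normedModType R) (f : V -> W) (p v : V) (t : R) :
  differentiable f (t *: v + p) ->
  is_derive t 1 (fun s => f (s *: v + p)) ('D_v f (t *: v + p)).
Proof.
move=> df; have dv : derivable f (t *: v + p) v by exact: diff_derivable.
have E : (fun h : R => h^-1 *: (f ((h *: 1 + t) *: v + p) - f (t *: v + p))) =
         (fun h : R => h^-1 *: (f (h *: v + (t *: v + p)) - f (t *: v + p))).
  by apply/funext => h; rewrite addrA -scalerDl [h *: 1]mulr1.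
by split; [rewrite /derivable|rewrite /derive]; rewrite E.
Qed.

(* Young's form of Schwarz's theorem: by the mean value theorem the second difference is
   [h] times an increment of ['D_v f], and only differentiability of ['D_v f] at [x] is used. *)
Lemma second_difference (V : normedModType R) (f g : V -> R) (x v w : V) (e : R) :
  (\forall y \near x, differentiable f y /\ 'D_v f y = g y) ->
  differentiable g x -> 0 < e ->
  \forall h \near 0^'+, `|f (h *: v + h *: w + x) - f (h *: v + x) - f (h *: w + x) + f x
     - h ^+ 2 * 'D_w g x| <= e * h ^+ 2.
Proof.
move=> df ddf e0.
(* [h * K] bounds [t *: v + s *: w] for t and s in [0, h]; the summand 1 keeps [K] positive when v =
   w = 0. The two expansions below cost half of [e] each, whence [e / (2 * K)]. *)
set K := `|v| + `|w| + 1.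
have K0 : 0 < K by rewrite /K ltr_wpDl ?addr_ge0.
have e'0 : 0 < e / (2 * K) by rewrite divr_gt0 // mulr_gt0.
have dfx : \forall u \near (0 : V), differentiable f (u + x) /\ 'D_v f (u + x) = g (u + x).
  by move: df; rewrite (near_shift 0); apply: filterS => u; rewrite /= subr0.
have := differentiable_expansion ddf e'0.
move/(filterI dfx) => /nbhs_ballP [r /= r0 Hr].
near=> h.
have h0 : 0 < h by near: h; exact: nbhs_right_gt.
have hK : h * K < r.
  by rewrite -ltr_pdivlMr //; near: h; apply: nbhs_right_lt; rewrite divr_gt0.
have small (t s : R) : 0 <= t <= h -> 0 <= s <= h -> `|t *: v + s *: w| <= h * K.
  move=> /andP[t0 th] /andP[s0 sh].
  rewrite (le_trans (ler_normD _ _)) // !normrZ (ger0_norm t0) (ger0_norm s0).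
  have := ler_wpM2r (normr_ge0 v) th; have := ler_wpM2r (normr_ge0 w) sh.
  by rewrite /K; lra.
have inr (t s : R) : 0 <= t <= h -> 0 <= s <= h -> ball 0 r (t *: v + s *: w).
  move=> Ht Hs; rewrite -ball_normE /= sub0r normrN; exact: le_lt_trans (small _ _ Ht Hs) hK.
have hh : 0 <= h <= h by rewrite lexx ltW.
have h00 : (0 : R) <= 0 <= h by apply/andP; split=> //; exact: ltW.
pose phi (t : R) := f (t *: v + (h *: w + x)) - f (t *: v + x).
have dphi (t : R) : 0 <= t <= h ->
    is_derive t 1 phi ('D_v f (t *: v + (h *: w + x)) - 'D_v f (t *: v + x)).
  move=> Ht; apply: is_deriveB.
    by apply: is_derive_line; rewrite addrA; exact: (Hr _ (inr t h Ht hh)).1.1.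
  apply: is_derive_line; have := (Hr _ (inr t 0 Ht h00)).1.1.
  by rewrite scale0r addr0.
have [c cab Ec] : exists2 c, c \in `]0, h[%R & phi h - phi 0 =
    ('D_v f (c *: v + (h *: w + x)) - 'D_v f (c *: v + x)) * (h - 0).
  apply: (@MVT R phi _ 0 h) => //.
    by move=> t /itvP Ht; apply: dphi; rewrite !Ht.
  apply: derivable_within_continuous => t; rewrite in_itv /= => Ht.
  by have := dphi t Ht; case.
have Hc : 0 <= c <= h by rewrite !(itvP cab).
have [[_ EP] HP] := Hr _ (inr c h Hc hh); have [[_ EQ] HQ] := Hr _ (inr c 0 Hc h00).
move: EP EQ HP HQ Ec; rewrite /= scale0r addr0 !addrA => -> -> + + Ec.
set L := g x; set P := g (c *: v + h *: w + x).
set Q := g (c *: v + x) => HP HQ.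
have DL : 'D_(c *: v + h *: w) g x = 'D_(c *: v) g x + h * 'D_w g x.
  by rewrite !deriveE // linearD; congr (_ + _); rewrite linearZ.
have -> : f (h *: v + h *: w + x) - f (h *: v + x) - f (h *: w + x) + f x = (P - Q) * h.
  by move: Ec; rewrite /phi !scale0r !add0r subr0 !addrA => <-; ring.
set D2 := 'D_w g x.
have -> : (P - Q) * h - h ^+ 2 * D2 = h * (P - Q - h * D2) by ring.
rewrite normrM (gtr0_norm h0) expr2 mulrCA ler_pM2l //.
(* Both increments of [g] are measured from [x]: the values [L] cancel and the linear parts differ
   by exactly [h * D2]. *)
have -> : P - Q - h * D2 = (P - L - 'D_(c *: v + h *: w) g x)
    - (Q - L - 'D_(c *: v) g x) by rewrite DL -/D2; ring.
rewrite (le_trans (ler_normB _ _)) //.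
have S1 := small c h Hc hh; have S2 := small c 0 Hc h00.
rewrite scale0r addr0 in S2.
have B1 := le_trans HP (ler_wpM2l (ltW e'0) S1).
have B2 := le_trans HQ (ler_wpM2l (ltW e'0) S2).
apply: le_trans (lerD B1 B2) _.
have -> : e / (2 * K) * (h * K) + e / (2 * K) * (h * K) = e * h; last by [].
by field; rewrite gt_eqF.
Unshelve. all: by end_near. Qed.

(** The second difference is symmetric in [v] and [w], so for small h one and the same quotient lies
    within e / 2 of both mixed derivatives. *)
Lemma derive_sym (V : normedModType R) (f g k : V -> R) (x v w : V) :
  (\forall y \near x, [/\ differentiable f y, 'D_v f y = g y & 'D_w f y = k y]) ->
  differentiable g x -> differentiable k x -> 'D_w g x = 'D_v k x.
Proof.
move=> df dv dw; apply/eqP; rewrite -subr_eq0 -normr_le0; apply/ler_addgt0Pr => e e0.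
rewrite add0r.
have e2 : 0 < e / 2 by rewrite divr_gt0.
have near2 : \forall h \near (0 : R)^'+, `|'D_w g x - 'D_v k x| <= e.
  near=> h.
  have h0 : 0 < h by near: h; exact: nbhs_right_gt.
  have H1 : `|f (h *: v + h *: w + x) - f (h *: v + x) - f (h *: w + x) + f x
     - h ^+ 2 * 'D_w g x| <= e / 2 * h ^+ 2.
    near: h; apply: (@second_difference _ f g x v w) => //.
    by move: df; apply: filterS => y [].
  have H2 : `|f (h *: w + h *: v + x) - f (h *: w + x) - f (h *: v + x) + f x
     - h ^+ 2 * 'D_v k x| <= e / 2 * h ^+ 2.
    near: h; apply: (@second_difference _ f k x w v) => //.
    by move: df; apply: filterS => y [].
  have hh0 : 0 < h ^+ 2 by rewrite exprn_gt0.
  rewrite -(ler_pM2r hh0) -{1}(gtr0_norm hh0) -normrM.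
  move: H1 H2; rewrite [h *: w + h *: v]addrC !ler_norml; lra.
by have [h] := filter_ex near2.
Unshelve. all: by end_near. Qed.

Lemma derive_sym_mx (V : normedModType R) p q (M g k : V -> 'M[R]_(p, q)) (x v w : V) :
  (\forall y \near x, [/\ differentiable M y, 'D_v M y = g y & 'D_w M y = k y]) ->
  differentiable g x -> differentiable k x -> 'D_w g x = 'D_v k x.
Proof.
move=> dM dv dw; apply/matrixP => i j.
rewrite -!derive_entry; try exact: diff_derivable.
apply: (@derive_sym _ (fun y => M y i j)); try exact: differentiable_entry.
move: dM; apply: filterS => y [dM <- <-].
by split; [exact: differentiable_entry|..]; rewrite derive_entry //; exact: diff_derivable.
Qed.

(** Mean value theorem on the segment from [x] to [y], which stays inside the ball. *)
Lemma near_constant (V : normedModType R) (f : V -> R) (x : V) :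
  (\forall y \near x, differentiable f y /\ forall v, 'D_v f y = 0) ->
  \forall y \near x, f y = f x.
Proof.
move=> H; have [r /= r0 Hr] := (nbhs_ballP _ _).1 H; move: (nbhsx_ballx x r r0); apply: filterS => y.
rewrite -ball_normE /= distrC => yr.
pose phi (t : R) := f (t *: (y - x) + x).
have dphi (t : R) : 0 <= t <= 1 -> is_derive t 1 phi 0.
  move=> /andP[t0 t1]; have [df <-] : differentiable f (t *: (y - x) + x) /\
      'D_(y - x) f (t *: (y - x) + x) = 0.
    suff /Hr [? D0] : ball x r (t *: (y - x) + x) by split.
    rewrite -ball_normE /= distrC addrK normrZ ger0_norm //.
    by apply: le_lt_trans yr; rewrite ler_piMl.
  exact: is_derive_line.
have [c _] : exists2 c, c \in `](0:R), 1[%R & phi 1 - phi 0 = 0 * (1 - 0).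
  apply: (@MVT R phi (fun=> 0) 0 1) => //.
    by move=> t /itvP Ht; apply: dphi; rewrite !Ht.
  apply: derivable_within_continuous => t; rewrite in_itv /= => Ht.
  by have := dphi t Ht; case.
by rewrite mul0r /phi scale1r subrK scale0r add0r => /subr0_eq.
Qed.

Lemma near_constant_mx (V : normedModType R) p q (f : V -> 'M[R]_(p, q)) (x : V) :
  (\forall y \near x, differentiable f y /\ forall v, 'D_v f y = 0) ->
  \forall y \near x, f y = f x.
Proof.
move=> df.
have H : \forall y \near x, forall ij : 'I_p * 'I_q, f y ij.1 ij.2 = f x ij.1 ij.2.
  apply: filter_forall => ij; apply: (@near_constant _ (fun y => f y ij.1 ij.2)).
  move: df; apply: filterS => y [df d0]; split; first exact: differentiable_entry.
  by move=> v; rewrite derive_entry ?d0 ?mxE //; exact: diff_derivable.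
by move: H; apply: filterS => y Hy; apply/matrixP => i j; exact: (Hy (i, j)).
Qed.

End Calculus.

(** Preimages of arbitrary sets are open, hence the fibre through [p] is both open and closed. *)
Lemma connected_locally_constant (T : topologicalType) (U : Type) (u : T -> U) :
  connected [set: T] -> (forall p, \forall q \near p, u q = u p) ->
  forall p q, u p = u q.
Proof.
move=> cT lc p q.
have oA (A : set U) : open (u @^-1` A).
  by rewrite openE => r Ar; apply: filterS (lc r) => t E; rewrite /preimage /= E.
suff /seteqP[_ /(_ q I)] : u @^-1` [set u p] = [set: T] by move=> ->.
apply: cT; first by exists p.
  by exists (u @^-1` [set u p]); [exact: oA|rewrite setTI].
exists (u @^-1` [set u p]); last by rewrite setTI.
by rewrite -openC; exact: (oA (~` [set u p])).
Qed.

(** * Charts and local expressions of maps *)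

Section Charts.
Context {R : realType} {d : nat}.

Lemma smooth_on_differentiable (W : normedModType R) (U : set 'rV[R]_d) (G : 'rV[R]_d -> W) x :
  smooth_on U G -> U x -> differentiable G x.
Proof. by move=> sG Ux; exact: (sG [::] x Ux). Qed.

Lemma smooth_on_differentiable_derive (W : normedModType R) (U : set 'rV[R]_d)
    (G : 'rV[R]_d -> W) x i :
  smooth_on U G -> U x -> differentiable ('D_(basis_vec i) G) x.
Proof. by move=> sG Ux; exact: (sG [:: i] x Ux). Qed.

Lemma chart_img_nbhs (M : manifold R d) (a : chart M) x :
  chart_img a x -> \forall y \near x, chart_img a y.
Proof. by move=> ax; apply: open_nbhs_nbhs; split => //; exact: chart_img_open. Qed.

Lemma exists_chart (M : manifold R d) (p : M) :
  exists a (x : 'rV[R]_d), chart_img a x /\ param a x = p.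
Proof.
have [a Dp] := chart_cover p; exists a, (Defs.coord a p); split; last exact: coordK.
by exists p.
Qed.

Lemma chart_locally_constant (M : manifold R d) (U : Type) (u : M -> U) :
  (forall (a : chart M) x, chart_img a x ->
     \forall y \near x, u (param a y) = u (param a x)) ->
  forall p q, u p = u q.
Proof.
move=> lc; apply: connected_locally_constant; first exact: mf_connected.
move=> p; have [a Dp] := chart_cover p.
have ap : chart_img a (Defs.coord a p) by exists p.
have Da : \forall q \near p, chart_dom a q.
  by apply: open_nbhs_nbhs; split => //; exact: chart_dom_open.
have := Defs.coord_continuous Dp; move/(_ _ (lc a _ ap)) => H.
near=> q; rewrite -(coordK (near Da q _)) // -[in RHS](coordK Dp).
by near: q; exact: H.
Unshelve. all: by end_near. Qed.

(** Differentiability in charts is easier to supply than [is_smooth_fun] for a product such as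
    lambda^2, to which this is applied. *)
Lemma differentiable_fun_constant (M : manifold R d) (u : M -> R) :
  (forall (a : chart M) x, chart_img a x -> differentiable (u \o param a) x) ->
  (forall (a : chart M) x, chart_img a x -> forall v, 'D_v (u \o param a) x = 0) ->
  forall p q, u p = u q.
Proof.
move=> su du; apply: chart_locally_constant => a x ax.
apply: (@near_constant _ _ (u \o param a)).
by apply: filterS (chart_img_nbhs ax) => y ay; split; [exact: su|exact: du].
Qed.

End Charts.

Section MapCharts.
Context {R : realType} {d e : nat} {M : riemannian R d} {N : riemannian R e}.
Context {f : M -> N} (sf : smooth_map f).
Implicit Types (a : chart M) (b : chart N) (x : 'rV[R]_d).

Lemma local_domP a b x :
  local_dom f a b x <-> chart_img a x /\ chart_dom b (f (param a x)).
Proof.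
split=> [[p [Dp fp] <-]|[[p Dp <-]]]; last by rewrite coordK // => fp; exists p.
by rewrite coordK //; split => //; exists p.
Qed.

Lemma local_dom_src a b x : local_dom f a b x -> chart_img a x.
Proof. by case/local_domP. Qed.

Lemma local_dom_tgt a b x : local_dom f a b x -> chart_img b (local_map f a b x).
Proof. by case/local_domP => _ ?; exists (f (param a x)). Qed.

Lemma param_local_map a b x :
  local_dom f a b x -> param b (local_map f a b x) = f (param a x).
Proof. by case/local_domP => _ fx; rewrite /local_map /= coordK. Qed.

Lemma exists_local_dom a x : chart_img a x -> exists b, local_dom f a b x.
Proof.
move=> ax; have [b fb] := chart_cover (f (param a x)).
by exists b; apply/local_domP.
Qed.

Lemma local_dom_nbhs a b x :
  local_dom f a b x -> \forall y \near x, local_dom f a b y.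
Proof.
move=> /local_domP[ax bx].
have c : {for x, continuous (f \o param a)}.
  by apply: continuous_comp; [exact: param_continuous|exact: sf.1].
have : \forall q \near f (param a x), chart_dom b q.
  by apply: open_nbhs_nbhs; split => //; exact: chart_dom_open.
move/c => H; near=> y; apply/local_domP; split; near: y; [exact: chart_img_nbhs|exact: H].
Unshelve. all: by end_near. Qed.

Lemma local_map_differentiable a b x :
  local_dom f a b x -> differentiable (local_map f a b) x.
Proof. by move=> /(smooth_on_differentiable (sf.2 a b)). Qed.

Lemma derive_local_map a b x v :
  local_dom f a b x -> 'D_v (local_map f a b) x = v *m diff_map f a b x.
Proof. by move=> /local_map_differentiable/deriveEjacobian ->. Qed.

Lemma smooth_map_constant :
  (forall a b x, local_dom f a b x -> diff_map f a b x = 0) -> constant_map f.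
Proof.
move=> f0; apply: chart_locally_constant => a x ax.
have [b abx] := exists_local_dom ax.
have lx := local_dom_nbhs abx.
have H : \forall y \near x, local_map f a b y = local_map f a b x.
  apply: near_constant_mx; apply: filterS lx => y ly.
  split; first exact: local_map_differentiable.
  by move=> v; rewrite derive_local_map // f0 // mulmx0.
apply: filterS (filterI lx H) => y [ly E].
by rewrite -!(param_local_map (b := b)) // E.
Qed.

End MapCharts.

(** * Levi-Civita connection in a chart *)

Section Inner.
Context {R : realType} {d : nat}.
Implicit Types (A B : 'M[R]_d) (u v w : 'rV[R]_d) (c : 'cV[R]_d) (k : R).

Lemma innerE A v w : inner A v w = (v *m A *m w^T) 0 0.
Proof. by []. Qed.
Lemma innerDl A u v w : inner A (u + v) w = inner A u w + inner A v w.
Proof. by rewrite /inner !mulmxDl mxE. Qed.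
Lemma innerDr A u v w : inner A w (u + v) = inner A w u + inner A w v.
Proof. by rewrite /inner linearD mulmxDr mxE. Qed.
Lemma innerZl A k u w : inner A (k *: u) w = k * inner A u w.
Proof. by rewrite /inner -!scalemxAl mxE. Qed.
Lemma innerZr A k u w : inner A w (k *: u) = k * inner A w u.
Proof. by rewrite /inner linearZ -scalemxAr mxE. Qed.
Lemma innerNl A u w : inner A (- u) w = - inner A u w.
Proof. by rewrite /inner !mulNmx mxE. Qed.
Lemma innerNr A u w : inner A w (- u) = - inner A w u.
Proof. by rewrite /inner linearN mulmxN mxE. Qed.
Lemma innerBl A u v w : inner A (u - v) w = inner A u w - inner A v w.
Proof. by rewrite innerDl innerNl. Qed.
Lemma innerBr A u v w : inner A w (u - v) = inner A w u - inner A w v.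
Proof. by rewrite innerDr innerNr. Qed.
Lemma inner0l A w : inner A 0 w = 0.
Proof. by rewrite /inner !mul0mx mxE. Qed.
Lemma inner0r A w : inner A w 0 = 0.
Proof. by rewrite /inner trmx0 mulmx0 mxE. Qed.
Lemma inner_suml A I (r : seq I) (P : pred I) (F : I -> 'rV[R]_d) w :
  inner A (\sum_(i <- r | P i) F i) w = \sum_(i <- r | P i) inner A (F i) w.
Proof. by rewrite /inner !mulmx_suml summxE. Qed.
Lemma innerDmx A B u v : inner (A + B) u v = inner A u v + inner B u v.
Proof. by rewrite /inner mulmxDr mulmxDl mxE. Qed.
Lemma innerZmx k A u v : inner (k *: A) u v = k * inner A u v.
Proof. by rewrite /inner -scalemxAr -scalemxAl mxE. Qed.
Lemma innerC A u v : A^T = A -> inner A u v = inner A v u.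
Proof.
move=> sA; rewrite /inner.
have -> : u *m A *m v^T = (v *m A *m u^T)^T by rewrite !trmx_mul trmxK sA mulmxA.
by rewrite mxE.
Qed.

Lemma pairingZ c k u : pairing c (k *: u) = k * pairing c u.
Proof. by rewrite /pairing -scalemxAl mxE. Qed.
Lemma pairingN c u : pairing c (- u) = - pairing c u.
Proof. by rewrite /pairing mulNmx mxE. Qed.

Lemma pairing0 c : pairing c 0 = 0.
Proof. by rewrite /pairing mul0mx mxE. Qed.

Definition posdef A : Prop := forall v, v != 0 -> 0 < inner A v v.

Lemma inner_inj A u v : posdef A -> (forall w, inner A u w = inner A v w) -> u = v.
Proof.
move=> pA E; apply/eqP; rewrite -subr_eq0; apply/negPn/negP => /pA.
by rewrite {1}innerDl innerNl E subrr ltxx.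
Qed.

Lemma inner_eq0 A u : posdef A -> inner A u u = 0 -> u = 0.
Proof. by move=> pA E; apply/eqP/negPn/negP => /pA; rewrite E ltxx. Qed.

Lemma inner_ge0 A u : posdef A -> 0 <= inner A u u.
Proof. by move=> pA; have [->|/pA/ltW//] := eqVneq u 0; rewrite inner0l. Qed.

Lemma posdef_unitmx A : posdef A -> A \in unitmx.
Proof.
move=> pA; rewrite -row_free_unit -kermx_eq0; apply/eqP/row_matrixP => i.
rewrite row0; apply: (inner_eq0 pA).
by rewrite /inner -row_mul mulmx_ker row0 mul0mx mxE.
Qed.

Lemma deriveDdir (W : normedModType R) (G : 'rV[R]_d -> W) x u v :
  differentiable G x -> 'D_(u + v) G x = 'D_u G x + 'D_v G x.
Proof. by move=> dG; rewrite !deriveE // linearD. Qed.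

Lemma deriveZdir (W : normedModType R) (G : 'rV[R]_d -> W) x k u :
  differentiable G x -> 'D_(k *: u) G x = k *: 'D_u G x.
Proof. by move=> dG; rewrite !deriveE // linearZ. Qed.

End Inner.

Opaque inner derive.

Section ProductRules.
Context {R : realType} {d e : nat}.
Implicit Types (x v : 'rV[R]_d) (G : 'rV[R]_d -> 'M[R]_e) (Z W : 'rV[R]_d -> 'rV[R]_e).

Lemma differentiable_inner G Z W x :
  differentiable G x -> differentiable Z x -> differentiable W x ->
  differentiable (fun y => inner (G y) (Z y) (W y)) x.
Proof.
move=> dG dZ dW; under eq_fun do rewrite innerE; apply: differentiable_entry.
apply: differentiable_mulmx; last exact: differentiable_trmx.
exact: differentiable_mulmx.
Qed.

Lemma derive_inner G Z W x v :
  differentiable G x -> differentiable Z x -> differentiable W x ->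
  'D_v (fun y => inner (G y) (Z y) (W y)) x =
  inner ('D_v G x) (Z x) (W x) + inner (G x) ('D_v Z x) (W x) + inner (G x) (Z x) ('D_v W x).
Proof.
move=> dG dZ dW; under eq_fun do rewrite innerE.
have dZG := differentiable_mulmx dZ dG; have dWT := differentiable_trmx dW.
rewrite derive_entry; last exact/diff_derivable/differentiable_mulmx.
rewrite derive_mulmx // derive_mulmx // derive_trmx // mulmxDl.
by rewrite !innerE mxE [X in X + _]mxE [X in X + _]addrC.
Qed.

End ProductRules.

(* The algebra of the Koszul formula: [D v] stands for the derivative of the metric
   in the direction [v] and [G] for the Christoffel symbols. *)
Section Koszul.
Context {R : realType} {e : nat}.
Variables (A : 'M[R]_e) (D : 'rV[R]_e -> 'M[R]_e) (G : 'rV[R]_e -> 'rV[R]_e -> 'rV[R]_e).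
Implicit Types (u v w : 'rV[R]_e).
Hypotheses (symA : A^T = A) (posA : posdef A) (symD : forall v, (D v)^T = D v).
Hypotheses (DD : forall u v, D (u + v) = D u + D v).
Hypotheses (DZ : forall k v, D (k *: v) = k *: D v).
Hypothesis (GE : forall v w u, inner A (G v w) u =
  2^-1 * (inner (D v) w u + inner (D w) v u - inner (D u) v w)).

Lemma koszul_sym v w : G v w = G w v.
Proof.
apply: (inner_inj posA) => u; rewrite !GE (innerC v w (symD u)).
by congr (_ * (_ - _)); rewrite addrC.
Qed.

Lemma koszulDr v w u : G v (w + u) = G v w + G v u.
Proof.
apply: (inner_inj posA) => z.
by rewrite innerDl !GE !innerDr !innerDl DD innerDmx; ring.
Qed.

Lemma koszulZr v k w : G v (k *: w) = k *: G v w.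
Proof.
apply: (inner_inj posA) => z.
by rewrite innerZl !GE !innerZr !innerZl DZ innerZmx; ring.
Qed.

Lemma koszul_metric v w u : inner (D v) w u = inner A (G v w) u + inner A w (G v u).
Proof.
rewrite [X in _ = _ + X](innerC _ _ symA) !GE.
by rewrite (innerC u w (symD v)); field.
Qed.
End Koszul.

Section Christoffel.
Context {R : realType} {e : nat}.
Implicit Types (g : 'rV[R]_e -> 'M[R]_e) (u v w y : 'rV[R]_e).

(** Symmetry is required near [y] because it gets differentiated; positivity enters pointwise. *)
Definition local_metric g y : Prop :=
  [/\ differentiable g y, \forall z \near y, (g z)^T = g z & posdef (g y)].

Lemma local_metric_sym g y : local_metric g y -> (g y)^T = g y.
Proof. by case=> _ sg _; exact: nbhs_singleton sg. Qed.

Lemma derive_metric_sym g y v : local_metric g y -> ('D_v g y)^T = 'D_v g y.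
Proof. by case=> dg sg _; rewrite -derive_trmx //; exact: near_eq_derive sg. Qed.

Lemma derive_inner_const g y v u w : differentiable g y ->
  'D_v (fun z => inner (g z) u w) y = inner ('D_v g y) u w.
Proof.
move=> dg; rewrite (derive_inner (Z := cst u) (W := cst w)) //; try exact: differentiable_cst.
by rewrite !derive_cst inner0l inner0r !addr0.
Qed.

(** [christoffel] lists a linear form on the coordinate vectors and raises its index with [invmx];
    pairing with the metric recovers the form. This reduces all properties of the Christoffel
    symbols to the Koszul formula. *)
Lemma inner_christoffel_linear (A : 'M[R]_e) (phi : 'rV[R]_e -> R) u : posdef A ->
  (forall z t, phi (z + t) = phi z + phi t) -> (forall k z, phi (k *: z) = k * phi z) ->
  inner A (2^-1 *: (\row_l phi (basis_vec l)) *m invmx A) u = 2^-1 * phi u.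
Proof.
move=> /posdef_unitmx AU phiD phiZ.
have phi0 : phi 0 = 0 by rewrite -[0](scale0r 0) phiZ mul0r.
rewrite innerE -!scalemxAl mxE mulmxKV // mxE; congr (_ * _).
rewrite [in RHS](row_sum_delta u) (big_morph phi phiD phi0).
by apply: eq_bigr => l _; rewrite phiZ !mxE mulrC.
Qed.

Lemma koszul_form_linear (D : 'rV[R]_e -> 'M[R]_e) v w
    (phi := fun z => inner (D v) w z + inner (D w) v z - inner (D z) v w) :
  (forall u v, D (u + v) = D u + D v) -> (forall k v, D (k *: v) = k *: D v) ->
  (forall z t, phi (z + t) = phi z + phi t) /\ (forall k z, phi (k *: z) = k * phi z).
Proof.
move=> DD DZ; split=> [z t|k z]; rewrite /phi.
  by rewrite !innerDr DD innerDmx; ring.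
by rewrite !innerZr DZ innerZmx; ring.
Qed.

Lemma inner_christoffel g y v w u : local_metric g y ->
  inner (g y) (christoffel g y v w) u =
  2^-1 * (inner ('D_v g y) w u + inner ('D_w g y) v u - inner ('D_u g y) v w).
Proof.
move=> [dg sg pg]; have [phiD phiZ] :=
  @koszul_form_linear (fun v => 'D_v g y) v w (fun u v => deriveDdir u v dg)
    (fun k v => deriveZdir k v dg).
rewrite -(inner_christoffel_linear u pg phiD phiZ); congr inner.
by congr (_ *m _); congr (_ *: _); apply/rowP => l; rewrite !mxE !derive_inner_const.
Qed.

Section Koszul.
Variables (g : 'rV[R]_e -> 'M[R]_e) (y : 'rV[R]_e).
Hypothesis mg : local_metric g y.
Let dg : differentiable g y. Proof. by case: mg. Qed.
Let pg : posdef (g y). Proof. by case: mg. Qed.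
Let D v := 'D_v g y.
Let symD v : (D v)^T = D v. Proof. exact: derive_metric_sym. Qed.
Let DD u v : D (u + v) = D u + D v. Proof. exact: deriveDdir. Qed.
Let DZ k v : D (k *: v) = k *: D v. Proof. exact: deriveZdir. Qed.
Let GE v w u := inner_christoffel v w u mg.

Lemma christoffel_sym v w : christoffel g y v w = christoffel g y w v.
Proof. exact: (koszul_sym pg symD GE). Qed.

Lemma christoffelDr v w u :
  christoffel g y v (w + u) = christoffel g y v w + christoffel g y v u.
Proof. exact: (koszulDr pg DD GE). Qed.

Lemma christoffelZr v k w : christoffel g y v (k *: w) = k *: christoffel g y v w.
Proof. exact: (koszulZr pg DZ GE). Qed.

Lemma christoffel_metric v w u : inner ('D_v g y) w u =
  inner (g y) (christoffel g y v w) u + inner (g y) w (christoffel g y v u).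
Proof. exact: (koszul_metric (local_metric_sym mg) symD GE). Qed.

Lemma christoffelDl v w u :
  christoffel g y (v + u) w = christoffel g y v w + christoffel g y u w.
Proof. by rewrite !(christoffel_sym _ w) christoffelDr. Qed.

Lemma christoffelZl v k w : christoffel g y (k *: v) w = k *: christoffel g y v w.
Proof. by rewrite !(christoffel_sym _ w) christoffelZr. Qed.

Lemma christoffel0r v : christoffel g y v 0 = 0.
Proof. by have := christoffelZr v 0 0; rewrite !scale0r. Qed.
End Koszul.

Section Nabla.
Variables (g F : 'rV[R]_e -> 'M[R]_e) (y : 'rV[R]_e).
Hypotheses (mg : local_metric g y) (dF : differentiable F y).

Lemma nablaE v Y : nabla g v Y y = 'D_v Y y + christoffel g y v (Y y).
Proof. by []. Qed.

Lemma nabla_cst v w : nabla g v (cst w) y = christoffel g y v w.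
Proof. by rewrite nablaE derive_cst add0r. Qed.

Lemma nabla_endoE v w : nabla_endo g F y v w =
  w *m 'D_v F y + christoffel g y v (w *m F y) - christoffel g y v w *m F y.
Proof.
by rewrite /nabla_endo nabla_cst nablaE (derive_mulmx (X := cst w)) // derive_cst mul0mx add0r.
Qed.

Lemma nabla_endoDr v w u :
  nabla_endo g F y v (w + u) = nabla_endo g F y v w + nabla_endo g F y v u.
Proof.
rewrite !nabla_endoE; have := christoffelDr mg v.
move: (christoffel g y v) ('D_v F y) => C P CD.
by rewrite !mulmxDl !CD mulmxDl opprD (addrACA (w *m P)) [LHS]addrACA.
Qed.

Lemma nabla_endoZr v k w : nabla_endo g F y v (k *: w) = k *: nabla_endo g F y v w.
Proof.
rewrite !nabla_endoE; have := christoffelZr mg v.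
move: (christoffel g y v) ('D_v F y) => C P CZ.
by rewrite -!scalemxAl !CZ -scalemxAl scalerBr scalerDr.
Qed.

Lemma nabla_endoDl v w u :
  nabla_endo g F y (v + u) w = nabla_endo g F y v w + nabla_endo g F y u w.
Proof.
rewrite !nabla_endoE (deriveDdir _ _ dF); have CD z := christoffelDl mg v z u.
move: (christoffel g y) ('D_v F y) ('D_u F y) CD => C P Q CD.
by rewrite !CD mulmxDl mulmxDr opprD (addrACA (w *m P)) [LHS]addrACA.
Qed.

Lemma nabla_endoZl v k w : nabla_endo g F y (k *: v) w = k *: nabla_endo g F y v w.
Proof.
rewrite !nabla_endoE (deriveZdir _ _ dF); have CZ z := christoffelZl mg v k z.
move: (christoffel g y) ('D_v F y) CZ => C P CZ.
by rewrite !CZ -scalemxAl -scalemxAr scalerBr scalerDr.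
Qed.

End Nabla.
End Christoffel.

(** * The pull-back connection along a map *)

Section AlongMap.
Context {R : realType} {d e : nat}.
Variables (g psi : 'rV[R]_e -> 'M[R]_e) (gam : 'rV[R]_d -> 'rV[R]_e) (x : 'rV[R]_d).
Hypotheses (mg : local_metric g (gam x)) (dgam : differentiable gam x).
Implicit Types (v : 'rV[R]_d) (Z W : 'rV[R]_d -> 'rV[R]_e).

(** The connection of the pull-back bundle [gam]^*TN. For [gam = id] it is [nabla], so one set of
    product rules serves vector fields and fields along a map alike. *)
Definition nabla_along v Z : 'rV[R]_e :=
  'D_v Z x + christoffel g (gam x) ('D_v gam x) (Z x).

Lemma derive_along (U : normedModType R) (G : 'rV[R]_e -> U) v :
  differentiable G (gam x) -> 'D_v (fun y => G (gam y)) x = 'D_('D_v gam x) G (gam x).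
Proof.
move=> dG; rewrite !deriveE //; last exact: differentiable_comp.
by rewrite diff_comp.
Qed.

Lemma derive_inner_along v Z W : differentiable Z x -> differentiable W x ->
  'D_v (fun y => inner (g (gam y)) (Z y) (W y)) x =
  inner (g (gam x)) (nabla_along v Z) (W x) + inner (g (gam x)) (Z x) (nabla_along v W).
Proof.
move=> dZ dW; have [dg _ _] := mg.
rewrite derive_inner //; last exact: differentiable_comp.
rewrite derive_along // (christoffel_metric mg) /nabla_along innerDl innerDr; ring.
Qed.

Lemma nabla_along_endo v Z : differentiable psi (gam x) -> differentiable Z x ->
  nabla_along v (fun y => Z y *m psi (gam y)) =
  nabla_along v Z *m psi (gam x) + nabla_endo g psi (gam x) ('D_v gam x) (Z x).
Proof.
move=> dpsi dZ; rewrite /nabla_along derive_mulmx //; last exact: differentiable_comp.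
rewrite derive_along // nabla_endoE // mulmxDl.
set C' := christoffel _ _ _ (Z x) *m _.
by rewrite -[RHS]addrA [C' + _]addrC subrK addrA.
Qed.

End AlongMap.

(** * Almost contact metric structures at a point *)

(* The values at a point of an almost contact metric structure, together with
   [T = nabla xi] and [A v = nabla_v phi]; the form [eta] is [inner g - xi]. *)
Record acm_point (R : realType) (d : nat) (g phi : 'M[R]_d) (xi : 'rV[R]_d)
    (T : 'rV[R]_d -> 'rV[R]_d) (A : 'rV[R]_d -> 'rV[R]_d -> 'rV[R]_d) : Prop := AcmPoint {
  acp_sym : g^T = g;
  acp_pos : posdef g;
  acp_phi2 : forall v, v *m phi *m phi = - v + inner g v xi *: xi;
  acp_compat : forall v w, inner g (v *m phi) (w *m phi) =
    inner g v w - inner g v xi * inner g w xi;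
  acp_xi : inner g xi xi = 1;
  acp_T_xi : forall v, inner g (T v) xi = 0;
  acp_skew : forall v w u, inner g (A v w) u = - inner g w (A v u);
  acp_A_phi : forall v w, A v (w *m phi) + A v w *m phi =
    inner g (T v) w *: xi + inner g w xi *: T v;
  acp_TD : forall v w, T (v + w) = T v + T w;
  acp_TZ : forall k v, T (k *: v) = k *: T v;
  acp_ADl : forall v w u, A (v + w) u = A v u + A w u;
  acp_AZl : forall k v u, A (k *: v) u = k *: A v u;
  acp_ADr : forall v w u, A u (v + w) = A u v + A u w;
  acp_AZr : forall k v u, A u (k *: v) = k *: A u v
}.

Lemma alternating_anti (U W : zmodType) (A : U -> U -> W) :
  (forall u v w, A (u + v) w = A u w + A v w) -> (forall u v w, A w (u + v) = A w u + A w v) ->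
  (forall u, A u u = 0) -> forall v w, A v w = - A w v.
Proof.
move=> Dl Dr A0 v w; have := A0 (v + w); rewrite Dl !Dr !A0 add0r addr0 => /eqP.
by rewrite addr_eq0 => /eqP.
Qed.

Section AcmPoint.
Context {R : realType} {d : nat} {g phi : 'M[R]_d} {xi : 'rV[R]_d}
  {T : 'rV[R]_d -> 'rV[R]_d} {A : 'rV[R]_d -> 'rV[R]_d -> 'rV[R]_d}.
Hypothesis H : acm_point g phi xi T A.
Implicit Types (u v w : 'rV[R]_d).
Local Notation "<< v , w >>" := (inner g v w).

Let gC v w : <<v, w>> = <<w, v>>. Proof. exact: innerC (acp_sym H). Qed.

(** [phi] squared kills [xi]; the formula for [phi] squared at [xi *m phi] then makes [xi *m phi] a
    multiple k of [xi], and a further [phi] gives k^2 = 0. *)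
Lemma acp_xi_phi : xi *m phi = 0.
Proof.
have E2 : xi *m phi *m phi = 0 by rewrite (acp_phi2 H) (acp_xi H) scale1r addNr.
apply: (inner_eq0 (acp_pos H)).
have E3 := acp_phi2 H (xi *m phi); rewrite E2 mul0mx in E3.
have E4 : xi *m phi = <<xi *m phi, xi>> *: xi.
  by apply/eqP; rewrite -subr_eq0 -opprB oppr_eq0 addrC -E3.
have E5 : <<xi *m phi, xi>> = 0.
  have : <<xi *m phi, xi>> *: (<<xi *m phi, xi>> *: xi) = 0.
    by rewrite -E4 scalemxAl -E4 E2.
  rewrite scalerA => /(congr1 (inner g ^~ xi)).
  by rewrite innerZl inner0l (acp_xi H) mulr1 => /eqP; rewrite mulf_eq0 orbb => /eqP.
by rewrite E4 E5 scale0r inner0l.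
Qed.

(** Compute the cube of [phi] in two ways: as the square applied to [v *m phi], and as [phi] applied
    to the square of [v]. *)
Lemma acp_phi_xi v : <<v *m phi, xi>> = 0.
Proof.
have E := acp_phi2 H (v *m phi).
have : (v *m phi *m phi) *m phi = - (v *m phi).
  by rewrite (acp_phi2 H v) mulmxDl mulNmx -scalemxAl acp_xi_phi scaler0 addr0.
rewrite E => /eqP; rewrite -subr_eq0 opprK addrC addNKr => /eqP /(congr1 (inner g ^~ xi)).
by rewrite innerZl (acp_xi H) inner0l mulr1.
Qed.

Lemma acp_phi3 v : v *m phi *m phi *m phi = - (v *m phi).
Proof. by rewrite (acp_phi2 H (v *m phi)) acp_phi_xi scale0r addr0. Qed.

Lemma acp_phi_skew v w : <<v *m phi, w>> = - <<v, w *m phi>>.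
Proof.
have := acp_compat H (v *m phi) w; rewrite acp_phi_xi mul0r subr0 => <-.
rewrite (acp_phi2 H) innerDl innerNl innerZl [<<xi, _>>]gC acp_phi_xi; ring.
Qed.

Lemma acp_phi_self v : <<v, v *m phi>> = 0.
Proof.
have := acp_phi_skew v v; rewrite gC => /eqP.
by rewrite -subr_eq0 opprK -mulr2n mulrn_eq0 => /eqP.
Qed.

Lemma acp_phi2_D v : <<v, xi>> = 0 -> v *m phi *m phi = - v.
Proof. by rewrite (acp_phi2 H) => ->; rewrite scale0r addr0. Qed.

Lemma acp_norm_phi v : <<v, xi>> = 0 -> <<v *m phi, v *m phi>> = <<v, v>>.
Proof. by rewrite (acp_compat H) => ->; rewrite mul0r subr0. Qed.

Lemma acp_ker_phi v : v *m phi = 0 -> v = <<v, xi>> *: xi.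
Proof.
move=> v0; have := acp_phi2 H v; rewrite v0 mul0mx => /esym/eqP.
by rewrite addrC subr_eq0 => /eqP ->.
Qed.

Lemma acp_A0r v : A v 0 = 0.
Proof. by have := acp_AZr H 0 0 v; rewrite !scale0r. Qed.
Lemma acp_A0l v : A 0 v = 0.
Proof. by have := acp_AZl H 0 0 v; rewrite !scale0r. Qed.
Lemma acp_ANr v w : A v (- w) = - A v w.
Proof. by have := acp_AZr H (-1) w v; rewrite !scaleN1r. Qed.
Lemma acp_T0 : T 0 = 0.
Proof. by have := acp_TZ H 0 0; rewrite !scale0r. Qed.
Lemma acp_TN v : T (- v) = - T v.
Proof. by have := acp_TZ H (-1) v; rewrite !scaleN1r. Qed.

Lemma acp_A_xi_xi v : <<A v xi, xi>> = 0.
Proof.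
have := acp_skew H v xi xi; rewrite [<<xi, _>>]gC => /eqP.
by rewrite -subr_eq0 opprK -mulr2n mulrn_eq0 => /eqP.
Qed.

(** At [xi], the derivative of the identity for [phi] squared reads [A v xi *m phi = T v]. Applying
    [phi] once more inverts this, since [A v xi] has no [xi]-component by skewness. *)
Lemma acp_A_xi v : A v xi = - (T v *m phi).
Proof.
have E := acp_A_phi H v xi.
rewrite acp_xi_phi acp_A0r add0r (acp_T_xi H) scale0r add0r (acp_xi H) scale1r in E.
by rewrite -E (acp_phi2 H) acp_A_xi_xi scale0r addr0 opprK.
Qed.

Lemma acp_eta_A v w : <<A v w, xi>> = <<w, T v *m phi>>.
Proof. by rewrite (acp_skew H) acp_A_xi innerNr opprK. Qed.

Lemma acp_T_of_phi v : T v *m phi = 0 -> T v = 0.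
Proof. by move/acp_ker_phi ->; rewrite (acp_T_xi H) scale0r. Qed.

Lemma acp_T_xi0 : A xi xi = 0 -> T xi = 0.
Proof. by rewrite acp_A_xi => /eqP; rewrite oppr_eq0 => /eqP /acp_T_of_phi. Qed.

(* [S_point] is the defect in [B (phi v) (phi v) + B v v = 0] for the second fundamental
   form [B] of a holomorphic map; see [hol_B_phi_phi]. *)
Definition S_point v := A (v *m phi) v + A v v *m phi.
Definition P_point v w := A v w + A (v *m phi) (w *m phi).
Definition d_eta_point v w := 2^-1 * (<<T v, w>> - <<T w, v>>).
Definition d_Omega_point u v w := <<v, A u w>> + <<w, A v u>> + <<u, A w v>>.

(* What the theorem uses about the target: the classes A1, A2, A3, A5, A6 are of contact
   type with [rho != 0], while A4, B1 (with [beta = 0]) and B3 are of Kenmotsu type. *)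
Definition contact_type (rho : R) : Prop := T xi = 0 /\
  forall v, <<v, xi>> = 0 -> <<T v, v *m phi>> - <<T (v *m phi), v>> = - (2 * rho * <<v, v>>).
Definition kenmotsu_type (beta : R) : Prop := T xi = 0 /\
  forall v, <<v, xi>> = 0 -> S_point v *m phi = 0 /\
    <<T v, v>> + <<T (v *m phi), v *m phi>> = 2 * beta * <<v, v>>.
(** A condition on the source, made for pluriharmonicity. The item on [A xi] is what separates these
    types from the nearly cosymplectic ones: there [A xi v = T v *m phi], which vanishes only if
    [T v] does. *)
Definition restricted_type : Prop := [/\ T xi = 0, forall v, A xi v = 0,
  forall v, T (v *m phi) = - (T v *m phi) & forall v, <<v, xi>> = 0 -> S_point v *m phi = 0].

Lemma acp_skew_r v w : <<v, w *m phi>> = - <<v *m phi, w>>.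
Proof. by rewrite acp_phi_skew opprK. Qed.

Lemma S_point_eta v : <<S_point v, xi>> = - <<T (v *m phi), v *m phi>>.
Proof. by rewrite innerDl acp_phi_xi addr0 acp_eta_A acp_skew_r gC. Qed.

Lemma P_point_eta v : <<v, xi>> = 0 ->
  <<P_point v v, xi>> = <<T (v *m phi), v>> - <<T v, v *m phi>>.
Proof.
move=> v0; rewrite innerDl !acp_eta_A (acp_compat H) v0 mul0r subr0.
by rewrite acp_skew_r [<<v *m phi, _>>]gC [<<v, _>>]gC addrC.
Qed.

(** The tension produces sums of [S_point], whereas the codifferential of [Omega] controls sums of
    [P_point]; the two agree up to [phi] and a multiple of [xi], by the derivative of [phi] squared
    at [v *m phi]. *)
Lemma S_pointE v : <<v, xi>> = 0 ->
  S_point v = P_point v v *m phi - <<T (v *m phi), v *m phi>> *: xi.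
Proof.
move=> v0; have := acp_A_phi H (v *m phi) (v *m phi).
rewrite (acp_phi2_D v0) acp_ANr acp_phi_xi scale0r addr0 => E.
by rewrite -E /S_point /P_point mulmxDl opprD opprK addrACA subrr addr0 addrC.
Qed.

(** The form of [S_point] adapted to [d_Omega_point]: its skew part is what [d_Omega_phi]
    computes. *)
Lemma S_pointE' v : <<v, xi>> = 0 ->
  S_point v = A (v *m phi) v - A v (v *m phi) + <<T v, v>> *: xi.
Proof.
move=> v0; have := acp_A_phi H v v; rewrite v0 scale0r addr0 => <-.
by rewrite /S_point addrA subrK.
Qed.

Lemma T_eq0 v : (forall w, <<T v, w>> = 0) -> T v = 0.
Proof. by move=> E; apply: (inner_inj (acp_pos H)) => w; rewrite E inner0l. Qed.

Lemma d_eta_T_xi : (forall w, d_eta_point xi w = 0) -> T xi = 0.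
Proof.
move=> E; apply: T_eq0 => w; have := E w.
by rewrite /d_eta_point (acp_T_xi H) subr0 => /eqP; rewrite mulf_eq0 invr_eq0 pnatr_eq0 => /eqP.
Qed.

Lemma contact_type_d_eta a : (forall v w, d_eta_point v w = a * <<v, w *m phi>>) ->
  contact_type a.
Proof.
move=> E; split; first by apply: d_eta_T_xi => w; rewrite E acp_skew_r acp_xi_phi inner0l oppr0 mulr0.
move=> v v0; have := E v (v *m phi); rewrite (acp_phi2_D v0) innerNr /d_eta_point; lra.
Qed.

(** At [xi] the second term drops out because [xi *m phi = 0]; at (v, phi v) with v orthogonal to
    [xi], the two terms on the right coincide. *)
Lemma contact_type_nearly a :
  (forall v w, 2 * a * <<v, w *m phi>> = d_eta_point v w + d_eta_point (v *m phi) (w *m phi)) ->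
  contact_type a.
Proof.
move=> E; split.
  apply: d_eta_T_xi => w; have := E xi w.
  rewrite acp_skew_r acp_xi_phi inner0l oppr0 mulr0 [X in _ + X]/d_eta_point acp_T0.
  by rewrite inner0l inner0r subrr mulr0 addr0.
move=> v v0; have := E v (v *m phi).
rewrite (acp_phi2_D v0) /d_eta_point !acp_TN !innerNr !innerNl; lra.
Qed.

Lemma contact_type_P a : A xi xi = 0 ->
  (forall v, <<v, xi>> = 0 -> <<P_point v v, xi>> = 2 * a * <<v, v>>) -> contact_type a.
Proof.
move=> /acp_T_xi0 T0 E; split=> // v v0.
by rewrite -(E v v0) (P_point_eta v0) opprB.
Qed.

Lemma contact_type_A a : A xi xi = 0 ->
  (forall v, <<v, xi>> = 0 -> <<A v v, xi>> = a * <<v, v>>) -> contact_type a.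
Proof.
move=> A0 E; apply: contact_type_P => // v v0.
by rewrite innerDl !E ?acp_phi_xi // acp_norm_phi //; ring.
Qed.

(** Of the three cyclic terms, [<<v, A z (v *m phi)>>] vanishes: [A z] is skew and anticommutes with
    [phi] up to terms in [xi], so this number is its own opposite. *)
Lemma d_Omega_phi v z : <<v, xi>> = 0 ->
  d_Omega_point v (v *m phi) z = <<A (v *m phi) v - A v (v *m phi), z>>.
Proof.
move=> v0.
have third : <<v, A z (v *m phi)>> = 0.
  have := congr1 (inner g ^~ v) (acp_A_phi H z v); rewrite v0 scale0r addr0.
  rewrite innerDl innerZl [<<xi, v>>]gC v0 mulr0 acp_phi_skew (acp_skew H z v).
  rewrite (acp_skew H z (v *m phi)) opprK [<<v *m phi, _>>]gC (acp_skew H z v).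
  by move=> E; have : 2 * <<v, A z (v *m phi)>> = 0; lra.
rewrite /d_Omega_point third addr0 innerBl (acp_skew H v (v *m phi)) opprK.
by rewrite addrC [<<z, _>>]gC.
Qed.

(** Inserting (v, phi v, z) shows that [S_point v] is a multiple of [xi]. Its coefficient is also
    given by [S_point_eta], and the comparison is the trace condition with constant [beta]. *)
Lemma kenmotsu_type_d_Omega beta : T xi = 0 ->
  (forall u v w, d_Omega_point u v w = 2 * beta *
     (<<u, xi>> * <<v, w *m phi>> + <<v, xi>> * <<w, u *m phi>> + <<w, xi>> * <<u, v *m phi>>)) ->
  kenmotsu_type beta.
Proof.
move=> T0 E; split=> // v v0.
have E1 : A (v *m phi) v - A v (v *m phi) = - (2 * beta * <<v, v>>) *: xi.
  apply: (inner_inj (acp_pos H)) => z; rewrite -d_Omega_phi // E v0 acp_phi_xi.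
  rewrite (acp_phi2_D v0) innerNr innerZl [<<xi, _>>]gC; ring.
have E2 : S_point v = (<<T v, v>> - 2 * beta * <<v, v>>) *: xi.
  by rewrite S_pointE' // E1 -scalerDl addrC.
split; first by rewrite E2 -scalemxAl acp_xi_phi scaler0.
have := S_point_eta v; rewrite E2 innerZl (acp_xi H) mulr1 => E3.
by rewrite -[<<T (v *m phi), _>>]opprK -E3; ring.
Qed.

Lemma T_phi2 v : T v *m phi *m phi = - T v.
Proof. by rewrite (acp_phi2 H) (acp_T_xi H) scale0r addr0. Qed.

Lemma A_xi_phi v : T xi = 0 -> A xi (v *m phi) = - (A xi v *m phi).
Proof.
move=> T0; have := acp_A_phi H xi v; rewrite T0 inner0l scale0r scaler0 addr0.
by move=> /eqP; rewrite addr_eq0 => /eqP.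
Qed.

(* [T v = - phi (A xi v)], where [A xi] is skew and anticommutes with [phi]: hence [T] is
   skew, that is, [xi] is a Killing field. *)
Section NearlyCosymplectic.
Hypothesis AD : forall v, A v v = 0.

Lemma nearly_A_anti v w : A v w = - A w v.
Proof. exact: (alternating_anti (acp_ADl H) (acp_ADr H) AD). Qed.

Lemma nearly_S v : <<v, xi>> = 0 -> S_point v *m phi = 0.
Proof.
move=> v0; have := acp_A_phi H v v; rewrite AD mul0mx addr0 v0 scale0r addr0 => E.
rewrite /S_point AD mul0mx addr0 nearly_A_anti E -scaleNr -scalemxAl.
by rewrite acp_xi_phi scaler0.
Qed.

Lemma kenmotsu_type_nearly : kenmotsu_type 0.
Proof.
have T0 : T xi = 0 by apply: acp_T_xi0.
split=> // v v0; split; first exact: nearly_S.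
have TE u : <<T u, u>> = <<A xi u, u *m phi>>.
  have := acp_A_xi u; rewrite nearly_A_anti => /eqP; rewrite eqr_opp => /eqP ->.
  by rewrite acp_skew_r T_phi2 innerNl opprK.
have E : <<A xi v, v *m phi>> = 0.
  have := acp_skew_r (A xi v) v.
  rewrite -[A xi v *m phi]opprK -A_xi_phi // innerNl opprK (acp_skew H) gC => E.
  lra.
rewrite !TE E A_xi_phi // innerNl acp_phi_skew opprK (acp_phi3 v) innerNr E; ring.
Qed.
End NearlyCosymplectic.

Section QuasiKCosymplectic.
Hypothesis PE : forall v w, P_point v w = <<w, xi>> *: T (v *m phi).

Lemma quasiK_T_xi : T xi = 0.
Proof.
apply: acp_T_xi0; have := PE xi xi.
by rewrite /P_point acp_xi_phi acp_A0l addr0 acp_T0 scaler0.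
Qed.

Lemma quasiK_T_phi v : T (v *m phi) = - (T v *m phi).
Proof.
have := PE v xi; rewrite /P_point acp_xi_phi acp_A0r addr0 (acp_xi H) scale1r.
by rewrite acp_A_xi.
Qed.

Lemma quasiK_S v : <<v, xi>> = 0 -> S_point v *m phi = 0.
Proof.
move=> v0; rewrite S_pointE // PE v0 scale0r mul0mx sub0r mulNmx -scalemxAl.
by rewrite acp_xi_phi scaler0 oppr0.
Qed.

Lemma kenmotsu_type_quasiK : kenmotsu_type 0.
Proof.
split=> [|v v0]; first exact: quasiK_T_xi.
split; first exact: quasiK_S.
rewrite quasiK_T_phi innerNl (acp_compat H) v0; ring.
Qed.

Lemma restricted_type_quasiK : restricted_type.
Proof.
split; [exact: quasiK_T_xi| |exact: quasiK_T_phi|exact: quasiK_S].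
move=> v; have := PE xi v.
by rewrite /P_point acp_xi_phi acp_A0l addr0 acp_T0 scaler0.
Qed.
End QuasiKCosymplectic.

Lemma restricted_type_nearlyK :
  (forall v, A v v = 0) -> (forall v, A v xi = 0) -> restricted_type.
Proof.
move=> AD A0; have T0 v : T v = 0.
  by apply: acp_T_of_phi; have := acp_A_xi v; rewrite A0 => /eqP; rewrite eq_sym oppr_eq0 => /eqP.
split=> // [v|v|v]; last exact: nearly_S.
  by rewrite (nearly_A_anti AD) A0 oppr0.
by rewrite !T0 mul0mx oppr0.
Qed.

(** Closedness of [eta] makes [T] symmetric, and dOmega(xi, ., .) = 0 then gives [AE]. Since [A xi]
    anticommutes with [phi], [AE] forces [TE], that is, [T] anticommutes with [phi]; fed back into
    [AE], this kills [A xi]. *)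
Lemma restricted_type_almost :
  (forall v w, d_eta_point v w = 0) -> (forall u v w, d_Omega_point u v w = 0) ->
  restricted_type.
Proof.
move=> de dO; have T0 : T xi = 0 by apply: d_eta_T_xi.
have Tsym v w : <<T v, w>> = <<T w, v>>.
  have := de v w; rewrite /d_eta_point => /eqP.
  by rewrite mulf_eq0 invr_eq0 pnatr_eq0 subr_eq0 => /eqP.
have AE w : A xi w = - T (w *m phi) - T w *m phi.
  apply: (inner_inj (acp_pos H)) => v; have := dO xi v w.
  rewrite /d_Omega_point acp_A_xi innerNr acp_skew_r [<<xi, _>>]gC acp_eta_A.
  rewrite [<<w *m phi, _>>]gC Tsym innerBl innerNl [<<A _ _, v>>]gC [<<v, T w *m phi>>]gC.
  lra.
have TE w : T w = T (w *m phi) *m phi.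
  have := A_xi_phi w T0; rewrite !AE (acp_phi2 H w) (acp_TD H) acp_TN (acp_TZ H) T0.
  rewrite scaler0 addr0 opprK mulmxBl mulNmx T_phi2 opprB opprK.
  move: (T (w *m phi) *m phi) (T w) => X Y.
  rewrite [- Y + X]addrC -[X - Y]opprB => /eqP.
  by rewrite -subr_eq0 opprK -mulr2n -scaler_nat scaler_eq0 pnatr_eq0 subr_eq0 => /eqP.
have TN w : T (w *m phi) = - (T w *m phi) by rewrite [in RHS]TE T_phi2 opprK.
split=> // [v|v v0].
  by rewrite AE TN opprK subrr.
have [_ /(_ v v0) []] // : kenmotsu_type 0.
apply: kenmotsu_type_d_Omega => // u w z; rewrite dO; ring.
Qed.

End AcmPoint.

Arguments S_point {R d} phi A v.
Arguments P_point {R d} phi A v w.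
Arguments d_eta_point {R d} g T v w.
Arguments d_Omega_point {R d} g A u v w.
Arguments contact_type {R d} g phi xi T rho.
Arguments kenmotsu_type {R d} g phi xi T A beta.
Arguments restricted_type {R d} g phi xi T A.

Lemma metric_local (R : realType) (d : nat) (N : riemannian R d) (c : chart N) x :
  chart_img c x -> local_metric (metric c) x.
Proof.
move=> cx; have [sg _ symg posg] := metricP N; split.
- exact: smooth_on_differentiable (sg c) cx.
- by apply: filterS (chart_img_nbhs cx) => y; exact: symg.
- by move=> v; exact: posg.
Qed.

Lemma differentiable_id (R : numFieldType) (V : normedModType R) (x : V) : differentiable id x.
Proof. exact: ex_diff. Qed.

Lemma skew_derivative_algebra (R : realType) d (g F : 'M[R]_d) (z b aw au w u : 'rV[R]_d) :
  (forall w u, inner g (w *m F) u = - inner g w (u *m F)) ->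
  inner g (z *m F + aw) u + inner g (w *m F) b = - (inner g z (u *m F) + inner g w (b *m F + au)) ->
  inner g aw u = - inner g w au.
Proof. by move=> sk; rewrite innerDl innerDr !sk; lra. Qed.

(** * Product rules for vector fields, endomorphisms and their fundamental forms *)

Section Levi_Civita.
Context {R : realType} {d : nat} (g F : 'rV[R]_d -> 'M[R]_d) (x : 'rV[R]_d).
Hypotheses (mg : local_metric g x) (dF : differentiable F x).
Implicit Types (v : 'rV[R]_d) (Y Z : 'rV[R]_d -> 'rV[R]_d).

Lemma nabla_along_id v Y : nabla g v Y x = nabla_along g id x v Y.
Proof. by rewrite /nabla_along derive_id. Qed.

Lemma derive_inner_nabla v Y Z : differentiable Y x -> differentiable Z x ->
  'D_v (fun y => inner (g y) (Y y) (Z y)) x =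
  inner (g x) (nabla g v Y x) (Z x) + inner (g x) (Y x) (nabla g v Z x).
Proof.
move=> dY dZ; rewrite !nabla_along_id.
exact: (derive_inner_along (gam := id) mg (differentiable_id x) v dY dZ).
Qed.

Lemma nabla_mulmx v Y : differentiable Y x ->
  nabla g v (fun y => Y y *m F y) x = nabla g v Y x *m F x + nabla_endo g F x v (Y x).
Proof.
move=> dY; rewrite !nabla_along_id.
rewrite (nabla_along_endo g (gam := id) (differentiable_id x) v dF dY).
by rewrite derive_id.
Qed.

Lemma nabla_near v Y Z : (\forall y \near x, Y y = Z y) -> nabla g v Y x = nabla g v Z x.
Proof. by move=> E; rewrite /nabla (near_eq_derive _ E) (nbhs_singleton E). Qed.

Lemma nabla_endo_skew v w u :
  (\forall y \near x, forall w u, inner (g y) (w *m F y) u = - inner (g y) w (u *m F y)) ->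
  inner (g x) (nabla_endo g F x v w) u = - inner (g x) w (nabla_endo g F x v u).
Proof.
move=> skF; have dmul (z : 'rV[R]_d) : differentiable (fun y => z *m F y) x.
  exact: (differentiable_mulmx (X := cst z)).
have E : 'D_v (fun y => inner (g y) (w *m F y) u) x =
         - 'D_v (fun y => inner (g y) w (u *m F y)) x.
  rewrite -deriveN; last first.
    by apply/diff_derivable/(differentiable_inner (Z := cst w)) => //; case: mg.
  by apply: near_eq_derive; apply: filterS skF => y; apply.
have E1 : 'D_v (fun y => inner (g y) w (u *m F y)) x =
    inner (g x) (nabla g v (cst w) x) (u *m F x) + inner (g x) w (nabla g v (fun y => u *m F y) x).
  exact: (derive_inner_nabla v (differentiable_cst w x) (dmul u)).
have E2 : 'D_v (fun y => inner (g y) (w *m F y) u) x =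
    inner (g x) (nabla g v (fun y => w *m F y) x) u + inner (g x) (w *m F x) (nabla g v (cst u) x).
  exact: (derive_inner_nabla v (dmul w) (differentiable_cst u x)).
have E3 z : nabla g v (fun y => z *m F y) x = nabla g v (cst z) x *m F x + nabla_endo g F x v z.
  exact: (nabla_mulmx v (differentiable_cst z x)).
move: E; rewrite E1 E2 !E3; exact: (skew_derivative_algebra (nbhs_singleton skF)).
Qed.

Lemma nabla_2form_fundamental u v w :
  nabla_2form g (fundamental_form g F) x u v w = inner (g x) v (nabla_endo g F x u w).
Proof.
rewrite /nabla_2form /fundamental_form.
rewrite (derive_inner_nabla u (Y := cst v) (Z := fun y => w *m F y)) //; last first.
  exact: (differentiable_mulmx (X := cst w)).
rewrite /nabla_endo; move: (nabla g u (cst v) x) (nabla g u (cst w) x) (nabla _ _ _ _) => a b z.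
by rewrite innerBr; ring.
Qed.

End Levi_Civita.

Lemma phi2_derivative_algebra (R : realType) d (g : 'M[R]_d) (a t xi w X Y : 'rV[R]_d) :
  g^T = g ->
  - a + (inner g a xi + inner g w t) *: xi + inner g w xi *: t =
    - a + inner g a xi *: xi + X + Y ->
  Y + X = inner g t w *: xi + inner g w xi *: t.
Proof.
move=> sg; rewrite scalerDl !addrA => E; apply: (addrI (- a + inner g a xi *: xi)).
by rewrite !addrA (innerC t w sg) E [RHS]addrAC.
Qed.

(** * The pointwise data of an almost contact metric manifold *)

Section AlmostContactPoint.
Context {R : realType} {m : nat} {M : almost_contact_metric R m} (c : chart M).
Local Notation V := 'rV[R]_((m.*2).+1).
Implicit Types (x v w u : V).
Local Notation g := (metric c).
Local Notation phi := (acm_phi c).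
Local Notation xi := (acm_xi c).
Local Notation eta := (acm_eta c).

(** The argument of [acp_xi_phi] with [pairing] in place of [inner]: [eta] is not yet known to be
    metrically dual to [xi], and [pairing_eta] below rests on this lemma. *)
Lemma acm_xi_phi x : chart_img c x -> xi x *m phi x = 0.
Proof.
move=> cx; have E2 : xi x *m phi x *m phi x = 0.
  by rewrite acm_phi2 // acm_eta_xi // scale1r addNr.
have E3 := acm_phi2 (xi x *m phi x) cx; rewrite E2 mul0mx in E3.
have E4 : xi x *m phi x = pairing (eta x) (xi x *m phi x) *: xi x.
  by apply/eqP; rewrite -subr_eq0 -opprB oppr_eq0 addrC -E3.
have E5 : pairing (eta x) (xi x *m phi x) = 0.
  have : pairing (eta x) (xi x *m phi x) *: (pairing (eta x) (xi x *m phi x) *: xi x) = 0.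
    by rewrite -E4 scalemxAl -E4 E2.
  rewrite scalerA => /(congr1 (pairing (eta x))).
  rewrite pairingZ acm_eta_xi // mulr1 pairing0.
  by move=> /eqP; rewrite mulf_eq0 orbb => /eqP.
by rewrite E4 E5 scale0r.
Qed.

Lemma pairing_eta x v : chart_img c x -> pairing (eta x) v = inner (g x) v (xi x).
Proof.
move=> cx; have := acm_compat v (xi x) cx.
by rewrite acm_xi_phi // inner0r acm_eta_xi // mulr1 => /esym /eqP; rewrite subr_eq0 => /eqP ->.
Qed.

(* Taking [T] and [A] to be zero gives access to the purely algebraic identities. *)
Lemma acm_algebra_point x : chart_img c x ->
  acm_point (g x) (phi x) (xi x) (fun=> 0) (fun _ _ => 0).
Proof.
move=> cx; have mg := metric_local cx.
have [_ _ pg] := mg; split=> //.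
- exact: local_metric_sym.
- by move=> v; rewrite acm_phi2 // pairing_eta.
- by move=> v w; rewrite acm_compat // !pairing_eta.
- by rewrite -pairing_eta // acm_eta_xi.
- by move=> v; rewrite inner0l.
- by move=> v w u; rewrite inner0l inner0r oppr0.
- by move=> v w; rewrite mul0mx inner0l scale0r scaler0.
- by move=> *; rewrite addr0.
- by move=> *; rewrite scaler0.
- by move=> *; rewrite addr0.
- by move=> *; rewrite scaler0.
- by move=> *; rewrite addr0.
- by move=> *; rewrite scaler0.
Qed.

Section AtPoint.
Variable x : V.
Hypothesis cx : chart_img c x.

Let mg : local_metric g x. Proof. exact: metric_local. Qed.

Lemma acm_phi_differentiable : differentiable phi x.
Proof. exact: smooth_on_differentiable ((acm_phiP M).1 c) cx. Qed.

Lemma acm_xi_differentiable : differentiable xi x.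
Proof. exact: smooth_on_differentiable ((acm_xiP M).1 c) cx. Qed.

Let dphi := acm_phi_differentiable.
Let dxi := acm_xi_differentiable.

Lemma near_chart (P : V -> Prop) : (forall y, chart_img c y -> P y) -> \forall y \near x, P y.
Proof. by move=> HP; apply: filterS (chart_img_nbhs cx) => y /HP. Qed.

Lemma derive_eta v w : 'D_v (fun y => pairing (eta y) w) x =
  inner (g x) (nabla g v (cst w) x) (xi x) + inner (g x) w (nabla_xi c x v).
Proof.
rewrite -(derive_inner_nabla mg v (Y := cst w) (Z := xi)) //.
by apply: near_eq_derive; apply: near_chart => y cy; rewrite pairing_eta.
Qed.

Let dmul v : differentiable (fun y => v *m phi y) x.
Proof. exact: (differentiable_mulmx (X := cst v)). Qed.

Let nabla_mul v w : nabla g v (fun y => w *m phi y) x =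
  nabla g v (cst w) x *m phi x + nabla_phi c x v w.
Proof. exact: (nabla_mulmx g dphi v (Y := cst w)). Qed.

Lemma inner_nabla_xi_xi v : inner (g x) (nabla_xi c x v) (xi x) = 0.
Proof.
have E1 : 'D_v (fun y => inner (g y) (xi y) (xi y)) x = 'D_v (fun=> 1 : R) x.
  by apply: near_eq_derive; apply: near_chart => y cy; rewrite -pairing_eta // acm_eta_xi.
have := derive_inner_nabla mg v dxi dxi.
rewrite E1 derive_cst -/(nabla_xi c x v) [inner _ (xi x) _]innerC ?local_metric_sym //.
by move: (inner _ _ _) => r E; lra.
Qed.

Lemma nabla_phi_skew v w u :
  inner (g x) (nabla_phi c x v w) u = - inner (g x) w (nabla_phi c x v u).
Proof.
apply: (nabla_endo_skew mg dphi); apply: near_chart => y cy z t.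
exact: (acp_phi_skew (acm_algebra_point cy)).
Qed.

(** The covariant derivative of phi^2 = - id + eta (x) xi applied to a constant field [w]; [k] is
    the function eta(w), written with the metric so that its derivative is known. *)
Lemma nabla_phi_mulphi v w :
  nabla_phi c x v (w *m phi x) + nabla_phi c x v w *m phi x =
  inner (g x) (nabla_xi c x v) w *: xi x + inner (g x) w (xi x) *: nabla_xi c x v.
Proof.
have E1 := nabla_mulmx g dphi v (dmul w).
rewrite nabla_mul mulmxDl in E1.
pose k y := inner (g y) w (xi y).
have dk : differentiable k x.
  by apply: (differentiable_inner (Z := cst w)) => //; case: mg.
have Dk : 'D_v k x = inner (g x) (nabla g v (cst w) x) (xi x) + inner (g x) w (nabla_xi c x v).
  exact: (derive_inner_nabla mg v (Y := cst w)).
have E2 : nabla g v (fun y => w *m phi y *m phi y) x =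
    - nabla g v (cst w) x + 'D_v k x *: xi x + k x *: nabla_xi c x v.
  rewrite (@nabla_near _ _ _ _ v _ (fun y => - w + k y *: xi y)); last first.
    by apply: near_chart => y cy; rewrite acm_phi2 // pairing_eta.
  have dkxi := differentiable_scalemx dk dxi.
  have D1 : 'D_v (fun y => - w + k y *: xi y) x = 'D_v k x *: xi x + k x *: 'D_v xi x.
    by rewrite (deriveD (f := cst (- w))) ?derive_cst ?add0r ?derive_scalemx //; exact: diff_derivable.
  rewrite /nabla D1 derive_cst add0r (christoffelDr mg) (christoffelZr mg).
  rewrite -scaleN1r (christoffelZr mg) scaleN1r /nabla_xi /nabla scalerDr.
  move: (christoffel g x v w) (christoffel g x v _) ('D_v k x *: _) ('D_v xi x) => a b p q.
  by rewrite addrACA (addrC p).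
rewrite E2 Dk (acp_phi2 (acm_algebra_point cx)) in E1.
exact: (phi2_derivative_algebra (local_metric_sym mg) E1).
Qed.

Lemma acm_acm_point : acm_point (g x) (phi x) (xi x) (nabla_xi c x) (nabla_phi c x).
Proof.
have [Hs Hp Hphi Hc Hx _ _ _ _ _ _ _ _ _] := acm_algebra_point cx.
split; [exact: Hs|exact: Hp|exact: Hphi|exact: Hc|exact: Hx|..].
- exact: inner_nabla_xi_xi.
- exact: nabla_phi_skew.
- exact: nabla_phi_mulphi.
- move=> v w; rewrite /nabla_xi /nabla deriveDdir // (christoffelDl mg).
  by rewrite addrACA.
- by move=> k v; rewrite /nabla_xi /nabla deriveZdir // (christoffelZl mg) scalerDr.
- by move=> v w u; exact: nabla_endoDl.
- by move=> k v u; exact: nabla_endoZl.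
- by move=> v w u; exact: nabla_endoDr.
- by move=> k v u; exact: nabla_endoZr.
Qed.

End AtPoint.
End AlmostContactPoint.

Lemma acm_xi_component (R : realType) d (g phi : 'M[R]_d) xi T A (a b c : 'rV[R]_d) k :
  acm_point g phi xi T A ->
  a *m phi *m phi + 0 - b *m phi - c *m phi + (2 * k) *: xi = 0 -> k = 0.
Proof.
move=> H /(congr1 (inner g ^~ xi)); rewrite addr0 !innerDl !innerNl !(acp_phi_xi H).
by rewrite innerZl inner0l (acp_xi H); lra.
Qed.

(** * Pointwise consequences of the class conditions *)

Section Classes.
Context {R : realType} {m : nat} {M : almost_contact_metric R m} (c : chart M).
Local Notation V := 'rV[R]_((m.*2).+1).
Variable x : V.
Hypothesis cx : chart_img c x.
Local Notation g := (metric c).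
Local Notation phi := (acm_phi c).
Local Notation xi := (acm_xi c).
Local Notation eta := (acm_eta c).
Local Notation T := (nabla_xi c x).
Local Notation A := (nabla_phi c x).

Let mg : local_metric g x := metric_local cx.
Let dphi := acm_phi_differentiable cx.
Let dxi := acm_xi_differentiable cx.
Let H := acm_acm_point cx.

Lemma bracket_cst_r (X : V -> V) w : bracket X (cst w) x = - 'D_w X x.
Proof. by rewrite /bracket derive_cst add0r. Qed.

(** The connection is torsion-free: the Christoffel terms of the two derivatives of [eta] cancel. *)
Lemma d_etaE v w : d_eta c x v w = d_eta_point (g x) T v w.
Proof.
rewrite /d_eta /d_eta_fields bracket_cst_r derive_cst oppr0 pairing0 subr0; congr (_ * _).
have := derive_eta cx v w; have := derive_eta cx w v.
rewrite !nabla_cst /cst => -> ->.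
rewrite (christoffel_sym mg w v) (innerC w (T v) (local_metric_sym mg)).
rewrite (innerC v (T w) (local_metric_sym mg)).
by rewrite opprD addrACA subrr add0r.
Qed.

Lemma d_OmegaE u v w : d_Omega c x u v w = d_Omega_point (g x) A u v w.
Proof.
have E a b z : nabla_2form g (@Omega _ _ _ c) x a b z = inner (g x) b (A a z) :=
  nabla_2form_fundamental mg dphi a b z.
by rewrite /d_Omega /ext_2form !E.
Qed.

(** [h_tensor] extends its argument by constant components, so [xi, xi] = 0 cannot be quoted
    directly. The two brackets add up to the derivative of [xi *m phi], which vanishes near the
    point. *)
Lemma h_tensor_xi : h_tensor c x (xi x) = 0.
Proof.
rewrite /h_tensor bracket_cst_r mulNmx opprK.
have dz : differentiable (fun y => xi x *m phi y) x by exact: (differentiable_mulmx (X := cst (xi x))).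
have E : 'D_(xi x) (fun y => xi x *m phi y) x + 'D_(xi x) xi x *m phi x = 0.
  have := derive_mulmx (xi x) dxi dphi; have := derive_mulmx (xi x) (differentiable_cst (xi x) x) dphi.
  rewrite derive_cst mul0mx add0r /cst => ->.
  have -> : 'D_(xi x) (fun y => xi y *m phi y) x = 'D_(xi x) (fun=> 0) x.
    by apply: near_eq_derive; apply: (near_chart cx) => y; exact: acm_xi_phi.
  by rewrite derive_cst addrC.
rewrite /bracket (acm_xi_phi cx) derive0 subr0; move: E.
by move: ('D_(xi x) _ x) ('D_(xi x) _ x) => a b ->; rewrite scaler0.
Qed.

Let etaE v : pairing (eta x) v = inner (g x) v (xi x). Proof. exact: pairing_eta. Qed.

Lemma eta_derive_xi w : pairing (eta x) ('D_w xi x) = - inner (g x) (nabla g (xi x) (cst w) x) (xi x).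
Proof.
have := acp_T_xi H w; rewrite nabla_cst etaE /nabla_xi /nabla (christoffel_sym mg).
by rewrite innerDl => /eqP; rewrite addr_eq0 => /eqP.
Qed.

Lemma d_eta_fields_xi w : d_eta_fields c xi (cst w) x = 2^-1 * inner (g x) w (T (xi x)).
Proof.
rewrite /d_eta_fields bracket_cst_r pairingN opprK eta_derive_xi.
have -> : 'D_(cst w x) (fun y => pairing (eta y) (xi y)) x = 'D_w (fun=> 1 : R) x.
  by apply: near_eq_derive; apply: (near_chart cx) => y cy; exact: acm_eta_xi.
rewrite derive_cst subr0; congr (_ * _).
have := derive_eta cx (xi x) w; rewrite /cst => ->.
by rewrite addrC addKr.
Qed.

(** Evaluate normality on [xi] and a constant field [w]: the bracket of the [phi]-images is zero and
    the other brackets lie in the image of [phi], so the [xi]-component says that d eta(xi, w), half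
    of [<w, T xi>], is zero. *)
Lemma normal_T_xi : normal_at c x -> T (xi x) = 0.
Proof.
move=> N; apply: (T_eq0 H) => w.
have B : bracket (fun y => xi y *m phi y) (fun y => cst w y *m phi y) x = 0.
  rewrite /bracket (acm_xi_phi cx) derive0 sub0r.
  have -> : 'D_(cst w x *m phi x) (fun y => xi y *m phi y) x = 'D_(w *m phi x) (fun=> 0 : V) x.
    by apply: near_eq_derive; apply: (near_chart cx) => y; exact: acm_xi_phi.
  by rewrite derive_cst oppr0.
have := N xi (cst w) dxi (differentiable_cst w x); rewrite /nijenhuis B.
move=> /(acm_xi_component H); rewrite d_eta_fields_xi.
by rewrite (innerC w _ (local_metric_sym mg)) => ?; lra.
Qed.

Lemma nabla_phi_contact_type a : A (xi x) (xi x) = 0 ->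
  (forall v, inner (g x) v (xi x) = 0 -> inner (g x) (A v v) (xi x) = a * inner (g x) v v) ->
  contact_type (g x) (phi x) (xi x) T a.
Proof. exact: (contact_type_A H). Qed.

Lemma contact_type_P_tensor : P_tensor c x (xi x) (xi x) = 0 ->
  (forall v, inner (g x) v (xi x) = 0 ->
     P_tensor c x v v = (2 * inner (g x) v v) *: xi x) ->
  contact_type (g x) (phi x) (xi x) T 1.
Proof.
rewrite {1}/P_tensor (acp_xi_phi H) (acp_A0l H) addr0 => A0 E.
apply: (contact_type_P H) => // v v0.
by rewrite [P_point _ _ _ _](E v v0) innerZl (acp_xi H); ring.
Qed.

Lemma contact_type_Q_tensor a : Q_tensor c x (xi x) (xi x) = 0 ->
  (forall v, inner (g x) v (xi x) = 0 ->
     Q_tensor c x v v = (2 * a * inner (g x) v v) *: xi x) ->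
  contact_type (g x) (phi x) (xi x) T a.
Proof.
have Q v : Q_tensor c x v v = 2 *: A v v by rewrite scaler_nat.
rewrite Q => /eqP; rewrite scaler_eq0 pnatr_eq0 => /eqP A0 E.
apply: (contact_type_A H) => // v v0.
have := congr1 (inner (g x) ^~ (xi x)) (E v v0); rewrite Q !innerZl (acp_xi H); lra.
Qed.

End Classes.

Section ClassTypes.
Context {R : realType} {m : nat} {M : almost_contact_metric R m}.
Local Notation V := 'rV[R]_((m.*2).+1).

Definition chart_contact_type (c : chart M) (x : V) (rho : R) : Prop :=
  contact_type (metric c x) (acm_phi c x) (acm_xi c x) (nabla_xi c x) rho.
Definition chart_kenmotsu_type (c : chart M) (x : V) (beta : R) : Prop :=
  kenmotsu_type (metric c x) (acm_phi c x) (acm_xi c x) (nabla_xi c x) (nabla_phi c x) beta.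
Definition chart_restricted_type (c : chart M) (x : V) : Prop :=
  restricted_type (metric c x) (acm_phi c x) (acm_xi c x) (nabla_xi c x) (nabla_phi c x).

Lemma alpha_contact_type a (c : chart M) x : alpha_contact_metric M a ->
  chart_img c x -> a != 0 /\ chart_contact_type c x a.
Proof.
move=> [a0 Ma] cx; split=> //; apply: (contact_type_d_eta (acm_acm_point cx)) => v w.
by rewrite -(d_etaE cx) Ma.
Qed.

(** The constant is alpha for the classes that carry an alpha, 1 for the quasi-contact,
    quasi-K-Sasakian and strongly pseudoconvex ones, and the value at the point of the first
    function for the (nearly) trans-Sasakian ones. The terms in the second function drop out because
    [v] is orthogonal to [xi] and to [v *m phi], and [xi *m phi = 0]. *)
Lemma class_contact_type (c : chart M) x :
  class_A1 M \/ class_A2 M \/ class_A3 M \/ class_A5 M \/ class_A6 M ->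
  chart_img c x -> exists2 rho, rho != 0 & chart_contact_type c x rho.
Proof.
move=> HM cx; have H := acm_acm_point cx.
have etaE v : pairing (acm_eta c x) v = inner (metric c x) v (acm_xi c x) by exact: pairing_eta.
have TN0 : nabla_xi c x (acm_xi c x *m acm_phi c x) = 0 by rewrite (acp_xi_phi H) (acp_T0 H).
case: HM => [[[a Ma]|[Ma|[Ma|[Ma|[a [Ma _]]]]]]|[[rho [th [[_ r0] _ Ma]]]|[[rho [th [[_ r0] _ _ Ma]]]|[[a [a0 Ma]]|[a [a0 Ma]]]]]].
- by have [] := alpha_contact_type Ma cx; exists a.
- exists 1; [exact: oner_neq0|apply: (contact_type_P_tensor cx) => [|v v0]].
    rewrite (Ma c x cx) h_tensor_xi // etaE (acp_xi H) addr0 !scale1r mulr1 -mulr2n.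
    by rewrite scaler_nat subrr.
  by rewrite (Ma c x cx) etaE v0 !scale0r subr0.
- exists 1; [exact: oner_neq0|apply: (contact_type_P_tensor cx) => [|v v0]].
    by rewrite (Ma c x cx) TN0 etaE (acp_xi H) !mulr1 subrr scaler0 addr0.
  by rewrite (Ma c x cx) etaE v0 mulr0 !scale0r subr0 addr0.
- exists 1; [exact: oner_neq0|apply: (contact_type_d_eta H) => v w].
  by rewrite -(d_etaE cx) (Ma c x cx v w).1 mul1r.
- by have [] := alpha_contact_type Ma cx; exists a.
- exists (rho (param c x)); [exact: r0|apply: (contact_type_Q_tensor cx) => [|v v0]].
    rewrite (Ma c x cx) etaE (acp_xi H) !mulr1 !scale1r (acp_xi_phi H) !addr0 scaler0 subr0.
    by rewrite -addrA -opprD -mulr2n scaler_nat subrr scaler0.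
  by rewrite (Ma c x cx) etaE v0 !scale0r !subr0 addr0 scaler0 subr0 scalerA mulrCA mulrA.
- have [Mx _ _] := Ma c x cx.
  exists (rho (param c x)); [exact: r0|apply: (nabla_phi_contact_type cx) => [|v v0]].
    by rewrite Mx etaE (acp_xi H) !scale1r (acp_xi_phi H) inner0l scale0r !subrr !scaler0 addr0.
  rewrite Mx etaE v0 !scale0r !subr0 innerDl !innerZl (acp_xi H).
  by rewrite (innerC _ v (acp_sym H)) (acp_phi_self H); ring.
- exists a; [exact: a0|apply: (contact_type_nearly H) => v w].
  by rewrite (Ma c x cx) !(d_etaE cx).
- exists a; [exact: a0|apply: (contact_type_Q_tensor cx) => [|v v0]].
    by rewrite (Ma c x cx) etaE (acp_xi H) !mulr1 !scale1r -addrA -opprD -mulr2n scaler_nat subrr scaler0.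
  by rewrite (Ma c x cx) etaE v0 !scale0r !subr0 scalerA mulrCA mulrA.
Qed.

Lemma eta_closed_T_xi (c : chart M) x : eta_closed M -> chart_img c x ->
  nabla_xi c x (acm_xi c x) = 0.
Proof.
by move=> Me cx; apply: (d_eta_T_xi (acm_acm_point cx)) => w; rewrite -(d_etaE cx) Me.
Qed.

Lemma Omega_closed_kenmotsu_type (c : chart M) x : Omega_closed M -> chart_img c x ->
  nabla_xi c x (acm_xi c x) = 0 -> chart_kenmotsu_type c x 0.
Proof.
move=> MO cx T0; apply: (kenmotsu_type_d_Omega (acm_acm_point cx)) => // u v w.
by rewrite -(d_OmegaE cx) MO // mulr0 mul0r.
Qed.

Lemma class_restricted_type (c : chart M) x : class_B1_restricted M ->
  chart_img c x -> chart_restricted_type c x.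
Proof.
move=> HM cx; have H := acm_acm_point cx.
have closed : eta_closed M -> Omega_closed M -> chart_restricted_type c x.
  move=> Me MO; apply: (restricted_type_almost H) => *; last by rewrite -(d_OmegaE cx) MO.
  by rewrite -(d_etaE cx) Me.
case: HM => [[Me MO _]|[Me MO]|Mn|Mq]; [exact: closed|exact: closed| |].
- by apply: (restricted_type_nearlyK H) => v; have [] := Mn c x cx v.
- by apply: (restricted_type_quasiK H) => v w; rewrite -(pairing_eta _ cx); exact: Mq.
Qed.

Lemma class_kenmotsu_type (c : chart M) x : class_A4 M \/ class_B1 M ->
  chart_img c x -> chart_kenmotsu_type c x 0.
Proof.
move=> HM cx; have H := acm_acm_point cx.
case: HM => [[Mn MO _]|[[[Me MO _]|[Me MO]|Mn|Mq]|Mn]].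
- by apply: Omega_closed_kenmotsu_type => //; apply: normal_T_xi => //; exact: Mn.
- by apply: Omega_closed_kenmotsu_type => //; exact: eta_closed_T_xi.
- by apply: Omega_closed_kenmotsu_type => //; exact: eta_closed_T_xi.
- by apply: (kenmotsu_type_nearly H) => v; have [] := Mn c x cx v.
- by apply: (kenmotsu_type_quasiK H) => v w; rewrite -(pairing_eta _ cx); exact: Mq.
- by apply: (kenmotsu_type_nearly H) => v; exact: Mn.
Qed.

Lemma almost_beta_kenmotsu_type (beta : M -> R) (c : chart M) x : almost_beta_kenmotsu beta ->
  chart_img c x -> chart_kenmotsu_type c x (beta (param c x)).
Proof.
move=> [_ Me Mb] cx; have H := acm_acm_point cx.
apply: (kenmotsu_type_d_Omega H) => [|u v w]; first exact: eta_closed_T_xi.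
by rewrite -(d_OmegaE cx) (Mb c x cx).1 /eta_wedge_Omega !pairing_eta.
Qed.

End ClassTypes.

Lemma linear_combination (R : realType) (U W : lmodType R) (f : U -> W) n
    (c : 'I_n -> R) (z : 'I_n -> U) :
  linear f -> f (\sum_i c i *: z i) = \sum_i c i *: f (z i).
Proof.
move=> lf; have f0 : f 0 = 0.
  by have := lf (-1) 0 0; rewrite scaler0 addr0 scaleN1r addNr.
have fD x y : f (x + y) = f x + f y by have := lf 1 x y; rewrite !scale1r.
rewrite (big_morph f fD f0); apply: eq_bigr => i _.
by have := lf (c i) (z i) 0; rewrite !addr0 f0 addr0.
Qed.

(** * Adapted frames *)

Section OrthonormalBasis.
Context {R : realType} {d : nat} (I : finType) (g : 'M[R]_d) (u : I -> 'rV[R]_d).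
Hypotheses (cardI : #|I| = d) (sg : g^T = g) (pg : posdef g).
Hypothesis ou : forall i j, inner g (u i) (u j) = (i == j)%:R.

(** Indexing the basis by a finite type lets an adapted frame use ['I_m + 'I_m + 'I_1]. Renumbered
    by [h], it forms the rows of [E], and orthonormality becomes E g E^T = 1; this one-sided inverse
    is two-sided, which yields both the expansion and [invg]. *)
Let h (i : 'I_d) : I := enum_val (cast_ord (esym cardI) i).
Let h' (k : I) : 'I_d := cast_ord cardI (enum_rank k).
Let hK : cancel h h'. Proof. by move=> i; rewrite /h /h' enum_valK cast_ordKV. Qed.
Let h'K : cancel h' h. Proof. by move=> k; rewrite /h /h' cast_ordK enum_rankK. Qed.
Let E : 'M[R]_d := \matrix_(i < d) u (h i).

Let EgE : E *m (g *m E^T) = 1%:M.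
Proof.
apply/matrixP => i j; rewrite mulmxA !mxE -[in RHS](can_eq hK) -ou innerE mxE.
by apply: eq_bigr => k _; congr (_ * _); rewrite !mxE //; apply: eq_bigr => l _; rewrite !mxE.
Qed.

Let reindex_h (W : zmodType) (F : I -> W) : \sum_(i < d) F (h i) = \sum_k F k.
Proof. by rewrite [RHS](reindex h) //; exists h' => k _; [exact: hK|exact: h'K]. Qed.

Let row_E i : row i E = u (h i). Proof. by apply/rowP => j; rewrite !mxE. Qed.

Lemma orthonormal_expansion v : v = \sum_k inner g v (u k) *: u k.
Proof.
rewrite -[LHS]mulmx1 -(mulmx1C EgE) mulmxA mulmx_sum_row -reindex_h.
apply: eq_bigr => i _; rewrite row_E; congr (_ *: _).
rewrite innerE mulmxA !mxE; apply: eq_bigr => l _; by rewrite !mxE.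
Qed.

Let invg : invmx g = E^T *m E.
Proof.
have gU := posdef_unitmx pg.
have := mulmx1C EgE; rewrite -mulmxA => /(congr1 (mulmx (invmx g))).
by rewrite mulKmx // mulmx1.
Qed.

Lemma orthonormal_trace2 (W : lmodType R) (B : 'rV[R]_d -> 'rV[R]_d -> W) :
  (forall w, linear (B w)) -> (forall w, linear (B ^~ w)) ->
  \sum_i \sum_j invmx g i j *: B (basis_vec i) (basis_vec j) = \sum_k B (u k) (u k).
Proof.
move=> Br Bl.
rewrite -reindex_h invg.
under eq_bigr => i _ do under eq_bigr => j _ do rewrite mxE scaler_suml.
rewrite exchange_big /=; under eq_bigr => j _ do rewrite exchange_big /=.
rewrite exchange_big /=; apply: eq_bigr => k _.
rewrite -row_E [X in B X _](row_sum_delta (row k E)).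
rewrite (linear_combination _ _ (Bl _)) exchange_big /=.
apply: eq_bigr => i _; rewrite [X in B _ X](row_sum_delta (row k E)).
rewrite (linear_combination _ _ (Br _)) scaler_sumr.
by apply: eq_bigr => j _; rewrite !mxE scalerA.
Qed.

Lemma orthonormal_trace (T : 'rV[R]_d -> 'rV[R]_d) : linear T ->
  \tr (\matrix_i T (basis_vec i)) = \sum_k inner g (T (u k)) (u k).
Proof.
move=> lT; rewrite /mxtrace -reindex_h.
under eq_bigr => i _ do rewrite mxE (orthonormal_expansion (T _)) -reindex_h summxE.
rewrite exchange_big /=; apply: eq_bigr => k _.
rewrite -row_E [X in inner g (T X) _](row_sum_delta (row k E)).
rewrite (linear_combination _ _ lT) inner_suml.
by apply: eq_bigr => i _; rewrite innerZl !mxE mulrC.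
Qed.

End OrthonormalBasis.

(** Convertible with [adapted_frame] at the values of the structure, so results on frames pass
    between a point and a manifold without translation. *)
Definition frame_at {R : realType} {d m : nat} (g phi : 'M[R]_d) (xi : 'rV[R]_d)
    (e : 'I_m -> 'rV[R]_d) : Prop :=
  (forall i j, [/\ inner g (e i) (e j) = (i == j)%:R,
                   inner g (e i *m phi) (e j *m phi) = (i == j)%:R
                 & inner g (e i) (e j *m phi) = 0]) /\
  (forall i, [/\ inner g (e i) xi = 0, inner g (e i *m phi) xi = 0 & inner g xi xi = 1]).

Section Frames.
Context {R : realType} {m : nat}.
Local Notation d := (m.*2).+1.
Context {g phi : 'M[R]_d} {xi : 'rV[R]_d}
  {T : 'rV[R]_d -> 'rV[R]_d} {A : 'rV[R]_d -> 'rV[R]_d -> 'rV[R]_d}.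
Hypothesis H : acm_point g phi xi T A.

(** Dimension count: g W^T has fewer columns than rows, so its left kernel contains a nonzero
    vector, which is then normalised. *)
Let orth_vec (n : nat) (W : 'M[R]_(n, d)) : (n < d)%N ->
  exists v, inner g v v = 1 /\ forall i, inner g v (row i W) = 0.
Proof.
move=> nd; have : kermx (g *m W^T) != 0.
  rewrite kermx_eq0 /row_free neq_ltn (leq_ltn_trans _ nd) //.
  exact: rank_leq_col.
move=> /rowV0Pn[v /sub_kermxP v0 vn0].
have vv := acp_pos H vn0.
exists ((Num.sqrt (inner g v v))^-1 *: v); split=> [|i].
  rewrite innerZl innerZr mulrA -expr2 exprVn sqr_sqrtr ?mulVf ?gt_eqF //.
  exact: ltW.
rewrite innerZl; have -> : inner g v (row i W) = 0; last by rewrite mulr0.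
have := congr1 (fun N : 'rV[R]_n => N 0 i) v0; rewrite mulmxA mxE [RHS]mxE => E0.
by rewrite innerE mxE -[RHS]E0; apply: eq_bigr => j _; rewrite !mxE.
Qed.

(** Gram-Schmidt by pairs (e_i, phi e_i). The vectors are indexed by [nat], so that one step of the
    induction merely redefines the value at k. *)
Lemma exists_frame : exists e : 'I_m -> 'rV[R]_d, frame_at g phi xi e.
Proof.
suff [e He] : exists e : nat -> 'rV[R]_d, forall i j, (i < m)%N -> (j < m)%N ->
    [/\ inner g (e i) (e j) = (i == j)%:R, inner g (e i) (e j *m phi) = 0
      & inner g (e i) xi = 0].
  exists (fun i => e i); split=> [i j|i].
    have [E1 E2 E3] := He i j (ltn_ord i) (ltn_ord j).
    by rewrite (acp_compat H) E1 E2 E3 mul0r subr0.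
  have [_ _ E3] := He i i (ltn_ord i) (ltn_ord i).
  by rewrite (acp_phi_xi H) (acp_xi H) E3.
suff F k : (k <= m)%N -> exists e : nat -> 'rV[R]_d, forall i j, (i < k)%N -> (j < k)%N ->
    [/\ inner g (e i) (e j) = (i == j)%:R, inner g (e i) (e j *m phi) = 0
      & inner g (e i) xi = 0] by exact: F.
elim: k => [_|k IH km]; first by exists (fun=> 0) => i j.
have [e He] := IH (ltnW km).
(* There are 2k + 1 constraints in dimension 2m + 1, and k < m. The rows [e i *m phi] ensure that
   [v *m phi] is orthogonal to the old vectors, [phi] being skew; that [v] is orthogonal to
   [v *m phi] is automatic. *)
pose W : 'M[R]_(k + k + 1, d) :=
  col_mx (col_mx (\matrix_(i < k) e i) (\matrix_(i < k) (e i *m phi))) xi.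
have [v [v1 vW]] : exists v, inner g v v = 1 /\ forall i, inner g v (row i W) = 0.
  by apply: orth_vec; rewrite addn1 addnn ltnS ltn_double.
have v_e i : (i < k)%N -> inner g v (e i) = 0.
  by move=> ik; have := vW (lshift 1 (lshift k (Ordinal ik))); rewrite !rowKu rowK.
have v_ephi i : (i < k)%N -> inner g v (e i *m phi) = 0.
  by move=> ik; have := vW (lshift 1 (rshift k (Ordinal ik))); rewrite rowKu rowKd rowK.
have v_xi : inner g v xi = 0 by have := vW (rshift (k + k) ord0); rewrite rowKd row_id.
have gC x y : inner g x y = inner g y x by exact: innerC (acp_sym H).
exists (fun i => if i == k then v else e i) => i j; rewrite (ltnS i k) (ltnS j k) (leq_eqVlt i) (leq_eqVlt j).
case: (eqVneq i k) => [->|ik] /=; case: (eqVneq j k) => [->|jk] //= ki kj.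
- by rewrite ?eqxx v1 v_xi (acp_phi_self H).
- by rewrite v_e // v_ephi // eq_sym (negPf jk) v_xi.
- have [_ _ ->] := He i i ki ki.
  by rewrite gC v_e // (negPf ik) gC (acp_phi_skew H) v_ephi ?oppr0.
- exact: He.
Qed.

Section Expansion.
Variable e : 'I_m -> 'rV[R]_d.
Hypothesis He : frame_at g phi xi e.

Let I : finType := ('I_m + 'I_m + 'I_1)%type.
Let u (i : I) : 'rV[R]_d :=
  match i with inl (inl i) => e i | inl (inr i) => e i *m phi | inr _ => xi end.
Let cardI : #|I| = d. Proof. by rewrite !card_sum !card_ord addnn addn1. Qed.
Let gC x y : inner g x y = inner g y x. Proof. exact: innerC (acp_sym H). Qed.

Let ou i j : inner g (u i) (u j) = (i == j)%:R.
Proof.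
case: He => ee ex; case: i => [[i|i]|i]; case: j => [[j|j]|j] /=.
- by have [-> _ _] := ee i j.
- by have [_ _ ->] := ee i j.
- by have [-> _ _] := ex i.
- by rewrite gC; have [_ _ ->] := ee j i.
- by have [_ -> _] := ee i j.
- by have [_ -> _] := ex i.
- by rewrite gC; have [-> _ _] := ex j.
- by rewrite gC; have [_ -> _] := ex j.
- by rewrite (acp_xi H) !ord1.
Qed.

Let sumI (W : zmodType) (F : I -> W) :
  \sum_k F k = \sum_i (F (inl (inl i)) + F (inl (inr i))) + F (inr ord0).
Proof. by rewrite !big_sumType /= big_ord1 big_split. Qed.

Lemma frame_expansion v : v =
  \sum_i (inner g v (e i) *: e i + inner g v (e i *m phi) *: (e i *m phi)) + inner g v xi *: xi.
Proof. by rewrite [LHS](orthonormal_expansion cardI ou) sumI. Qed.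

Lemma frame_trace2 (W : lmodType R) (B : 'rV[R]_d -> 'rV[R]_d -> W) :
  (forall w, linear (B w)) -> (forall w, linear (B ^~ w)) ->
  \sum_i \sum_j invmx g i j *: B (basis_vec i) (basis_vec j) =
  \sum_i (B (e i) (e i) + B (e i *m phi) (e i *m phi)) + B xi xi.
Proof.
by move=> Br Bl; rewrite (orthonormal_trace2 cardI (acp_pos H) ou Br Bl) sumI.
Qed.

Lemma frame_trace (F : 'rV[R]_d -> 'rV[R]_d) : linear F ->
  \tr (\matrix_i F (basis_vec i)) =
  \sum_i (inner g (F (e i)) (e i) + inner g (F (e i *m phi)) (e i *m phi)) + inner g (F xi) xi.
Proof. by move=> lF; rewrite (orthonormal_trace cardI ou lF) sumI. Qed.

End Expansion.
End Frames.

(** * Holomorphic maps at a point *)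

(* The values at a point of a holomorphic map: [F] is the differential, [B] the second
   fundamental form; [map_B] is the derivative of [F phi = s psi F]. *)
Record holomorphic_point (R : realType) (d e : nat) (phi : 'M[R]_d)
    (A : 'rV[R]_d -> 'rV[R]_d -> 'rV[R]_d) (psi : 'M[R]_e)
    (AN : 'rV[R]_e -> 'rV[R]_e -> 'rV[R]_e) (F : 'M[R]_(d, e))
    (B : 'rV[R]_d -> 'rV[R]_d -> 'rV[R]_e) (s : R) : Prop := HolomorphicPoint {
  hol_sq : s * s = 1;
  hol_F : forall v : 'rV[R]_d, v *m phi *m F = s *: (v *m F *m psi);
  hol_sym : forall v w, B v w = B w v;
  hol_linear : forall w, linear (B w);
  hol_B : forall v w, B v (w *m phi) + A v w *m F = s *: (AN (v *m F) (w *m F) + B v w *m psi);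
  hol_ANZ : forall k v w, AN (k *: v) w = k *: AN v w
}.

Section HolomorphicPoint.
Context {R : realType} {m e : nat}.
Local Notation d := (m.*2).+1.
Context {g phi : 'M[R]_d} {xi : 'rV[R]_d}
  {T : 'rV[R]_d -> 'rV[R]_d} {A : 'rV[R]_d -> 'rV[R]_d -> 'rV[R]_d}
  {psi : 'M[R]_e} {AN : 'rV[R]_e -> 'rV[R]_e -> 'rV[R]_e}
  {F : 'M[R]_(d, e)} {B : 'rV[R]_d -> 'rV[R]_d -> 'rV[R]_e} {s : R}.
Hypotheses (H : acm_point g phi xi T A) (K : holomorphic_point phi A psi AN F B s).
Local Notation "<< v , w >>" := (inner g v w).
Local Notation S := (S_point phi A).
Local Notation SN := (S_point psi AN).
Local Notation P := (P_point phi A).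

Lemma hol_s_neq0 : s != 0.
Proof.
by apply/eqP => s0; have := hol_sq K; rewrite s0 mul0r => /esym/eqP; rewrite oner_eq0.
Qed.

Lemma hol_BDr u v w : B u (v + w) = B u v + B u w.
Proof. by have := hol_linear K u 1 v w; rewrite !scale1r. Qed.

Lemma hol_B0r u : B u 0 = 0.
Proof. by have := hol_linear K u (-1) 0 0; rewrite scaler0 addr0 scaleN1r addNr. Qed.

Lemma hol_BZr u k v : B u (k *: v) = k *: B u v.
Proof. by have := hol_linear K u k v 0; rewrite !addr0 hol_B0r addr0. Qed.

Lemma hol_BDl u v w : B (v + w) u = B v u + B w u.
Proof. by rewrite !(hol_sym K _ u) hol_BDr. Qed.

Lemma hol_BZl u k v : B (k *: v) u = k *: B v u.
Proof. by rewrite !(hol_sym K _ u) hol_BZr. Qed.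

(** [hol_B] in the direction phi v leaves B(phi v, v); the symmetry of [B] turns it into B(v, phi
    v), to which [hol_B] applies again. The two signs cancel through s^2 = 1. *)
Lemma hol_B_phi_phi v :
  B (v *m phi) (v *m phi) = - (S v *m F) + SN (v *m F) + B v v *m psi *m psi.
Proof.
have E1 := hol_B K (v *m phi) v.
rewrite (hol_F K) (hol_ANZ K) scalerDr scalerA (hol_sq K) scale1r in E1.
have E2 : s *: (B (v *m phi) v *m psi) =
    AN (v *m F) (v *m F) *m psi + B v v *m psi *m psi - A v v *m phi *m F.
  rewrite (hol_sym K) -[B v _](addrK (A v v *m F)) (hol_B K) mulmxBl scalerBr (hol_F K).
  by rewrite -scalemxAl scalerA (hol_sq K) scale1r mulmxDl.
move: E1; rewrite E2 /S_point mulmxDl.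
move: (B _ _) (AN _ _) (AN _ _ *m _) (B _ _ *m _ *m _) (A _ _ *m _) (A _ _ *m _ *m _).
move=> b a p q r t /(congr1 (fun z => z - r)); rewrite addrK => ->.
by apply/rowP => i; rewrite !mxE; ring.
Qed.

Section Tension.
Variable (fr : 'I_m -> 'rV[R]_d).
Hypothesis Hfr : frame_at g phi xi fr.

Definition tension_point : 'rV[R]_e :=
  \sum_i (B (fr i) (fr i) + B (fr i *m phi) (fr i *m phi)) + B xi xi.

Hypothesis coclosed_Omega : \sum_i P (fr i) (fr i) = T xi *m phi.

Lemma frame_D i : <<fr i, xi>> = 0.
Proof. by have [_ /(_ i) []] := Hfr. Qed.

(** A [z] that kills [F xi] removes the [xi]-part of [S_pointE]. It is used with [z = psi] for
    contact targets and with the identity for Hermitian ones, where [F xi = 0]. *)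
Lemma sum_S_point (z : 'M[R]_e) : xi *m F *m z = 0 ->
  \sum_i S (fr i) *m F *m z = - (T xi *m F *m z).
Proof.
move=> xz; have -> : \sum_i S (fr i) *m F *m z = \sum_i P (fr i) (fr i) *m phi *m F *m z.
  apply: eq_bigr => i _; rewrite (S_pointE H (frame_D i)) !mulmxBl -!scalemxAl xz.
  by rewrite scaler0 subr0.
by rewrite -!mulmx_suml coclosed_Omega (T_phi2 H) !mulNmx.
Qed.

(** As [psi] squares to - 1, B(e_i, e_i) cancels within each pair; the sum of the [S] terms leaves
    F(T xi), which is cancelled by B(xi, xi). *)
Lemma tension_point_hermitian : xi *m F = 0 -> (forall u, SN u = 0) ->
  (forall u : 'rV[R]_e, u *m psi *m psi = - u) -> B xi xi = - (T xi *m F) -> tension_point = 0.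
Proof.
move=> xF SN0 psi2 Bxx.
rewrite /tension_point Bxx; under eq_bigr do rewrite hol_B_phi_phi SN0 addr0 psi2 addrCA subrr addr0.
rewrite sumrN -[X in - X]mulmx1 mulmx_suml sum_S_point ?mulmx1 ?opprK ?subrr //.
Qed.

End Tension.

(** The point is that F T = 0. Indeed B(xi, .) = - F T, so [hol_B] at [xi] with [A xi = 0] makes F T
    intertwine [phi] with s psi, whereas [T] anticommutes with [phi]. Then [xi] lies in the kernel
    of [B], and only the part of [v] orthogonal to [xi] counts. *)
Lemma pluriharmonic_of_restricted : restricted_type g phi xi T A ->
  xi *m F = 0 -> (forall v, B v xi = - (T v *m F)) ->
  (forall v, <<v, xi>> = 0 -> v *m F *m psi = 0 -> v *m F = 0) ->
  (forall v, <<v, xi>> = 0 -> SN (v *m F) + (B v v + B v v *m psi *m psi) = 0) ->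
  forall v, B v v + B (v *m phi) (v *m phi) = 0.
Proof.
move=> [T0 Ax Tphi S0] xF Bxi inj HSN v.
have AN0 w : AN 0 w = 0 by have := hol_ANZ K 0 0 w; rewrite !scale0r.
have TF w : T w *m F = 0.
  have TFphi : T w *m phi *m F = 0.
    have := hol_B K xi w; rewrite Ax mul0mx addr0 xF AN0 add0r !(hol_sym K xi) !Bxi Tphi.
    rewrite !mulNmx opprK scalerN -(hol_F K) => /eqP.
    by rewrite -addr_eq0 -mulr2n -scaler_nat scaler_eq0 pnatr_eq0 => /eqP.
  apply: inj; first exact: (acp_T_xi H).
  move: TFphi; rewrite (hol_F K) => /eqP.
  by rewrite scaler_eq0 (negPf hol_s_neq0) => /eqP.
have Bxi0 w : B w xi = 0 by rewrite Bxi TF oppr0.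
pose w := v - <<v, xi>> *: xi.
have w0 : <<w, xi>> = 0 by rewrite innerBl innerZl (acp_xi H) mulr1 subrr.
have vE : v = w + <<v, xi>> *: xi by rewrite subrK.
have -> : v *m phi = w *m phi.
  by rewrite mulmxBl -scalemxAl (acp_xi_phi H) scaler0 subr0.
have -> : B v v = B w w.
  by rewrite vE hol_BDr hol_BZr Bxi0 scaler0 addr0 hol_BDl hol_BZl (hol_sym K) Bxi0 scaler0 addr0.
have SwF : S w *m F = 0.
  by rewrite (acp_ker_phi H (S0 w w0)) -scalemxAl xF scaler0.
by rewrite hol_B_phi_phi SwF oppr0 add0r addrCA -[RHS](HSN w w0) addrCA addrA addrAC addrC addrA.
Qed.

Section ContactTarget.
Context {h : 'M[R]_e} {gam : 'rV[R]_e} {TN : 'rV[R]_e -> 'rV[R]_e} {l : R} {dl : 'rV[R]_d -> R}.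
Hypothesis HN : acm_point h psi gam TN AN.
Hypothesis xiF : xi *m F = l *: gam.
Hypothesis etaF : forall v, inner h (v *m F) gam = l * <<v, xi>>.
Hypothesis B_eta : forall v w,
  inner h (B v w) gam = dl v * <<w, xi>> + l * <<T v, w>> - inner h (TN (v *m F)) (w *m F).
Hypothesis B_xi : forall v, B v xi = dl v *: gam + l *: TN (v *m F) - T v *m F.

Lemma etaF_D v : <<v, xi>> = 0 -> inner h (v *m F) gam = 0.
Proof. by move=> v0; rewrite etaF v0 mulr0. Qed.

Section ContactTension.
Variable (fr : 'I_m -> 'rV[R]_d).
Hypothesis Hfr : frame_at g phi xi fr.
Hypothesis coclosed_Omega : \sum_i P (fr i) (fr i) = T xi *m phi.
Hypothesis coclosed_eta : \sum_i (<<T (fr i), fr i>> + <<T (fr i *m phi), fr i *m phi>>) = 0.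
Local Notation tau := (tension_point fr).
Local Notation E i := (fr i *m F).

Lemma sum_d_eta_target :
  \sum_i (inner h (TN (E i)) (E i *m psi) - inner h (TN (E i *m psi)) (E i)) = 0.
Proof.
(* The factor [s] matches the single sign that F(phi e_i) = s psi E_i brings into each of the two
   expressions for B(e_i, phi e_i). *)
apply: (mulfI hol_s_neq0); rewrite mulr0 mulr_sumr.
have -> : \sum_i s * (inner h (TN (E i)) (E i *m psi) - inner h (TN (E i *m psi)) (E i)) =
    \sum_i - l * <<P (fr i) (fr i), xi>>.
  apply: eq_bigr => i _; have i0 := frame_D Hfr i; rewrite (P_point_eta H i0).
  have := B_eta (fr i) (fr i *m phi); rewrite (hol_sym K) B_eta.
  rewrite (acp_phi_xi H) i0 !(hol_F K) (acp_TZ HN) innerZl innerZr; lra.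
by rewrite -mulr_sumr -inner_suml coclosed_Omega (acp_phi_xi H) mulr0.
Qed.

(** A vanishing sum of squares gives E_i = 0, hence also F(phi e_i) = s psi E_i = 0, and these
    vectors span the orthogonal of [xi]. *)
Lemma sum_norm_eq0_D : \sum_i inner h (E i) (E i) = 0 -> forall v, <<v, xi>> = 0 -> v *m F = 0.
Proof.
move=> E0; have Ei i : E i = 0.
  apply: (inner_eq0 (acp_pos HN)); move/eqP: E0; rewrite psumr_eq0.
    by move=> /allP /(_ i (mem_index_enum i)) /eqP.
  by move=> j _; exact: inner_ge0 (acp_pos HN).
move=> v v0; rewrite (frame_expansion H Hfr v) v0 scale0r addr0 mulmx_suml.
apply: big1 => i _; rewrite mulmxDl -!scalemxAl (hol_F K) Ei.
by rewrite mul0mx !scaler0 addr0.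
Qed.

Lemma contact_type_target rho : rho != 0 -> contact_type h psi gam TN rho ->
  forall v, <<v, xi>> = 0 -> v *m F = 0.
Proof.
move=> rho0 [_ Crho]; apply: sum_norm_eq0_D.
have := sum_d_eta_target.
under eq_bigr => i _ do rewrite (Crho _ (etaF_D (frame_D Hfr i))).
rewrite sumrN -mulr_sumr => /eqP; rewrite oppr_eq0 !mulf_eq0 pnatr_eq0 (negPf rho0).
by move=> /eqP.
Qed.

Lemma tension_eta : inner h tau gam =
  dl xi - \sum_i (inner h (TN (E i)) (E i) + inner h (TN (E i *m psi)) (E i *m psi)).
Proof.
rewrite /tension_point innerDl inner_suml B_eta (acp_xi H) mulr1 (acp_T_xi H) mulr0 addr0.
rewrite xiF innerZr (acp_T_xi HN) mulr0 subr0 addrC; congr (_ + _).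
(* The terms l [<<T v, v>>] coming from [B_eta] add up to l times the divergence of [xi]. *)
have C := congr1 ( *%R l) coclosed_eta; rewrite mulr0 mulr_sumr in C.
rewrite -[RHS]add0r -[X in X - _]C -sumrB.
apply: eq_bigr => i _; rewrite innerDl !B_eta (acp_phi_xi H) (frame_D Hfr i) !(hol_F K).
rewrite (acp_TZ HN) innerZl innerZr mulrA (hol_sq K); ring.
Qed.

(** The relation psi^3 = - psi cancels the B(e_i, e_i) within each pair, and the F(T xi) left by the
    sum of the [S] terms cancels the one in B(xi, xi). *)
Lemma tension_psi : tau *m psi =
  \sum_i SN (E i) *m psi + (l ^+ 2) *: (TN gam *m psi).
Proof.
rewrite /tension_point mulmxDl mulmx_suml B_xi xiF (acp_TZ HN) mulmxBl mulmxDl.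
rewrite -!scalemxAl (acp_xi_phi HN) scaler0 add0r scalerA -expr2.
have -> : \sum_i (B (fr i) (fr i) + B (fr i *m phi) (fr i *m phi)) *m psi =
    \sum_i (SN (E i) *m psi - S (fr i) *m F *m psi).
  apply: eq_bigr => i _; rewrite hol_B_phi_phi.
  move: (B _ _) (SN _) (S _ *m F) => b p q; rewrite !mulmxDl (acp_phi3 HN) mulNmx.
  move: (b *m psi) (p *m psi) (q *m psi) => b' p' q'.
  by apply/rowP => j; rewrite !mxE; ring.
rewrite big_split /= sumrN sum_S_point //; last first.
  by rewrite xiF -scalemxAl (acp_xi_phi HN) scaler0.
by rewrite opprK -addrA; congr (_ + _); rewrite addrC subrK.
Qed.

(** The kernel of [psi] is the line of [gam]. *)
Lemma tension_eq0_iff : tau *m psi = 0 -> (tau = 0 <-> inner h tau gam = 0).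
Proof.
by move=> /(acp_ker_phi HN) tE; split=> [->|t0]; [rewrite inner0l|rewrite tE t0 scale0r].
Qed.

Lemma tension_kenmotsu_type beta : kenmotsu_type h psi gam TN AN beta ->
  (tau = 0 <-> dl xi - 2 * beta * \sum_i inner h (E i) (E i) = 0).
Proof.
move=> [T0 KN]; rewrite tension_eq0_iff; last first.
  rewrite tension_psi T0 mul0mx scaler0 addr0; apply: big1 => i _.
  by have [] := KN _ (etaF_D (frame_D Hfr i)).
rewrite tension_eta mulr_sumr (eq_bigr (fun i => 2 * beta * inner h (E i) (E i))) // => i _.
by have [] := KN _ (etaF_D (frame_D Hfr i)).
Qed.

Lemma tension_contact_type rho : rho != 0 -> contact_type h psi gam TN rho ->
  (tau = 0 <-> dl xi = 0).
Proof.
move=> rho0 Crho; have E0 i : E i = 0 := contact_type_target rho0 Crho (frame_D Hfr i).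
have [T0 _] := Crho; have A00 : AN 0 0 = 0 by exact: (acp_A0r HN).
rewrite tension_eq0_iff; last first.
  rewrite tension_psi T0 mul0mx scaler0 addr0; apply: big1 => i _.
  by rewrite E0 /S_point mul0mx A00 mul0mx addr0 mul0mx.
rewrite tension_eta big1 ?subr0 // => i _.
by rewrite E0 mul0mx inner0r addr0.
Qed.

End ContactTension.

(** Only [gam]-components survive: with u = F v, those of [SN u] and of [B v v] are - h(TN(psi u),
    psi u) and - h(TN u, u), whose sum is zero for Kenmotsu type with constant 0. *)
Lemma pluriharmonic_contact_target : l = 0 -> (forall v, dl v = 0) ->
  restricted_type g phi xi T A -> kenmotsu_type h psi gam TN AN 0 ->
  forall v, B v v + B (v *m phi) (v *m phi) = 0.
Proof.
move=> l0 dl0 HR [_ KN].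
have vgam v : inner h (v *m F) gam = 0 by rewrite etaF l0 mul0r.
apply: pluriharmonic_of_restricted => // [|v|v _ /(acp_ker_phi HN) ->|v v0].
- by rewrite xiF l0 scale0r.
- by rewrite B_xi dl0 l0 !scale0r !add0r.
- by rewrite vgam scale0r.
have [SN0 sum0] := KN _ (vgam v).
rewrite (acp_phi2 HN (B v v)) [B v v + _]addrA subrr add0r (acp_ker_phi HN SN0) -scalerDl.
rewrite (S_point_eta HN) B_eta dl0 l0; move: sum0; rewrite mulr0 mul0r => sum0.
rewrite [X in X *: _](_ : _ = 0) ?scale0r //; lra.
Qed.

End ContactTarget.
End HolomorphicPoint.

(* Polarising the derivative of [f^* h = mu^2 g] gives [h (B u v, F w)]. *)
Section ConformalPoint.
Context {R : realType} {m e : nat}.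
Local Notation d := (m.*2).+1.
Context {g phi : 'M[R]_d} {xi : 'rV[R]_d}
  {T : 'rV[R]_d -> 'rV[R]_d} {A : 'rV[R]_d -> 'rV[R]_d -> 'rV[R]_d}
  {F : 'M[R]_(d, e)} {B : 'rV[R]_d -> 'rV[R]_d -> 'rV[R]_e} {h : 'M[R]_e}
  {l : R} {dl : 'rV[R]_d -> R}.
Hypotheses (H : acm_point g phi xi T A) (symB : forall v w, B v w = B w v) (symh : h^T = h).
Hypothesis lin_dl : linear (dl : 'rV[R]_d -> R^o).
Hypothesis conf : forall u v w,
  inner h (B u v) (w *m F) + inner h (v *m F) (B u w) = 2 * l * dl u * inner g v w.

Lemma conformal_B u v w : inner h (B u v) (w *m F) =
  l * (dl u * inner g v w + dl v * inner g u w - dl w * inner g u v).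
Proof.
have := conf u v w; have := conf v w u; have := conf w u v.
rewrite (symB w u) (symB w v) (symB v u) !(innerC (_ *m F) _ symh).
rewrite (innerC w u (acp_sym H)); lra.
Qed.

(** Each of the 2m + 1 unit vectors u of the frame contributes l (2 dl(u) g(u, w) - dl(w)); the
    first terms sum to 2 l dl(w), leaving the factor 2 - (2m + 1). *)
Lemma conformal_tension fr w : frame_at g phi xi fr ->
  inner h (tension_point (phi := phi) (xi := xi) (B := B) fr) (w *m F) = - ((2 * m%:R - 1) * l * dl w).
Proof.
move=> Hfr; have [ee ex] := Hfr.
rewrite /tension_point innerDl inner_suml conformal_B (acp_xi H).
have -> : \sum_i inner h (B (fr i) (fr i) + B (fr i *m phi) (fr i *m phi)) (w *m F) =
  \sum_i (2 * l * (dl (fr i) * inner g (fr i) w + dl (fr i *m phi) * inner g (fr i *m phi) w))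
  - \sum_(i < m) 2 * l * dl w.
  rewrite -sumrB; apply: eq_bigr => i _; rewrite innerDl !conformal_B.
  have [-> -> _] := ee i i; rewrite eqxx /=; ring.
rewrite sumr_const card_ord -mulr_sumr.
have dlD a k : dl (a + k) = dl a + dl k by have := lin_dl 1 a k; rewrite !scale1r.
have dl0 : dl 0 = 0 by have := lin_dl (-1) 0 0; rewrite scaler0 addr0 scaleN1r addNr.
have dlZ k a : dl (k *: a) = k * dl a by have := lin_dl k a 0; rewrite !addr0 dl0 addr0.
have -> : \sum_i (dl (fr i) * inner g (fr i) w + dl (fr i *m phi) * inner g (fr i *m phi) w) =
    dl w - dl xi * inner g xi w.
  rewrite [X in _ = dl X - _](frame_expansion H Hfr w) dlD (big_morph dl dlD dl0) dlZ.
  rewrite (innerC w xi (acp_sym H)) [inner g xi w * _]mulrC addrK; apply: eq_bigr => i _.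
  by rewrite dlD !dlZ !(innerC w _ (acp_sym H)) ![inner g _ w * _]mulrC.
rewrite -mulr_natl; ring.
Qed.

End ConformalPoint.

Lemma derivable_dir (R : realType) (V W : normedModType R) (f : V -> W) x v :
  differentiable f x -> derivable f x v.
Proof. exact: diff_derivable. Qed.
Arguments derivable_dir {R V W f x} v.

(** The differential of [f] also serves [k], since a first-order expansion sees only values near
    [x]. *)
Lemma near_eq_differentiable (R : realType) (V W : normedModType R) (f k : V -> W) x :
  (\forall y \near x, f y = k y) -> differentiable f x -> differentiable k x.
Proof.
move=> fk df; have cdf := diff_continuous df.
have E : k \o shift x = cst (k x) + 'd f x +o_ (0 : V) id.
  apply/eqaddoP => e e0; have := differentiable_expansion df e0.
  have fk0 : \forall u \near (0 : V), f (u + x) = k (u + x).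
    by move: fk; rewrite (near_shift 0); apply: filterS => u; rewrite /= subr0.
  apply: filterS2 fk0 => u Eu; rewrite deriveE // !fctE /= opprD addrA.
  by rewrite Eu (nbhs_singleton fk).
have Ek := diff_unique cdf E.
by apply/diff_locallyP; rewrite Ek.
Qed.

Lemma holomorphic_along_algebra (R : realType) d e (F : 'M[R]_(d, e)) p q s (z ap : 'rV[R]_d)
    (bp bw an : 'rV[R]_e) :
  s *: ((bw + z *m F) *m q + an) = bp + (z *m p + ap) *m F ->
  p *m F = s *: (F *m q) -> bp + ap *m F = s *: (an + bw *m q).
Proof.
move=> E Fp; move: E; rewrite !mulmxDl -!mulmxA Fp -scalemxAr !scalerDr.
move: (bw *m q) (z *m _) (ap *m F) => u r t E.
apply: (addrI (s *: r)); rewrite addrCA -E.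
by apply/rowP => i; rewrite !mxE; ring.
Qed.

(** * The second fundamental form of a map *)

Section SecondFundamentalForm.
Context {R : realType} {d e : nat} {M : riemannian R d} {N : riemannian R e}.
Context {f : M -> N} (sf : smooth_map f) (a : chart M) (b : chart N) (x : 'rV[R]_d).
Hypothesis lx : local_dom f a b x.
Local Notation lm := (local_map f a b).
Local Notation D := (diff_map f a b).
Local Notation g := (metric a).
Local Notation h := (metric b).
Local Notation B := (second_fundamental_form f a b x).
Implicit Types (v w : 'rV[R]_d) (X : 'rV[R]_d -> 'rV[R]_d).

Let mg : local_metric g x := metric_local (local_dom_src lx).
Let mh : local_metric h (lm x) := metric_local (local_dom_tgt lx).
Let dlm : differentiable lm x := local_map_differentiable sf lx.
Let near_dom := local_dom_nbhs sf lx.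

(** [smooth_on] speaks of partial derivatives; they are the rows of the Jacobian wherever the local
    map is differentiable, hence near [x]. *)
Lemma diff_map_differentiable : differentiable D x.
Proof.
apply: (@near_eq_differentiable _ _ _ (fun y => \matrix_(i, j) ('D_(basis_vec i) lm y) 0 j)).
  apply: filterS near_dom => y ly; apply/matrixP => i j.
  by rewrite mxE (derive_local_map sf _ ly) -rowE mxE.
apply: differentiable_mx => i j; under eq_fun do rewrite mxE.
apply: differentiable_entry; exact: (smooth_on_differentiable_derive i (sf.2 a b) lx).
Qed.

Let dD := diff_map_differentiable.

Lemma mul_diff_map_differentiable X : differentiable X x -> differentiable (fun y => X y *m D y) x.
Proof. by move=> dX; exact: differentiable_mulmx. Qed.

Let derive_mul_diff v w : 'D_v (fun y => w *m D y) x = w *m 'D_v D x.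
Proof. by rewrite (derive_mulmx (X := cst w)) // derive_cst mul0mx add0r. Qed.

Lemma second_fundamental_formE v w : B v w =
  w *m 'D_v D x + christoffel h (lm x) (v *m D x) (w *m D x) - christoffel g x v w *m D x.
Proof. by rewrite /second_fundamental_form /pullback_nabla derive_mul_diff. Qed.

(** Schwarz's theorem for the local map, and torsion-freeness of the two connections for the
    Christoffel terms. *)
Lemma second_fundamental_form_sym v w : B v w = B w v.
Proof.
have E : w *m 'D_v D x = v *m 'D_w D x.
  rewrite -(derive_mul_diff v w) -(derive_mul_diff w v).
  apply: (@derive_sym_mx _ _ _ _ lm (fun y => w *m D y) (fun y => v *m D y)).
  - apply: filterS near_dom => y ly; rewrite !(derive_local_map sf _ ly).
    by split => //; exact: (local_map_differentiable sf).
  - exact: (mul_diff_map_differentiable (X := cst w)).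
  - exact: (mul_diff_map_differentiable (X := cst v)).
rewrite !second_fundamental_formE E (christoffel_sym mg v w).
by rewrite (christoffel_sym mh (v *m D x) (w *m D x)).
Qed.

Lemma second_fundamental_form_linear v : linear (B v).
Proof.
move=> k u w; rewrite !second_fundamental_formE.
have CD := christoffelDr mh (v *m D x); have CZ := christoffelZr mh (v *m D x).
have GD := christoffelDr mg v; have GZ := christoffelZr mg v.
move: (christoffel h _ _) (christoffel g x v) ('D_v D x) CD CZ GD GZ => C G P CD CZ GD GZ.
rewrite !(mulmxDl, CD, GD) -!scalemxAl CZ GZ -!scalemxAl.
move: (C _) (C _) (_ *m P) (_ *m P) (G _ *m _) (G _ *m _) => c1 c2 p1 p2 q1 q2.
by apply/rowP => i; rewrite !mxE; ring.
Qed.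

(** Expresses [B] as the covariant derivative of the differential: for a field with varying
    components the correction is the image of its own derivative. *)
Lemma nabla_along_field v X : differentiable X x ->
  nabla_along h lm x v (fun y => X y *m D y) = B v (X x) + nabla g v X x *m D x.
Proof.
move=> dX; rewrite second_fundamental_formE /nabla_along derive_mulmx // (derive_local_map sf v lx).
rewrite /nabla mulmxDl; move: (christoffel _ _ _ _) (christoffel _ _ _ _ *m _).
move: ('D_v X x *m _) (_ *m 'D_v D x) => p q r t.
by apply/rowP => i; rewrite !mxE; ring.
Qed.

Lemma nabla_along_near v Z W : (\forall y \near x, Z y = W y) ->
  nabla_along h lm x v Z = nabla_along h lm x v W.
Proof. by move=> E; rewrite /nabla_along (near_eq_derive _ E) (nbhs_singleton E). Qed.

Lemma nabla_along_scale v (k : 'rV[R]_d -> R) Z : differentiable k x -> differentiable Z x ->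
  nabla_along h lm x v (fun y => k y *: Z y) = 'D_v k x *: Z x + k x *: nabla_along h lm x v Z.
Proof.
by move=> dk dZ; rewrite /nabla_along derive_scalemx // (christoffelZr mh) scalerDr addrA.
Qed.

Lemma nabla_along_cst0 v : nabla_along h lm x v (fun=> 0) = 0.
Proof. by rewrite /nabla_along derive_cst (christoffel0r mh) addr0. Qed.

Lemma nabla_along_comp v Y : differentiable Y (lm x) ->
  nabla_along h lm x v (Y \o lm) = nabla h (v *m D x) Y (lm x).
Proof.
by move=> dY; rewrite /nabla_along /nabla -(derive_local_map sf v lx) -(derive_along dlm).
Qed.

(** Both sides of F phi = s psi F, applied to a constant field, are differentiated along the map;
    the relation holds near [x], so the derivatives agree. *)
Lemma holomorphic_along phi psi s v w :
  differentiable phi x -> differentiable psi (lm x) ->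
  (forall y, local_dom f a b y -> phi y *m D y = s *: (D y *m psi (lm y))) ->
  B v (w *m phi x) + nabla_endo g phi x v w *m D x =
  s *: (nabla_endo h psi (lm x) (v *m D x) (w *m D x) + B v w *m psi (lm x)).
Proof.
move=> dphi dpsi hol.
have dw : differentiable (fun y => w *m D y) x by exact: (mul_diff_map_differentiable (X := cst w)).
have E1 := nabla_along_field v (differentiable_mulmx (differentiable_cst w x) dphi).
have E2 := nabla_mulmx g dphi v (differentiable_cst w x).
have E3 := nabla_along_scale v (differentiable_cst s x) (differentiable_mulmx dw (differentiable_comp dlm dpsi)).
have E4 := nabla_along_endo h dlm v dpsi dw.
have E5 := nabla_along_field v (differentiable_cst w x).
have near_hol : \forall y \near x,
    cst w y *m phi y *m D y = cst s y *: (w *m D y *m (psi \o lm) y).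
  by apply: filterS near_dom => y ly; rewrite -mulmxA hol // -scalemxAr mulmxA.
have E6 := nabla_along_near v near_hol.
rewrite (derive_local_map sf v lx) in E4.
rewrite derive_cst scale0r add0r in E3.
move: E1; rewrite E6 E3 [nabla_along _ _ _ _ _]E4 E2 [nabla_along _ _ _ _ _]E5.
by move/holomorphic_along_algebra; apply; exact: hol.
Qed.

End SecondFundamentalForm.

Lemma second_fundamental_form_eta_algebra (R : realType) d e (g : 'M[R]_d) (h : 'M[R]_e)
    (z w t xi : 'rV[R]_d) (bvw zF wF gam u : 'rV[R]_e) (l dl : R) :
  g^T = g -> h^T = h -> inner h zF gam = l * inner g z xi ->
  l * (inner g z xi + inner g w t) + inner g w xi * dl = inner h (bvw + zF) gam + inner h wF u ->
  inner h bvw gam = dl * inner g w xi + l * inner g t w - inner h u wF.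
Proof.
move=> sg sh Ez; rewrite innerDl Ez (innerC u wF sh) (innerC t w sg).
move: (inner _ _ _) (inner _ _ _) (inner _ _ _) (inner _ _ _) (inner _ _ _) => p q r t' u'.
by move=> E; lra.
Qed.

(** * Pointwise data of holomorphic maps and adapted frames on the source *)

Section HolomorphicMap.
Context {R : realType} {m e : nat} {M : almost_contact_metric R m} {N : riemannian R e}.
Context {f : M -> N} (sf : smooth_map f).
Variable psi : chart N -> 'rV[R]_e -> 'M[R]_e.
Hypothesis dpsi : forall b y, chart_img b y -> differentiable (psi b) y.
Variable s : R.
Hypothesis ss : s * s = 1.
Hypothesis hol : forall a b x, local_dom f a b x ->
  acm_phi a x *m diff_map f a b x = s *: (diff_map f a b x *m psi b (local_map f a b x)).
Variables (a : chart M) (b : chart N) (x : 'rV[R]_((m.*2).+1)).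
Hypothesis lx : local_dom f a b x.

Lemma holomorphic_pointP : holomorphic_point (acm_phi a x) (nabla_phi a x)
  (psi b (local_map f a b x)) (nabla_endo (metric b) (psi b) (local_map f a b x))
  (diff_map f a b x) (second_fundamental_form f a b x) s.
Proof.
have ax := local_dom_src lx; have bx := local_dom_tgt lx.
have mh := metric_local bx.
split; first exact: ss.
- by move=> v; rewrite -mulmxA (hol lx) -scalemxAr mulmxA.
- exact: second_fundamental_form_sym.
- exact: second_fundamental_form_linear.
- move=> v w; apply: (holomorphic_along sf lx) => [||y]; [exact: acm_phi_differentiable|exact: dpsi|exact: hol].
- by move=> k v w; apply: nabla_endoZl => //; exact: dpsi.
Qed.

Lemma frame_atP : exists fr : 'I_m -> _, adapted_frame a x fr.
Proof. exact: (exists_frame (acm_acm_point (local_dom_src lx))). Qed.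

Lemma tensionE fr : adapted_frame a x fr -> tension f a b x =
  tension_point (phi := acm_phi a x) (xi := acm_xi a x) (B := second_fundamental_form f a b x) fr.
Proof.
move=> Hfr; apply: (frame_trace2 (acm_acm_point (local_dom_src lx)) Hfr).
  exact: second_fundamental_form_linear.
by move=> w k u v; rewrite !(second_fundamental_form_sym sf lx _ w) second_fundamental_form_linear.
Qed.

Hypothesis hM : almost_semi_cosymplectic M.
Variable fr : 'I_m -> 'rV[R]_((m.*2).+1).
Hypothesis Hfr : adapted_frame a x fr.
Let H := acm_acm_point (local_dom_src lx).

Lemma coclosed_Omega_frame :
  \sum_i P_point (acm_phi a x) (nabla_phi a x) (fr i) (fr i) = nabla_xi a x (acm_xi a x) *m acm_phi a x.
Proof.
have [_ /(_ fr Hfr) E] := hM (local_dom_src lx).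
apply: (inner_inj (acp_pos H)) => v; have := E v.
by rewrite /codiff_Omega innerDl innerNl => /eqP; rewrite addrC subr_eq0 => /eqP.
Qed.

Lemma coclosed_eta_frame :
  \sum_i (inner (metric a x) (nabla_xi a x (fr i)) (fr i) +
    inner (metric a x) (nabla_xi a x (fr i *m acm_phi a x)) (fr i *m acm_phi a x)) = 0.
Proof.
have [/eqP E _] := hM (local_dom_src lx); move: E; rewrite oppr_eq0 => /eqP E.
have lT : linear (nabla_xi a x) by move=> k u v; rewrite (acp_TD H) (acp_TZ H).
have alg (t p q : R) : t = p + q -> q = 0 -> t = 0 -> p = 0 by move=> -> ->; rewrite addr0.
exact: (alg _ _ _ (frame_trace H Hfr lT) (acp_T_xi H _) E).
Qed.

End HolomorphicMap.

Section ContactTargetMap.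
Context {R : realType} {m n : nat} {M : almost_contact_metric R m} {N : almost_contact_metric R n}.
Context {f : M -> N} (sf : smooth_map f).
Variable s : R.
Hypothesis ss : s * s = 1.
Hypothesis hol : forall a b x, local_dom f a b x ->
  acm_phi a x *m diff_map f a b x = s *: (diff_map f a b x *m acm_phi b (local_map f a b x)).
Variables (a : chart M) (b : chart N).
Local Notation lm := (local_map f a b).
Local Notation D := (diff_map f a b).
Local Notation g := (metric a).
Local Notation h := (metric b).

(** The coefficient of f_* xi on gamma, read off in a pair of charts. It is available even where no
    global lambda is given; [local_lambdaE] identifies the two. *)
Definition local_lambda (y : 'rV[R]_((m.*2).+1)) : R :=
  inner (h (lm y)) (acm_xi a y *m D y) (acm_xi b (lm y)).

Lemma diff_map_xi y : local_dom f a b y -> acm_xi a y *m D y = local_lambda y *: acm_xi b (lm y).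
Proof.
move=> ly; apply: (acp_ker_phi (acm_algebra_point (local_dom_tgt ly))).
have : s *: (acm_xi a y *m D y *m acm_phi b (lm y)) = 0.
  rewrite -mulmxA scalemxAr -(hol ly) mulmxA (acm_xi_phi (local_dom_src ly)).
  by rewrite mul0mx.
by move=> /(congr1 ( *:%R s)); rewrite scalerA ss scale1r scaler0.
Qed.

(** Write v = eta(v) xi - phi^2 v: the image of phi^2 v lies in the range of the target's [phi],
    hence is orthogonal to gamma. *)
Lemma eta_diff_map y v : local_dom f a b y ->
  inner (h (lm y)) (v *m D y) (acm_xi b (lm y)) = local_lambda y * inner (g y) v (acm_xi a y).
Proof.
move=> ly; have HM := acm_algebra_point (local_dom_src ly).
have HN := acm_algebra_point (local_dom_tgt ly).
have -> : v = inner (g y) v (acm_xi a y) *: acm_xi a y - v *m acm_phi a y *m acm_phi a y.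
  by rewrite (acp_phi2 HM) opprD opprK addrCA subrr addr0.
rewrite mulmxBl -scalemxAl -[X in _ - X]mulmxA (hol ly) -scalemxAr mulmxA diff_map_xi //.
rewrite innerBl !innerZl (acp_phi_xi HN) (acp_xi HN) innerBl innerZl (acp_xi HM) (acp_phi_xi HM).
ring.
Qed.

Variable x : 'rV[R]_((m.*2).+1).
Hypothesis lx : local_dom f a b x.
Local Notation B := (second_fundamental_form f a b x).

Let mg : local_metric g x := metric_local (local_dom_src lx).
Let mh : local_metric h (lm x) := metric_local (local_dom_tgt lx).
Let dlm : differentiable lm x := local_map_differentiable sf lx.
Let near_dom := local_dom_nbhs sf lx.
Let dxi : differentiable (acm_xi a) x := acm_xi_differentiable (local_dom_src lx).
Let dgam : differentiable (acm_xi b) (lm x) := acm_xi_differentiable (local_dom_tgt lx).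
Let dgamlm : differentiable (acm_xi b \o lm) x.
Proof. exact: differentiable_comp. Qed.

Lemma local_lambda_differentiable : differentiable local_lambda x.
Proof.
apply: (differentiable_inner (Z := fun y => acm_xi a y *m D y)) => //.
  by apply: differentiable_comp => //; case: mh.
exact: mul_diff_map_differentiable.
Qed.

Lemma second_fundamental_form_eta v w :
  inner (h (lm x)) (B v w) (acm_xi b (lm x)) =
  'D_v local_lambda x * inner (g x) w (acm_xi a x) + local_lambda x * inner (g x) (nabla_xi a x v) w
  - inner (h (lm x)) (nabla_xi b (lm x) (v *m D x)) (w *m D x).
Proof.
have dw : differentiable (fun y => w *m D y) x by exact: (mul_diff_map_differentiable sf lx (X := cst w)).
have E1 := derive_inner_along mh dlm v dw dgamlm.
have E2 := nabla_along_field sf lx v (differentiable_cst w x).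
have E3 := nabla_along_comp sf lx v dgam.
have E4 := derive_inner_nabla mg v (differentiable_cst w x) dxi.
have dk : differentiable (fun y => inner (g y) w (acm_xi a y)) x.
  have [dg _ _] := mg; exact: (differentiable_inner dg (differentiable_cst w x) dxi).
have E5 : 'D_v (fun y => inner (h (lm y)) (w *m D y) ((acm_xi b \o lm) y)) x =
    'D_v (fun y => local_lambda y * inner (g y) w (acm_xi a y)) x.
  by apply: near_eq_derive; apply: filterS near_dom => y ly; exact: eta_diff_map.
have E6 := deriveM (derivable_dir v local_lambda_differentiable) (derivable_dir v dk).
have E7 := eta_diff_map (nabla g v (cst w) x) lx.
rewrite E5 [LHS]E6 E4 E3 [nabla_along _ _ _ _ _]E2 in E1.
exact: (second_fundamental_form_eta_algebra (local_metric_sym mg) (local_metric_sym mh) E7 E1).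
Qed.

Lemma second_fundamental_form_xi v :
  B v (acm_xi a x) = 'D_v local_lambda x *: acm_xi b (lm x)
    + local_lambda x *: nabla_xi b (lm x) (v *m D x) - nabla_xi a x v *m D x.
Proof.
have E1 := nabla_along_field sf lx v dxi.
have near_xi : \forall y \near x, acm_xi a y *m D y = local_lambda y *: (acm_xi b \o lm) y.
  by apply: filterS near_dom => y ly; exact: diff_map_xi.
have E2 := nabla_along_near a b v near_xi.
have E3 := nabla_along_scale lx v local_lambda_differentiable dgamlm.
have E4 := nabla_along_comp sf lx v dgam.
by rewrite /nabla_xi -E4 -E3 -E2 E1 addrK.
Qed.

End ContactTargetMap.

Lemma J_derivative_algebra (R : realType) d (J : 'M[R]_d) (z aw aJw : 'rV[R]_d) :
  z *m J *m J = - z -> - z = (z *m J + aw) *m J + aJw -> aJw = - (aw *m J).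
Proof.
move=> JJ; rewrite mulmxDl JJ -addrA -[LHS]addr0 => /addrI /esym/eqP.
by rewrite addrC addr_eq0 => /eqP.
Qed.

Lemma eq0_of_eq_opp (R : realType) (p q r : R) : p = q -> r = - p -> r = q -> p = 0.
Proof. by lra. Qed.

(** * Almost Hermitian targets *)

Section Hermitian.
Context {R : realType} {n : nat} {N : almost_hermitian R n} (b : chart N) (x : 'rV[R]_n.*2).
Hypothesis bx : chart_img b x.
Local Notation g := (metric b).
Local Notation J := (ah_J b).
Local Notation A := (nabla_J b x).
Implicit Types (v w u : 'rV[R]_n.*2).

Let mg : local_metric g x := metric_local bx.
Let gC v w : inner (g x) v w = inner (g x) w v.
Proof. exact: innerC (local_metric_sym mg). Qed.

Lemma ah_J_differentiable : differentiable J x.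
Proof. exact: smooth_on_differentiable ((ah_JP N).1 b) bx. Qed.
Let dJ := ah_J_differentiable.

Lemma ah_J_skew y w u : chart_img b y ->
  inner (g y) (w *m J y) u = - inner (g y) w (u *m J y).
Proof. by move=> yx; rewrite -(ah_compat (w *m J y) u yx) ah_J2 // innerNl. Qed.

Lemma nabla_J_skew v w u : inner (g x) (A v w) u = - inner (g x) w (A v u).
Proof.
apply: (nabla_endo_skew mg dJ); apply: filterS (chart_img_nbhs bx) => y yx z t.
exact: ah_J_skew.
Qed.

Lemma nabla_J_J v w : A v (w *m J x) = - (A v w *m J x).
Proof.
have dw : differentiable (fun y => w *m J y) x by exact: (differentiable_mulmx (X := cst w)).
have E1 := nabla_mulmx g dJ v dw; have E2 := nabla_mulmx g dJ v (differentiable_cst w x).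
have E3 : nabla g v (fun y => w *m J y *m J y) x = nabla g v (cst (- w)) x.
  by apply: nabla_near; apply: filterS (chart_img_nbhs bx) => y yx; exact: ah_J2.
have E4 : nabla g v (cst (- w)) x = - nabla g v (cst w) x.
  by rewrite !nabla_cst -(scaleN1r w) (christoffelZr mg) scaleN1r.
rewrite E3 E4 [X in X *m _]E2 in E1.
exact: (J_derivative_algebra (ah_J2 _ bx) E1).
Qed.

(** As for [d_Omega_phi]: the third cyclic term of dPhi(v, Jv, z) is its own opposite, because the
    derivative of J is skew and anticommutes with J. *)
Lemma almost_kahler_quasi v : almost_kahler N -> A (v *m J x) v - A v (v *m J x) = 0.
Proof.
move=> dPhi; have [_ _ pg] := mg; apply: (inner_inj pg) => z.
have third : inner (g x) v (A z (v *m J x)) = 0.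
  have E1 : inner (g x) v (A z (v *m J x)) = inner (g x) (v *m J x) (A z v).
    by rewrite nabla_J_J innerNr -ah_J_skew.
  exact: (eq0_of_eq_opp E1 (nabla_J_skew z v (v *m J x)) (gC _ _)).
have E u w t : nabla_2form g (fundamental_form g J) x u w t = inner (g x) w (A u t).
  exact: (nabla_2form_fundamental mg dJ).
have := dPhi b x v (v *m J x) z bx.
rewrite /ext_2form !E third addr0 -[inner _ (v *m J x) _]opprK -(nabla_J_skew v (v *m J x) z).
by rewrite [inner _ z _]gC innerBl inner0l addrC.
Qed.

(** Since [A v] anticommutes with J, [S_point] is precisely the quasi-Kähler defect, and each of the
    four classes makes it vanish. *)
Lemma class_C1_S v : class_C1 N -> S_point (J x) A v = 0.
Proof.
have quasi : A (v *m J x) v - A v (v *m J x) = 0 -> S_point (J x) A v = 0.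
  by rewrite /S_point nabla_J_J opprK.
case=> [K|K|K|K]; last exact: (quasi (K b x v bx)).
- by rewrite /S_point !K // mul0mx addr0.
- have Dl u w z : A (u + w) z = A u z + A w z by exact: nabla_endoDl.
  have Dr u w z : A z (u + w) = A z u + A z w by exact: nabla_endoDr.
  have A0 u : A u u = 0 by exact: K bx.
  by rewrite /S_point (alternating_anti Dl Dr A0 (v *m J x) v) nabla_J_J A0 mul0mx oppr0 addr0 oppr0.
- exact/quasi/almost_kahler_quasi.
Qed.

End Hermitian.

Section HermitianTargetMap.
Context {R : realType} {m n : nat} {M : almost_contact_metric R m} {N : almost_hermitian R n}.
Context {f : M -> N} (sf : smooth_map f).
Variable s : R.
Hypothesis ss : s * s = 1.
Hypothesis hol : forall a b x, local_dom f a b x ->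
  acm_phi a x *m diff_map f a b x = s *: (diff_map f a b x *m ah_J b (local_map f a b x)).

Lemma diff_map_xi_hermitian a b x : local_dom f a b x -> acm_xi a x *m diff_map f a b x = 0.
Proof.
move=> lx; have by_ := local_dom_tgt lx.
have : s *: (acm_xi a x *m diff_map f a b x *m ah_J b (local_map f a b x)) = 0.
  rewrite -mulmxA scalemxAr -(hol lx) mulmxA (acm_xi_phi (local_dom_src lx)).
  by rewrite mul0mx.
move=> /(congr1 ( *:%R s)); rewrite scalerA ss scale1r scaler0.
move=> /(congr1 (mulmx^~ (ah_J b (local_map f a b x)))); rewrite ah_J2 // mul0mx => /eqP.
by rewrite oppr_eq0 => /eqP.
Qed.

Lemma second_fundamental_form_xi_hermitian a b x v : local_dom f a b x ->
  second_fundamental_form f a b x v (acm_xi a x) = - (nabla_xi a x v *m diff_map f a b x).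
Proof.
move=> lx; have E1 := nabla_along_field sf lx v (acm_xi_differentiable (local_dom_src lx)).
have near_xi : \forall y \near x, acm_xi a y *m diff_map f a b y = 0.
  by apply: filterS (local_dom_nbhs sf lx) => y ly; exact: diff_map_xi_hermitian.
have E2 := nabla_along_near a b v near_xi.
have E3 := nabla_along_cst0 lx v.
by apply/eqP; rewrite -addr_eq0 /nabla_xi -E1 E2 E3.
Qed.

End HermitianTargetMap.

Lemma conformal_derivative_algebra (R : realType) d e (g : 'M[R]_d) (h : 'M[R]_e)
    (v w v' w' : 'rV[R]_d) (vF wF vF' wF' bv bw : 'rV[R]_e) (l dl : R) :
  inner h vF' wF = l ^+ 2 * inner g v' w -> inner h vF wF' = l ^+ 2 * inner g v w' ->
  l * l * (inner g v' w + inner g v w') + inner g v w * (l * dl + l * dl) =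
    inner h (bv + vF') wF + inner h vF (bw + wF') ->
  inner h bv wF + inner h vF bw = 2 * l * dl * inner g v w.
Proof.
move=> E1 E2; rewrite innerDl innerDr E1 E2.
move: (inner _ _ _) (inner _ _ _) (inner _ _ _) (inner _ _ _) (inner _ _ _) => p q r t u E.
by lra.
Qed.

(** * Differentiating the conformality relation *)

Section ConformalMap.
Context {R : realType} {d e : nat} {M : riemannian R d} {N : riemannian R e}.
Context {f : M -> N} (sf : smooth_map f) (a : chart M) (b : chart N) (x : 'rV[R]_d).
Hypothesis lx : local_dom f a b x.
Local Notation lm := (local_map f a b).
Local Notation D := (diff_map f a b).
Local Notation B := (second_fundamental_form f a b x).
Variable l : 'rV[R]_d -> R.
Hypothesis dl : differentiable l x.
Hypothesis conf : forall y v w, local_dom f a b y ->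
  inner (metric b (lm y)) (v *m D y) (w *m D y) = l y ^+ 2 * inner (metric a y) v w.

(** The conformal factor is the square of a differentiable [l], to be taken as the coefficient of
    f_* xi; the function [mu] could not be differentiated. *)
Lemma conformal_derivative u v w :
  inner (metric b (lm x)) (B u v) (w *m D x) + inner (metric b (lm x)) (v *m D x) (B u w)
  = 2 * l x * 'D_u l x * inner (metric a x) v w.
Proof.
have mg : local_metric (metric a) x := metric_local (local_dom_src lx).
have mh : local_metric (metric b) (lm x) := metric_local (local_dom_tgt lx).
have dlm : differentiable lm x := local_map_differentiable sf lx.
have dmul (z : 'rV[R]_d) : differentiable (fun y => z *m D y) x.
  exact: (mul_diff_map_differentiable sf lx (X := cst z)).
have E1 := derive_inner_along mh dlm u (dmul v) (dmul w).
have E2 z : nabla_along (metric b) lm x u (fun y => z *m D y) =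
    B u z + nabla (metric a) u (cst z) x *m D x.
  exact: (nabla_along_field sf lx u (differentiable_cst z x)).
have dk : differentiable (fun y => inner (metric a y) v w) x.
  have [dg _ _] := mg.
  exact: (differentiable_inner dg (differentiable_cst v x) (differentiable_cst w x)).
have E3 : 'D_u (fun y => inner (metric b (lm y)) (v *m D y) (w *m D y)) x =
    'D_u (fun y => l y * l y * inner (metric a y) v w) x.
  apply: near_eq_derive; apply: filterS (local_dom_nbhs sf lx) => y ly.
  by rewrite conf // expr2.
have dll := differentiableM dl dl.
have E4 := deriveM (derivable_dir u dll) (derivable_dir u dk).
have E5 := deriveM (derivable_dir u dl) (derivable_dir u dl).
have E6 := derive_inner_nabla mg u (differentiable_cst v x) (differentiable_cst w x).
rewrite E3 [LHS]E4 E5 E6 !E2 in E1.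
have C1 := conf (nabla (metric a) u (cst v) x) w lx.
have C2 := conf v (nabla (metric a) u (cst w) x) lx.
exact: (conformal_derivative_algebra C1 C2 E1).
Qed.

End ConformalMap.
Arguments local_lambda {R m n M N} f a b y.

Lemma pm_sign (R : realType) (s : R) : s = 1 \/ s = -1 -> s * s = 1.
Proof. by case=> ->; rewrite ?mulrNN mulr1. Qed.

Lemma inner_basis (R : realType) d (A : 'M[R]_d) i j : inner A (basis_vec i) (basis_vec j) = A i j.
Proof. by rewrite innerE -rowE trmx_delta -colE !mxE. Qed.

Lemma mulmx_eq0 (R : realType) d e (D : 'M[R]_(d, e)) : (forall v : 'rV_d, v *m D = 0) -> D = 0.
Proof. by move=> D0; apply/row_matrixP => i; rewrite rowE D0 row0. Qed.

(** * Global consequences *)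

Section ConformalConstant.
Context {R : realType} {d e : nat} {M : riemannian R d} {N : riemannian R e}.
Context {f : M -> N} (sf : smooth_map f).

Lemma conformal_diff_map0 (a : chart M) (b : chart N) x k v : local_dom f a b x ->
  (forall v w, inner (metric b (local_map f a b x)) (v *m diff_map f a b x) (w *m diff_map f a b x)
     = k * inner (metric a x) v w) ->
  inner (metric a x) v v != 0 -> v *m diff_map f a b x = 0 -> diff_map f a b x = 0.
Proof.
move=> lx conf vv vD; have [_ _ ph] := metric_local (local_dom_tgt lx).
have k0 : k = 0.
  have /esym/eqP := conf v v; rewrite vD inner0l mulf_eq0 (negPf vv) orbF.
  by move/eqP.
by apply: mulmx_eq0 => w; apply: (inner_eq0 ph); rewrite conf k0 mul0r.
Qed.

(** A unit vector in the kernel forces the conformal factor to vanish at the point, and then the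
    whole differential is zero. *)
Lemma conformal_constant : weakly_conformal f ->
  (forall a b x, local_dom f a b x -> exists2 v, inner (metric a x) v v = 1 & v *m diff_map f a b x = 0) ->
  constant_map f.
Proof.
move=> [mu [_ conf]] ker; apply: (smooth_map_constant sf) => a b x lx.
have [v v1 vD] := ker a b x lx.
by apply: (conformal_diff_map0 lx (fun v w => conf a b x v w lx) _ vD); rewrite v1 oner_neq0.
Qed.

Lemma constant_harmonic : constant_map f -> harmonic_map f.
Proof.
move=> cf a b x lx.
have lmE : local_map f a b = cst (local_map f a b x).
  by apply/funext => y; rewrite /local_map /= (cf (param a y) (param a x)).
have D0 y : diff_map f a b y = 0.
  apply: mulmx_eq0 => v; rewrite /diff_map lmE -deriveEjacobian ?derive_cst //.
rewrite /tension; apply: big1 => i _; apply: big1 => j _.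
rewrite (second_fundamental_formE sf lx) D0 !mulmx0 subr0.
rewrite (christoffel0r (metric_local (local_dom_tgt lx))) addr0.
have -> : diff_map f a b = cst 0 by apply/funext.
by rewrite derive_cst mulmx0 scaler0.
Qed.

End ConformalConstant.

(** * Maps into almost contact metric manifolds *)

Section ContactMaps.
Context {R : realType} {m n : nat} {M : almost_contact_metric R m} {N : almost_contact_metric R n}.
Hypothesis hM : almost_semi_cosymplectic M.
Context {f : M -> N} (sf : smooth_map f).
Hypothesis pm : pm_holomorphic f (@acm_phi R m M) (@acm_phi R n N).
Local Notation loc := (local_lambda f).

Section Point.
Variables (a : chart M) (b : chart N) (x : 'rV[R]_((m.*2).+1)).
Hypothesis lx : local_dom f a b x.
Local Notation lm := (local_map f a b).
Local Notation D := (diff_map f a b).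
Local Notation B := (second_fundamental_form f a b x).

Let ax := local_dom_src lx.
Let bx := local_dom_tgt lx.
Let H := acm_acm_point ax.
Let HN := acm_acm_point bx.

Lemma contact_holomorphic_point : exists s, [/\ s * s = 1,
  forall a b x, local_dom f a b x ->
    acm_phi a x *m diff_map f a b x = s *: (diff_map f a b x *m acm_phi b (local_map f a b x))
  & holomorphic_point (acm_phi a x) (nabla_phi a x) (acm_phi b (lm x)) (nabla_phi b (lm x)) (D x) B s].
Proof.
have [s [/pm_sign ss hol]] := pm; exists s; split; [exact: ss|exact: hol|].
exact: (holomorphic_pointP sf (fun c y => @acm_phi_differentiable _ _ _ c y) ss hol lx).
Qed.

Lemma local_xi : acm_xi a x *m D x = loc a b x *: acm_xi b (lm x).
Proof. by have [s [ss hol _]] := contact_holomorphic_point; exact: (diff_map_xi ss hol lx). Qed.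

Lemma local_eta v : inner (metric b (lm x)) (v *m D x) (acm_xi b (lm x)) =
  loc a b x * inner (metric a x) v (acm_xi a x).
Proof. by have [s [ss hol _]] := contact_holomorphic_point; exact: (eta_diff_map ss hol v lx). Qed.

Lemma local_B_eta v w : inner (metric b (lm x)) (B v w) (acm_xi b (lm x)) =
  'D_v (loc a b) x * inner (metric a x) w (acm_xi a x)
  + loc a b x * inner (metric a x) (nabla_xi a x v) w
  - inner (metric b (lm x)) (nabla_xi b (lm x) (v *m D x)) (w *m D x).
Proof.
by have [s [ss hol _]] := contact_holomorphic_point; exact: (second_fundamental_form_eta sf ss hol lx v w).
Qed.

Lemma local_B_xi v : B v (acm_xi a x) = 'D_v (loc a b) x *: acm_xi b (lm x)
    + loc a b x *: nabla_xi b (lm x) (v *m D x) - nabla_xi a x v *m D x.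
Proof.
by have [s [ss hol _]] := contact_holomorphic_point; exact: (second_fundamental_form_xi sf ss hol lx v).
Qed.

Lemma local_contact_D rho v : rho != 0 -> chart_contact_type b (lm x) rho ->
  inner (metric a x) v (acm_xi a x) = 0 -> v *m D x = 0.
Proof.
move=> rho0 Crho v0; have [s [_ _ K]] := contact_holomorphic_point.
have [fr Hfr] := frame_atP lx.
exact: (contact_type_target H K HN local_eta local_B_eta Hfr (coclosed_Omega_frame lx hM Hfr) rho0 Crho v0).
Qed.

Lemma local_tension_contact rho : rho != 0 -> chart_contact_type b (lm x) rho ->
  (tension f a b x = 0 <-> 'D_(acm_xi a x) (loc a b) x = 0).
Proof.
move=> rho0 Crho; have [s [_ _ K]] := contact_holomorphic_point.
have [fr Hfr] := frame_atP lx; rewrite (tensionE sf lx Hfr).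
exact: (tension_contact_type H K HN local_xi local_eta local_B_eta local_B_xi Hfr
  (coclosed_Omega_frame lx hM Hfr) (coclosed_eta_frame lx hM Hfr) rho0 Crho).
Qed.

Lemma local_tension_kenmotsu beta fr : adapted_frame a x fr ->
  chart_kenmotsu_type b (lm x) beta ->
  (tension f a b x = 0 <-> 'D_(acm_xi a x) (loc a b) x -
    2 * beta * \sum_i inner (metric b (lm x)) (fr i *m D x) (fr i *m D x) = 0).
Proof.
move=> Hfr Kb; have [s [_ _ K]] := contact_holomorphic_point.
rewrite (tensionE sf lx Hfr).
exact: (tension_kenmotsu_type H K HN local_xi local_eta local_B_eta local_B_xi Hfr
  (coclosed_Omega_frame lx hM Hfr) (coclosed_eta_frame lx hM Hfr) Kb).
Qed.

Lemma local_tension_kenmotsu0 : chart_kenmotsu_type b (lm x) 0 ->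
  (tension f a b x = 0 <-> 'D_(acm_xi a x) (loc a b) x = 0).
Proof.
have [fr Hfr] := frame_atP lx.
by move=> /(local_tension_kenmotsu Hfr); rewrite mulr0 mul0r subr0.
Qed.

Lemma local_diff_map_D fr v : adapted_frame a x fr ->
  \sum_i inner (metric b (lm x)) (fr i *m D x) (fr i *m D x) = 0 ->
  inner (metric a x) v (acm_xi a x) = 0 -> v *m D x = 0.
Proof.
move=> Hfr E0 v0; have [s [_ _ K]] := contact_holomorphic_point.
exact: (sum_norm_eq0_D H K HN Hfr E0 v0).
Qed.

Lemma local_lambdaE lambda : is_lambda f lambda -> lambda (param a x) = loc a b x.
Proof.
move=> [_ lam]; have := lam a b x lx; rewrite local_xi.
move=> /(congr1 (inner (metric b (lm x)) ^~ (acm_xi b (lm x)))).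
by rewrite !innerZl (acp_xi HN) !mulr1.
Qed.

Lemma conformal_local_lambda mu v w : conformal_with f mu ->
  inner (metric b (lm x)) (v *m D x) (w *m D x) = loc a b x ^+ 2 * inner (metric a x) v w /\
  mu (param a x) ^+ 2 = loc a b x ^+ 2.
Proof.
move=> [_ conf]; have := conf a b x (acm_xi a x) (acm_xi a x) lx.
rewrite local_xi innerZl innerZr (acp_xi HN) (acp_xi H) !mulr1 => E.
by split; rewrite -?expr2 in E *; [rewrite conf // E expr2|rewrite -E expr2].
Qed.

End Point.

Lemma derive_lambda lambda a b x v : is_lambda f lambda -> local_dom f a b x ->
  'D_v (lambda \o param a) x = 'D_v (loc a b) x.
Proof.
move=> lam lx; apply: near_eq_derive; apply: filterS (local_dom_nbhs sf lx) => y ly.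
exact: local_lambdaE.
Qed.

Lemma constant_along_D_contact :
  class_A1 N \/ class_A2 N \/ class_A3 N \/ class_A5 N \/ class_A6 N -> constant_along_D f.
Proof.
move=> HN a b x v lx; rewrite (pairing_eta v (local_dom_src lx)) => v0.
have [rho rho0 Crho] := class_contact_type HN (local_dom_tgt lx).
exact: (local_contact_D lx rho0 Crho v0).
Qed.

Lemma harmonic_iff_lambda lambda : is_lambda f lambda ->
  (forall a b x, local_dom f a b x ->
     (tension f a b x = 0 <-> 'D_(acm_xi a x) (loc a b) x = 0)) ->
  (harmonic_map f <-> constant_along_xi lambda).
Proof.
move=> lam crit; split=> [hf a x ax|lc a b x lx].
  have [b lx] := exists_local_dom (f := f) ax.
  by rewrite (derive_lambda _ lam lx); apply/(crit a b x lx); exact: hf.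
by apply/(crit a b x lx); rewrite -(derive_lambda _ lam lx); exact: lc (local_dom_src lx).
Qed.

Lemma lambda_zero_iff lambda : is_lambda f lambda ->
  ((forall p, lambda p = 0) <-> maps_xi_to_zero f).
Proof.
move=> lam; split=> [l0 a b x lx|f0 p].
  by rewrite (local_xi lx) -(local_lambdaE lx lam) l0 scale0r.
have [a [x [ax <-]]] := exists_chart p; have [b lx] := exists_local_dom (f := f) ax.
rewrite (local_lambdaE lx lam); have := f0 a b x lx; rewrite (local_xi lx).
move=> /(congr1 (inner (metric b (local_map f a b x)) ^~ (acm_xi b (local_map f a b x)))).
by rewrite innerZl inner0l (acp_xi (acm_acm_point (local_dom_tgt lx))) mulr1.
Qed.

Lemma harmonic_iff_kenmotsu0 lambda : is_lambda f lambda -> class_A4 N \/ class_B1 N ->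
  (harmonic_map f <-> constant_along_xi lambda).
Proof.
move=> lam HN; apply: harmonic_iff_lambda => // a b x lx.
exact: (local_tension_kenmotsu0 lx (class_kenmotsu_type HN (local_dom_tgt lx))).
Qed.

Lemma harmonic_iff_contact lambda : is_lambda f lambda ->
  class_A1 N \/ class_A2 N \/ class_A3 N \/ class_A5 N \/ class_A6 N ->
  (harmonic_map f <-> constant_along_xi lambda).
Proof.
move=> lam HN; apply: harmonic_iff_lambda => // a b x lx.
have [rho rho0 Crho] := class_contact_type HN (local_dom_tgt lx).
exact: (local_tension_contact lx rho0 Crho).
Qed.

Lemma lambda_zero_derive lambda a b x v : is_lambda f lambda -> (forall p, lambda p = 0) ->
  local_dom f a b x -> 'D_v (loc a b) x = 0.
Proof.
move=> lam l0 lx; rewrite -(derive_lambda _ lam lx).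
have -> : lambda \o param a = cst 0 by apply/funext => y; rewrite /= l0.
exact: derive_cst.
Qed.

Lemma pluriharmonic_B1 lambda : is_lambda f lambda -> class_B1 N -> class_B1_restricted M ->
  (forall p, lambda p = 0) -> pluriharmonic f.
Proof.
move=> lam HN HM l0 a b x v lx; have [s [_ _ K]] := contact_holomorphic_point lx.
apply: (pluriharmonic_contact_target (acm_acm_point (local_dom_src lx)) K
  (acm_acm_point (local_dom_tgt lx)) (local_xi lx) (local_eta lx) (local_B_eta lx) (local_B_xi lx)).
- by rewrite -(local_lambdaE lx lam) l0.
- by move=> w; exact: lambda_zero_derive lam l0 lx.
- exact: (class_restricted_type HM (local_dom_src lx)).
- exact: (class_kenmotsu_type (or_intror HN) (local_dom_tgt lx)).
Qed.

Lemma conformal_local_tension mu a b x w : (0 < m)%N -> conformal_with f mu ->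
  local_dom f a b x -> tension f a b x = 0 -> loc a b x * 'D_w (loc a b) x = 0.
Proof.
move=> m0 conf lx t0; have [fr Hfr] := frame_atP lx.
have dl : differentiable (loc a b) x by exact: (local_lambda_differentiable sf lx).
have lin : linear ((fun v => 'D_v (loc a b) x) : _ -> R^o).
  by move=> k u v; rewrite deriveDdir // deriveZdir.
have cd := conformal_derivative sf lx dl (fun y v w ly => (conformal_local_lambda ly v w conf).1).
have := conformal_tension (acm_acm_point (local_dom_src lx)) (second_fundamental_form_sym sf lx)
  (local_metric_sym (metric_local (local_dom_tgt lx))) lin cd w Hfr.
rewrite -(tensionE sf lx Hfr) t0 inner0l => /esym/eqP; rewrite oppr_eq0 -mulrA mulf_eq0.
(* The factor 2m - 1 is nonzero by parity. *)
move=> /orP[|/eqP //]; rewrite subr_eq0 -natrM -[1]/(1%:R) eqr_nat.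
by rewrite mul2n => /eqP /(congr1 odd); rewrite odd_double.
Qed.

(** From lambda dlambda = 0, lambda^2 is constant. So either lambda vanishes somewhere, hence
    everywhere, or it vanishes nowhere and may be cancelled to give dlambda = 0. *)
Lemma conformal_harmonic_lambda lambda : (0 < m)%N -> is_lambda f lambda ->
  weakly_conformal f -> harmonic_map f -> forall p q, lambda p = lambda q.
Proof.
move=> m0 lam [mu conf] hf.
have dlam a x : chart_img a x -> differentiable (lambda \o param a) x.
  by move=> ax; exact: smooth_on_differentiable (lam.1 a) ax.
have ldl a x v : chart_img a x -> lambda (param a x) * 'D_v (lambda \o param a) x = 0.
  move=> ax; have [b lx] := exists_local_dom (f := f) ax.
  rewrite (derive_lambda _ lam lx) (local_lambdaE lx lam).
  exact: (conformal_local_tension _ m0 conf lx (hf a b x lx)).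
have sq : forall p q, lambda p * lambda p = lambda q * lambda q.
  apply: (@differentiable_fun_constant _ _ M (fun p => lambda p * lambda p)).
    by move=> a x ax; exact: differentiableM (dlam a x ax) (dlam a x ax).
  move=> a x ax v; rewrite -[X in 'D_v X x]/((lambda \o param a) * (lambda \o param a)).
  rewrite deriveM; try (exact: (derivable_dir v (dlam a x ax))).
  by rewrite [X in X + _](ldl a x v ax) [X in _ + X](ldl a x v ax) addr0.
have [[p0 l0]|ln0] := pselect (exists p, lambda p = 0).
  have all0 p : lambda p = 0.
    by have /eqP := sq p p0; rewrite l0 mul0r mulf_eq0 orbb => /eqP.
  by move=> p q; rewrite !all0.
apply: differentiable_fun_constant => // a x ax v.
have /eqP := ldl a x v ax; rewrite mulf_eq0 => /orP[/eqP l0|/eqP //].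
by case: ln0; exists (param a x).
Qed.

Lemma conformal_homothetic lambda : is_lambda f lambda -> weakly_conformal f ->
  (forall p q, lambda p = lambda q) -> homothetic f.
Proof.
move=> lam [mu conf] cl.
(* [manifold] admits the empty space, on which any constant serves. Otherwise the absolute value of
   lambda at a point is taken, the dilation having to be nonnegative. *)
have [[p0 _]|noM] := pselect (exists p : M, True); last first.
  by exists 0; split=> // a b x v w lx; case: noM; exists (param a x).
exists `|lambda p0|; split=> // a b x v w lx.
rewrite (conformal_local_lambda lx v w conf).1 -(local_lambdaE lx lam) (cl p0 (param a x)).
by rewrite real_normK // num_real.
Qed.

(** Where f is an immersion, the induced metric is lambda^2 g with lambda nonzero. Its trace of
    [pullback_nabla] is the tension divided by lambda^2, up to a tangential vector, which is
    orthogonal to [nu]. *)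
Lemma conformal_minimal_image : weakly_conformal f -> harmonic_map f -> minimal_image f.
Proof.
move=> [mu conf] hf a b x lx free nu Hnu.
have mh := metric_local (local_dom_tgt lx); have mg := metric_local (local_dom_src lx).
have [_ _ pg] := mg.
have cE v w := (conformal_local_lambda lx v w conf).1.
have ind : induced_metric f a b x = loc a b x ^+ 2 *: metric a x.
  apply/matrixP => i j; rewrite -inner_basis [in RHS]mxE -inner_basis -cE.
  by rewrite !innerE /induced_metric trmx_mul !mulmxA.
have l2 : loc a b x ^+ 2 != 0.
  apply/negP => /eqP l20; move: free; rewrite (_ : diff_map f a b x = 0).
    by rewrite /row_free mxrank0.
  have [_ _ ph] := mh.
  by apply: mulmx_eq0 => v; apply: (inner_eq0 ph); rewrite cE l20 mul0r.
have invE i j : invmx (induced_metric f a b x) i j = (loc a b x ^+ 2)^-1 * invmx (metric a x) i j.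
  rewrite ind invmxZ ?mxE // unitmxE detZ unitrM unitfE expf_neq0 //=.
  by rewrite -unitmxE posdef_unitmx.
have pE v w : pullback_nabla f a b x v w =
    second_fundamental_form f a b x v w + christoffel (metric a) x v w *m diff_map f a b x.
  by rewrite /second_fundamental_form subrK.
transitivity ((loc a b x ^+ 2)^-1 * inner (metric b (local_map f a b x)) (tension f a b x) nu).
  rewrite /tension !inner_suml mulr_sumr; apply: eq_bigr => i _.
  rewrite !inner_suml mulr_sumr; apply: eq_bigr => j _.
  by rewrite invE pE scalerDr innerDl !innerZl Hnu !mulr0 addr0 mulrA.
by rewrite (hf a b x lx) inner0l mulr0.
Qed.

(** * Almost beta-Kenmotsu targets *)

Section Kenmotsu.
Variable beta : N -> R.
Hypothesis Nb : almost_beta_kenmotsu beta.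

Lemma beta_neq0 q : beta q != 0.
Proof. by case: Nb => [[_ ->]]. Qed.

Lemma local_tension_beta a b x fr : local_dom f a b x -> adapted_frame a x fr ->
  (tension f a b x = 0 <-> 'D_(acm_xi a x) (loc a b) x -
    2 * beta (f (param a x)) *
    \sum_i inner (metric b (local_map f a b x)) (fr i *m diff_map f a b x) (fr i *m diff_map f a b x) = 0).
Proof.
move=> lx Hfr; rewrite -(param_local_map lx).
exact: (local_tension_kenmotsu lx Hfr (almost_beta_kenmotsu_type Nb (local_dom_tgt lx))).
Qed.

Lemma harmonic_iff_beta lambda : is_lambda f lambda ->
  (harmonic_map f <->
   forall (a : chart M) (b : chart N) x, local_dom f a b x ->
   forall e : 'I_m -> 'rV[R]_((m.*2).+1), adapted_frame a x e ->
     'D_(acm_xi a x) (lambda \o param a) x - 2 * beta (f (param a x)) *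
       \sum_(i < m) inner (metric b (local_map f a b x))
          (e i *m diff_map f a b x) (e i *m diff_map f a b x) = 0).
Proof.
move=> lam; split=> [hf a b x lx fr Hfr|E a b x lx].
  rewrite (derive_lambda _ lam lx); apply/(local_tension_beta lx Hfr); exact: hf.
have [fr Hfr] := frame_atP lx; apply/(local_tension_beta lx Hfr).
by rewrite -(derive_lambda _ lam lx); exact: E.
Qed.

Lemma constant_along_D_beta lambda : is_lambda f lambda ->
  harmonic_map f -> constant_along_xi lambda -> constant_along_D f.
Proof.
move=> lam hf lc a b x v lx; rewrite (pairing_eta v (local_dom_src lx)) => v0.
have [fr Hfr] := frame_atP lx; apply: (local_diff_map_D lx Hfr _ v0).
have := (local_tension_beta lx Hfr).1 (hf a b x lx).
rewrite -(derive_lambda _ lam lx) (lc a x (local_dom_src lx)) sub0r => /eqP.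
by rewrite oppr_eq0 !mulf_eq0 pnatr_eq0 (negPf (beta_neq0 _)) => /eqP.
Qed.

Lemma frame_constant_along_D a b x fr i : constant_along_D f -> local_dom f a b x ->
  adapted_frame a x fr -> fr i *m diff_map f a b x = 0.
Proof.
move=> cD lx Hfr; apply: (cD a b x _ lx); rewrite (pairing_eta _ (local_dom_src lx)).
by have [_ /(_ i) []] := Hfr.
Qed.

Lemma constant_along_xi_beta lambda : is_lambda f lambda ->
  constant_along_D f -> (harmonic_map f <-> constant_along_xi lambda).
Proof.
move=> lam cD; apply: harmonic_iff_lambda => // a b x lx.
have [fr Hfr] := frame_atP lx; rewrite (local_tension_beta lx Hfr).
by rewrite big1 ?mulr0 ?subr0 // => i _; rewrite frame_constant_along_D // inner0l.
Qed.

(** The zero function is constant along xi, so a harmonic f is constant along D; it also kills xi,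
    and the two span the tangent space. *)
Lemma harmonic_constant_beta lambda : is_lambda f lambda -> (forall p, lambda p = 0) ->
  (harmonic_map f <-> constant_map f).
Proof.
move=> lam l0; split=> [hf|]; last exact: constant_harmonic.
have lc : constant_along_xi lambda.
  move=> a x ax; have [b lx] := exists_local_dom (f := f) ax.
  by rewrite (derive_lambda _ lam lx); exact: lambda_zero_derive lam l0 lx.
have cD := constant_along_D_beta lam hf lc.
apply: (smooth_map_constant sf) => a b x lx; apply: mulmx_eq0 => v.
have H := acm_acm_point (local_dom_src lx).
have -> : v = inner (metric a x) v (acm_xi a x) *: acm_xi a x
    + (v - inner (metric a x) v (acm_xi a x) *: acm_xi a x) by rewrite addrC subrK.
rewrite mulmxDl -scalemxAl (local_xi lx) -(local_lambdaE lx lam) l0 scale0r scaler0 add0r.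
apply: (cD a b x _ lx); rewrite (pairing_eta _ (local_dom_src lx)).
by rewrite innerBl innerZl (acp_xi H) mulr1 subrr.
Qed.

Lemma conformal_harmonic_constant_beta : (0 < m)%N -> weakly_conformal f ->
  (harmonic_map f <-> constant_map f).
Proof.
move=> m0 wc; split=> [hf|]; last exact: constant_harmonic.
apply: (conformal_constant sf wc) => a b x lx.
have H := acm_acm_point (local_dom_src lx).
exists (acm_xi a x); first exact: (acp_xi H).
have [mu conf] := wc; have [fr Hfr] := frame_atP lx.
have E1 := (local_tension_beta lx Hfr).1 (hf a b x lx).
have E2 := conformal_local_tension (acm_xi a x) m0 conf lx (hf a b x lx).
have E3 : \sum_i inner (metric b (local_map f a b x)) (fr i *m diff_map f a b x)
    (fr i *m diff_map f a b x) = m%:R * loc a b x ^+ 2.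
  rewrite (eq_bigr (fun=> loc a b x ^+ 2)) => [|i _].
    by rewrite sumr_const card_ord mulr_natl.
  by rewrite (conformal_local_lambda lx _ _ conf).1; have [/(_ i i) [-> _ _] _] := Hfr; rewrite eqxx mulr1.
rewrite (local_xi lx); suff -> : loc a b x = 0 by rewrite scale0r.
(* Substituting xi(lambda) = 2 beta m lambda^2 into lambda xi(lambda) = 0 gives a nonzero multiple
   of lambda^3, because m > 0 and beta vanishes nowhere. *)
move: E1; rewrite E3 => /eqP; rewrite subr_eq0 => /eqP E1; move: E2; rewrite E1 => /eqP.
by rewrite !mulf_eq0 !pnatr_eq0 (negPf (beta_neq0 _)) (gtn_eqF m0) /= !orbb => /eqP.
Qed.

End Kenmotsu.
End ContactMaps.

Lemma contact_conformal_constant (R : realType) (m n : nat) (M : almost_contact_metric R m)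
    (N : almost_contact_metric R n) (k : M -> N) : (0 < m)%N ->
  smooth_map k -> weakly_conformal k -> constant_along_D k -> constant_map k.
Proof.
move=> m0 sk wc cD; apply: (conformal_constant sk wc) => a b x lx.
have [fr Hfr] := frame_atP lx; have [ee ex] := Hfr.
(* Positivity of m provides a unit vector orthogonal to xi, on which the differential vanishes. *)
exists (fr (Ordinal m0)); first by have [-> _ _] := ee (Ordinal m0) (Ordinal m0); rewrite eqxx.
apply: (cD a b x _ lx); rewrite (pairing_eta _ (local_dom_src lx)).
by have [] := ex (Ordinal m0).
Qed.

(** * Maps into almost Hermitian manifolds *)

Section HermitianMaps.
Context {R : realType} {m n : nat} {M : almost_contact_metric R m} {N : almost_hermitian R n}.
Context {f : M -> N} (sf : smooth_map f).
Hypothesis pm : pm_holomorphic f (@acm_phi R m M) (@ah_J R n N).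

Lemma hermitian_holomorphic_point a b x : local_dom f a b x -> exists s, [/\ s * s = 1,
  forall a b x, local_dom f a b x ->
    acm_phi a x *m diff_map f a b x = s *: (diff_map f a b x *m ah_J b (local_map f a b x))
  & holomorphic_point (acm_phi a x) (nabla_phi a x) (ah_J b (local_map f a b x))
      (nabla_J b (local_map f a b x)) (diff_map f a b x) (second_fundamental_form f a b x) s].
Proof.
move=> lx; have [s [/pm_sign ss hol]] := pm; exists s; split; [exact: ss|exact: hol|].
exact: (holomorphic_pointP sf (fun c y => @ah_J_differentiable _ _ _ c y) ss hol lx).
Qed.

Lemma hermitian_xi a b x : local_dom f a b x -> acm_xi a x *m diff_map f a b x = 0.
Proof.
by move=> lx; have [s [ss hol _]] := hermitian_holomorphic_point lx; exact: (diff_map_xi_hermitian ss hol lx).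
Qed.

Lemma hermitian_B_xi a b x v : local_dom f a b x ->
  second_fundamental_form f a b x v (acm_xi a x) = - (nabla_xi a x v *m diff_map f a b x).
Proof.
move=> lx; have [s [ss hol _]] := hermitian_holomorphic_point lx.
exact: (second_fundamental_form_xi_hermitian sf ss hol v lx).
Qed.

Lemma hermitian_harmonic : almost_semi_cosymplectic M -> class_C1 N -> harmonic_map f.
Proof.
move=> hM HN a b x lx; have [s [_ _ K]] := hermitian_holomorphic_point lx.
have [fr Hfr] := frame_atP lx; rewrite (tensionE sf lx Hfr).
apply: (tension_point_hermitian (acm_acm_point (local_dom_src lx)) K Hfr
  (coclosed_Omega_frame lx hM Hfr) (hermitian_xi lx)).
- by move=> u; exact: (class_C1_S (local_dom_tgt lx) u HN).
- by move=> u; exact: (ah_J2 u (local_dom_tgt lx)).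
- exact: hermitian_B_xi.
Qed.

Lemma hermitian_pluriharmonic : class_C1 N -> class_B1_restricted M -> pluriharmonic f.
Proof.
move=> HN HM a b x v lx; have [s [_ _ K]] := hermitian_holomorphic_point lx.
have J2 u := ah_J2 u (local_dom_tgt lx).
apply: (pluriharmonic_of_restricted (acm_acm_point (local_dom_src lx)) K
  (class_restricted_type HM (local_dom_src lx)) (hermitian_xi lx)).
- by move=> w; exact: hermitian_B_xi.
- move=> w _ /(congr1 (mulmx^~ (ah_J b (local_map f a b x)))); rewrite J2 mul0mx => /eqP.
  by rewrite oppr_eq0 => /eqP.
- by move=> w _; rewrite (class_C1_S (local_dom_tgt lx) _ HN) J2 subrr addr0.
Qed.

(** Here xi itself is the unit vector in the kernel: J F xi = s F(phi xi) = 0 and J is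
    invertible. *)
Lemma hermitian_conformal_constant : weakly_conformal f -> constant_map f.
Proof.
move=> wc; apply: (conformal_constant sf wc) => a b x lx; exists (acm_xi a x).
  exact: (acp_xi (acm_acm_point (local_dom_src lx))).
exact: hermitian_xi.
Qed.

End HermitianMaps.

Unset Implicit Arguments.
Set Strict Implicit.

Theorem theorem4p7 (R : realType) (m : nat) (hm : (0 < m)%N)
    (M : almost_contact_metric R m) (hM : almost_semi_cosymplectic M) :
  (forall (n : nat) (N : almost_contact_metric R n) (f : M -> N),
    smooth_map f -> pm_holomorphic f (@acm_phi R m M) (@acm_phi R n N) ->
    (* (1) *)
    (class_A1 N \/ class_A2 N \/ class_A3 N \/ class_A5 N \/ class_A6 N ->
       constant_along_D f /\
       ~ (exists k : M -> N,
            [/\ smooth_map k, pm_holomorphic k (@acm_phi R m M) (@acm_phi R n N),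
                weakly_conformal k & ~ constant_map k])) /\
    (* (2) *)
    (class_A1 N \/ class_A2 N \/ class_A3 N \/ class_A4 N \/ class_A5 N \/ class_A6 N ->
       forall lambda : M -> R, is_lambda f lambda ->
       (harmonic_map f <-> constant_along_xi lambda)) /\
    (* (3) *)
    (class_B1 N ->
       forall lambda : M -> R, is_lambda f lambda ->
       (harmonic_map f <-> constant_along_xi lambda) /\
       ((forall p, lambda p = 0) <-> maps_xi_to_zero f) /\
       ((forall p, lambda p = 0) -> class_B1_restricted M -> pluriharmonic f)) /\
    (* (4) *)
    (class_B1 N -> weakly_conformal f ->
       forall lambda : M -> R, is_lambda f lambda ->
       (constant_along_xi lambda ->
          [/\ harmonic_map f, homothetic f & minimal_image f]) /\
       (harmonic_map f -> forall p q, lambda p = lambda q)) /\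
    (* (5) *)
    (forall beta : N -> R, almost_beta_kenmotsu beta ->
       (forall lambda : M -> R, is_lambda f lambda ->
          (* (i) *)
          (harmonic_map f <->
             forall (a : chart M) (b : chart N) x, local_dom f a b x ->
             forall e : 'I_m -> 'rV[R]_((m.*2).+1), adapted_frame a x e ->
               'D_(acm_xi a x) (lambda \o param a) x
               - 2 * beta (f (param a x)) *
                 \sum_(i < m) inner (metric b (local_map f a b x))
                    (e i *m diff_map f a b x) (e i *m diff_map f a b x) = 0) /\
          (* (ii)(a) *)
          [/\ harmonic_map f -> constant_along_xi lambda -> constant_along_D f,
              harmonic_map f -> constant_along_D f -> constant_along_xi lambda
            & constant_along_xi lambda -> constant_along_D f -> harmonic_map f] /\
          (* (ii)(b) *)
          ((forall p, lambda p = 0) <-> maps_xi_to_zero f) /\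
          ((forall p, lambda p = 0) -> (harmonic_map f <-> constant_map f))) /\
       (* (iii) *)
       (weakly_conformal f -> (harmonic_map f <-> constant_map f))))
  /\
  (forall (n : nat) (N : almost_hermitian R n) (f : M -> N),
    smooth_map f -> pm_holomorphic f (@acm_phi R m M) (@ah_J R n N) ->
    (* (6) *)
    (class_C1 N ->
       harmonic_map f /\
       (class_B1_restricted M ->
          forall k : M -> N, smooth_map k ->
            pm_holomorphic k (@acm_phi R m M) (@ah_J R n N) ->
            pluriharmonic k /\ harmonic_map k)) /\
    (* (7) *)
    ~ (exists k : M -> N,
         [/\ smooth_map k, pm_holomorphic k (@acm_phi R m M) (@ah_J R n N),
             weakly_conformal k & ~ constant_map k])).
Proof.
split=> [n N f sf pm|n N f sf pm]; last first.
  split=> [HN|[k [sk pk wk nk]]].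
    split=> [|HM k sk pk]; first exact: (hermitian_harmonic sf pm hM HN).
    split; first exact: (hermitian_pluriharmonic sk pk HN HM).
    exact: (hermitian_harmonic sk pk hM HN).
  exact: (nk (hermitian_conformal_constant sk pk wk)).
split=> [HN|].
  split=> [|[k [sk pk wk nk]]]; first exact: (constant_along_D_contact hM sf pm HN).
  exact: (nk (contact_conformal_constant hm sk wk (constant_along_D_contact hM sk pk HN))).
split=> [HN lambda lam|].
  case: HN => [H|[H|[H|[H|H]]]]; try (by apply: (harmonic_iff_contact hM sf pm lam); auto).
  exact: (harmonic_iff_kenmotsu0 hM sf pm lam (or_introl H)).
split=> [HN lambda lam|].
  split; first exact: (harmonic_iff_kenmotsu0 hM sf pm lam (or_intror HN)).
  split; first exact: (lambda_zero_iff sf pm lam).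
  by move=> l0 HM; exact: (pluriharmonic_B1 sf pm lam HN HM l0).
split=> [HN wc lambda lam|beta Nb].
  have iff := harmonic_iff_kenmotsu0 hM sf pm lam (or_intror HN).
  split=> [lc|hf]; last exact: (conformal_harmonic_lambda sf pm hm lam wc hf).
  have hf := iff.2 lc; split; first exact: hf.
    exact: (conformal_homothetic sf pm lam wc (conformal_harmonic_lambda sf pm hm lam wc hf)).
  exact: (conformal_minimal_image sf pm wc hf).
split=> [lambda lam|wc]; last exact: (conformal_harmonic_constant_beta hM sf pm Nb hm wc).
split; first exact: (harmonic_iff_beta hM sf pm Nb lam).
split.
  split=> [hf lc|hf cD|lc cD]; first exact: (constant_along_D_beta hM sf pm Nb lam hf lc).
    exact: ((constant_along_xi_beta hM sf pm Nb lam cD).1 hf).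
  exact: ((constant_along_xi_beta hM sf pm Nb lam cD).2 lc).
split; first exact: (lambda_zero_iff sf pm lam).
by move=> l0; exact: (harmonic_constant_beta hM sf pm Nb lam l0).
Qed.
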